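(* Consider discrete polytope scheduling with group completion times (DPSP-G). Suppose that for some $\rho \ge 1$ there is a polynomial-time subroutine which, given any subset $J' \subseteq J$ of jobs, computes a feasible DPSP-G schedule of the jobs in $J'$ with makespan at most $\rho \cdot \max_{d \in [D]} \sum_{j \in J'} b_{d,j} p_j$. Then for every $\varepsilon > 0$ there is a polynomial-time $(2\rho e + \varepsilon)$-approximation algorithm for DPSP-G.
   Context: DPSP-G: We are given a set $J$ of $n$ jobs with processing requirements $p_j \ge 0$, a family $\mathcal{S} \subseteq 2^J$ of groups with weights $w_S > 0$, a matrix $B = (b_{d,j}) \in \mathbb{Q}_{\ge 0}^{D \times n}$ defining the downward-closed polytope $\mathcal{P} = \{y \in \mathbb{R}^n_{\ge 0} : By \le \mathbf{1}\}$, and (possibly implicitly) a subset $\mathcal{P}' \subseteq \mathcal{P}$ of allowed rate vectors. A schedule chooses at every time $t$ a rate vector $y(t) \in \mathcal{P}'$, and for every job $j$ there must be a start time $S_j$ and a value $y_j$ such that $y_j(t) = y_j$ for all $S_j \le t < C_j$ and $y_j(t) = 0$ for $t < S_j$ and $t \ge C_j$, where $C_j = \min\{t' : \int_0^{t'} y_j(t)\,\mathrm{d}t \ge p_j\}$ is the completion time of $j$. The group completion time is $C_S = \max_{j \in S} C_j$ and the objective is to minimize $\sum_{S} w_S C_S$. The makespan of a schedule is the maximum completion time of its jobs. An $\alpha$-approximation algorithm runs in polynomial time and outputs a feasible solution of objective at most $\alpha$ times the optimum. *)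

(* Defs.v *)
From HB Require Import structures.
From mathcomp Require Import all_boot all_order all_algebra.
From mathcomp Require Import all_classical all_reals all_analysis.
Import Order.TTheory GRing.Theory Num.Theory numFieldNormedType.Exports.

Set Implicit Arguments.
Unset Strict Implicit.
Unset Printing Implicit Defensive.

Local Open Scope classical_set_scope.
Local Open Scope ring_scope.

(* Polynomial time is measured in a point-free while-language over binary     *)
(* trees with exact rationals at the leaves.  Rationals are charged by        *)
(* bit length and every basic instruction is charged the full size of its     *)
(* input and of its output, without any sharing; hence the cost of a run      *)
(* bounds the size of all the data it handles, and cost and Turing machine    *)
(* time are polynomially related.                                             *)
Inductive data : Type :=
| Leaf of rat
| Pair of data & data.

Definition bitlen (n : nat) : nat := (trunc_log 2 n).+1.

Fixpoint vsize (v : data) : nat :=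
  match v with
  | Leaf q => (bitlen `|numq q| + bitlen `|denq q|).+1
  | Pair a b => (vsize a + vsize b).+1
  end.

Inductive prim : Type :=
  PId | PFst | PSnd | PIsPair | PAdd | PSub | PMul | PDiv | PLeq | PFloor.

Definition vbool (b : bool) : data := Leaf b%:R.

(* Ill-formed arguments yield Leaf 0. *)
Definition prim_sem (o : prim) (v : data) : data :=
  match o, v with
  | PId, _ => v
  | PFst, Pair a _ => a
  | PSnd, Pair _ b => b
  | PIsPair, Pair _ _ => vbool true
  | PAdd, Pair (Leaf a) (Leaf b) => Leaf (a + b)
  | PSub, Pair (Leaf a) (Leaf b) => Leaf (a - b)
  | PMul, Pair (Leaf a) (Leaf b) => Leaf (a * b)
  | PDiv, Pair (Leaf a) (Leaf b) => Leaf (a / b)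
  | PLeq, Pair (Leaf a) (Leaf b) => vbool (a <= b)
  | PFloor, Leaf a => Leaf (Num.floor a)%:~R
  | _, _ => Leaf 0
  end.

Definition vtrue (v : data) : bool := if v is Leaf q then q != 0 else true.

Inductive prog : Type :=
| Prim of prim
| Const of data
| Comp of prog & prog
| Fork of prog & prog
| If of prog & prog & prog
| While of prog & prog.

(* [exec f x y t]: on input x, f halts with output y at cost t. *)
Inductive exec : prog -> data -> data -> nat -> Prop :=
| ExecPrim o x : exec (Prim o) x (prim_sem o x) (vsize x + vsize (prim_sem o x))
| ExecConst v x : exec (Const v) x v (vsize x + vsize v)
| ExecComp g f x y z s t :
    exec f x y s -> exec g y z t -> exec (Comp g f) x z (s + t).+1
| ExecFork f g x y z s t :
    exec f x y s -> exec g x z t -> exec (Fork f g) x (Pair y z) (s + t).+1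
| ExecIfTrue c f g x b y s t :
    exec c x b s -> vtrue b -> exec f x y t -> exec (If c f g) x y (s + t).+1
| ExecIfFalse c f g x b y s t :
    exec c x b s -> ~~ vtrue b -> exec g x y t -> exec (If c f g) x y (s + t).+1
| ExecWhileStop c f x b s :
    exec c x b s -> ~~ vtrue b -> exec (While c f) x x s.+1
| ExecWhileStep c f x b y z s t u :
    exec c x b s -> vtrue b -> exec f x y t -> exec (While c f) y z u ->
    exec (While c f) x z (s + t + u).+1.

(* f solves in polynomial time the problem with inputs [dom], presented to    *)
(* the program through [enc], and acceptable outputs [good].                  *)
Definition solves_in_polytime (X : Type) (enc : X -> data) (dom : set X)
    (good : X -> data -> Prop) (f : prog) : Prop :=
  exists q : {poly nat}, forall x, dom x ->
    exists v t, [/\ exec f (enc x) v t, (t <= q.[vsize (enc x)])%N & good x v].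

(* [rates] is the set of allowed rate vectors; it may be given implicitly, so *)
(* an instance also carries the datum [rates_code] by which an algorithm      *)
(* learns about it.  How the two are related is part of the class of          *)
(* instances under consideration.                                             *)
Record instance (R : realType) := Instance {
  njobs : nat;
  proc : 'I_njobs -> rat;
  groups : {set {set 'I_njobs}};
  weight : {set 'I_njobs} -> rat;
  nrows : nat;
  bmat : 'M[rat]_(nrows, njobs);
  rates : set 'rV[R]_njobs;
  rates_code : data
}.

Arguments proc {R} _ _.
Arguments weight {R} _ _.
Arguments rates {R} _ _.

Section Scheduling.
Variable R : realType.
Implicit Types (I : instance R).

Definition polytope I : set 'rV[R]_(njobs I) :=
  [set y | (forall j, 0 <= y 0 j) /\
           (forall d, \sum_j ratr (bmat I d j) * y 0 j <= 1)].
Arguments polytope : clear implicits.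

Definition valid I : Prop :=
  [/\ forall j, 0 <= proc I j,
      forall S, S \in groups I -> 0 < weight I S,
      forall d j, 0 <= bmat I d j,
      bounded_set (polytope I) &
      rates I `<=` polytope I].

(* Schedules are functions of time; only times t >= 0 are relevant. *)
Definition finished I (y : R -> 'rV[R]_(njobs I)) (j : 'I_(njobs I)) : set R :=
  [set t | 0 <= t /\
    ((ratr (proc I j))%:E <=
       \int[lebesgue_measure]_(s in `[0%R, t]) (y s 0%R j)%:E)%E].

(* A minimum whenever the schedule is feasible and j is scheduled. *)
Definition completion I (y : R -> 'rV[R]_(njobs I)) (j : 'I_(njobs I)) : R :=
  inf (finished y j).

Definition feasible I (J : {set 'I_(njobs I)}) (y : R -> 'rV[R]_(njobs I)) :
    Prop :=
  [/\ forall t, 0 <= t -> rates I (y t),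
      forall j, j \in J ->
        finished y j (completion y j) /\
        exists start rate : R, 0 <= start /\
          forall t, 0 <= t ->
            y t 0 j = if start <= t < completion y j then rate else 0 &
      forall j, j \notin J -> forall t, 0 <= t -> y t 0 j = 0].

Definition makespan I (J : {set 'I_(njobs I)}) (y : R -> 'rV[R]_(njobs I)) : R :=
  \big[Num.max/0]_(j in J) completion y j.

Definition group_completion I (y : R -> 'rV[R]_(njobs I))
    (S : {set 'I_(njobs I)}) : R :=
  \big[Num.max/0]_(j in S) completion y j.

Definition objective I (y : R -> 'rV[R]_(njobs I)) : R :=
  \sum_(S in groups I) ratr (weight I S) * group_completion y S.

Definition optimum I : R :=
  inf [set objective y | y in feasible [set: 'I_(njobs I)]].

Definition max_load I (J : {set 'I_(njobs I)}) : rat :=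
  \big[Num.max/0]_(d < nrows I) \sum_(j in J) bmat I d j * proc I j.

Definition enc_list (s : seq data) : data := foldr Pair (Leaf 0) s.

Definition enc_set n (A : {set 'I_n}) : data :=
  enc_list [seq vbool (j \in A) | j <- enum 'I_n].

Definition enc_instance I : data :=
  enc_list [::
    enc_list [seq Leaf (proc I j) | j <- enum 'I_(njobs I)];
    enc_list [seq Pair (enc_set A) (Leaf (weight I A)) | A <- enum (groups I)];
    enc_list [seq enc_list [seq Leaf (bmat I d j) | j <- enum 'I_(njobs I)]
             | d <- enum 'I_(nrows I)];
    rates_code I].

(* Algorithms output a schedule as a start time and a rate for every job; a   *)
(* job of rate 0 is never processed.                                          *)
Definition enc_schedule n (start rate : 'I_n -> rat) : data :=
  enc_list [seq Pair (Leaf (start j)) (Leaf (rate j)) | j <- enum 'I_n].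

Definition schedule_of I (start rate : 'I_(njobs I) -> rat) :
    R -> 'rV[R]_(njobs I) :=
  fun t => \row_j
    (if ratr (start j) <= t < ratr (start j + proc I j / rate j)
     then ratr (rate j) else 0).

Definition outputs_schedule I (v : data) (y : R -> 'rV[R]_(njobs I)) : Prop :=
  exists start rate : 'I_(njobs I) -> rat,
    v = enc_schedule start rate /\ y = schedule_of start rate.

Definition makespan_subroutine (K : set (instance R)) (rho : R) (f : prog) :
    Prop :=
  solves_in_polytime
    (fun x : {I : instance R & {set 'I_(njobs I)}} =>
       Pair (enc_instance (projT1 x)) (enc_set (projT2 x)))
    [set x | K (projT1 x)]
    (fun x v => exists y, [/\ outputs_schedule v y, feasible (projT2 x) y &
       makespan (projT2 x) y <= rho * ratr (max_load (projT2 x))])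
    f.

Definition approximation_algorithm (K : set (instance R)) (alpha : R)
    (f : prog) : Prop :=
  solves_in_polytime (@enc_instance) K
    (fun I v => exists y, [/\ outputs_schedule v y,
       feasible [set: 'I_(njobs I)] y &
       objective y <= alpha * optimum I])
    f.

End Scheduling.

(* Main.v *)
Require Import Defs.
From mathcomp Require Import all_boot all_order all_algebra.
From mathcomp Require Import all_classical all_reals all_analysis.
From mathcomp Require Import measurable_realfun.
From mathcomp Require Import zify ring lra.
Import Order.TTheory GRing.Theory Num.Theory numFieldNormedType.Exports.

(* Only the times a ^ m with a = 1 + 1 / N matter.  By time a ^ m a schedule has
   completed a set of jobs whose load is at most a ^ m on every row, and keeping only
   this consequence gives a mixed packing and covering program: with x_(m,j) the part
   of job j done and v_(m,S) the part of group S missing at time a ^ m, one asks for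
   x_(m,j) + v_(m,S) >= 1 when j is in S, for loads of x_m at most a ^ m, and for
   sum_(m,S) w_S a^m v_(m,S) <= V.  Multiplicative weights solve it up to a factor
   1 + O(1/N), raising one variable by 1/K at a time.

   For a threshold i <= K and a shift s < N, stage k consists of the jobs j not placed
   before with x_(Nk+s,j) >= i/K; its load is at most about (K/i) a^(Nk+s).  Averaging
   over s loses a ^ N <= e, since group S waits for stage k + 1 only if it misses at
   least 1 - i/K at time a^(Nk+s), and averaging over i with weights proportional to i
   loses a factor 2.  Trying all guesses of V, thresholds and shifts, and running the
   subroutine on the stages of the cheapest choice one after another, loses rho. *)

Set Implicit Arguments.
Unset Strict Implicit.
Unset Printing Implicit Defensive.

Local Open Scope classical_set_scope.
Local Open Scope ring_scope.

(** * Polynomially bounded functions and polynomial-time functions *)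

(** The constants have a continuous origin. A threshold t in (0, 1] inflates loads by 1 / t. The
    density 2 t cancels this factor and leaves the integral over t of the indicator that a group
    misses at least 1 - t, which is the missing part itself; the normalisation of the density is the
    2. For the shift, suppose that stages are M levels apart. All levels below a completion time c
    sum to about N c, a group pays a stage a^M times as long as the level at which it was still
    missing something, and averaging divides by M. The loss a^M N / M is about e^(M/N) N / M, which
    is least for M = N, where it is e.

    No optimal fractional solution enters: the solver is compared directly with the 0/1 point read
    off a schedule. Since each variable of that point is 0 or 1, variables with a coefficient above
    1 can be discarded beforehand, and this keeps the width at 1. Variables are raised one unit at a
    time, so a fractional solution is just a list of variables with repetitions, and its size grows
    by a bounded amount in each round. *)

Definition polybounded (g : nat -> nat) : Prop :=
  exists q : {poly nat}, forall n, (g n <= q.[n])%N.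

Lemma horner_nat_homo (q : {poly nat}) : {homo (fun n => q.[n]) : m n / (m <= n)%N}.
Proof.
move=> m n mn; rewrite !horner_coef; apply: leq_sum => i _.
rewrite leq_mul2l; apply/orP; right.
by elim: (nat_of_ord i) => // k IH; rewrite !exprS leq_mul.
Qed.

Lemma horner_natD (p q : {poly nat}) n : (p + q).[n] = (p.[n] + q.[n])%N.
Proof. exact: hornerD. Qed.

Lemma horner_natM (p q : {poly nat}) n : (p * q).[n] = (p.[n] * q.[n])%N.
Proof. exact: hornerM. Qed.

Lemma horner_nat_comp (p q : {poly nat}) n : (p \Po q).[n] = p.[q.[n]].
Proof. exact: horner_comp. Qed.

Lemma polybounded_cst c : polybounded (fun=> c).
Proof. by exists c%:P => n; rewrite hornerC. Qed.

Lemma polybounded_id : polybounded id.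
Proof. by exists 'X => n; rewrite hornerX. Qed.

Lemma polybounded_add f g : polybounded f -> polybounded g ->
  polybounded (fun n => f n + g n)%N.
Proof.
by move=> [p fp] [q gq]; exists (p + q) => n; rewrite hornerD leq_add.
Qed.

Lemma polybounded_mul f g : polybounded f -> polybounded g ->
  polybounded (fun n => f n * g n)%N.
Proof.
by move=> [p fp] [q gq]; exists (p * q) => n; rewrite hornerM leq_mul.
Qed.

Lemma polybounded_horner (q : {poly nat}) f : polybounded f ->
  polybounded (fun n => q.[f n]).
Proof.
by move=> [p fp]; exists (q \Po p) => n; rewrite horner_comp horner_nat_homo.
Qed.

Lemma polybounded_succ f : polybounded f -> polybounded (fun n => (f n).+1).
Proof.
move=> pf; under eq_fun do rewrite -addn1.
by apply: polybounded_add => //; exact: polybounded_cst.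
Qed.

Ltac solve_polybounded :=
  repeat first [ exact: polybounded_cst | exact: polybounded_id
    | apply: polybounded_succ | apply: polybounded_add
    | apply: polybounded_mul | apply: polybounded_horner ].

(** Each instruction is charged for its input and its output. A time bound is therefore also a bound
    on the size of the result, which is what makes polynomial time closed under composition. *)
Lemma exec_size f x y t : exec f x y t -> (vsize x <= t /\ vsize y <= t)%N.
Proof.
by elim=> {f x y t} /=; intros; rewrite /=; lia.
Qed.

(** * Bit length of rationals *)

Lemma bitlen_gt0 n : (0 < bitlen n)%N. Proof. by []. Qed.

Lemma bitlenP n : (n < 2 ^ bitlen n)%N.
Proof. by rewrite /bitlen trunc_log_ltn. Qed.

Lemma bitlen_le n k : (0 < k)%N -> (n < 2 ^ k)%N -> (bitlen n <= k)%N.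
Proof.
move=> k0 nk; rewrite /bitlen; case: n nk => [|n] nk; first by rewrite trunc_log0.
rewrite -(ltn_exp2l _ _ (isT : 1 < 2)%N) (leq_ltn_trans _ nk)//.
by have /andP[] := trunc_log_bounds (isT : 1 < 2)%N (isT : 0 < n.+1)%N.
Qed.

(** The size of a sum can count the denominator of one summand twice, so [vsize] is not additive.
    [height] is additive up to 1 under sums and products, and it agrees with [vsize] up to a factor
    of about 2. *)
Definition height (q : rat) : nat := maxn (bitlen `|numq q|) (bitlen `|denq q|).

Lemma height_gt0 q : (0 < height q)%N.
Proof. by rewrite /height leq_max bitlen_gt0. Qed.

Lemma vsize_Leaf q : (height q < vsize (Leaf q) <= (height q).*2.+1)%N.
Proof. by rewrite /height /=; have := bitlen_gt0 `|numq q|; have := bitlen_gt0 `|denq q|; lia.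
  Qed.

Lemma height_ltnum q : (`|numq q| < 2 ^ height q)%N.
Proof. by rewrite (leq_trans (bitlenP _))// leq_exp2l// leq_maxl. Qed.

Lemma height_ltden q : (`|denq q| < 2 ^ height q)%N.
Proof. by rewrite (leq_trans (bitlenP _))// leq_exp2l// leq_maxr. Qed.

(** Reducing a fraction only shrinks its two entries, so bounds may be read off an unreduced
    form. *)
Lemma height_frac (n d : int) k : (0 < k)%N -> (`|n| < 2 ^ k)%N -> (`|d| < 2 ^ k)%N ->
  (height (n%:~R / d%:~R) <= k)%N.
Proof.
move=> k0; case: divqP => [|e x e0]; first by move=> _ _; rewrite /height /= geq_max /bitlen
  trunc_log0 trunc_log1 k0.
rewrite !abszM /height geq_max => nk dk; rewrite -absz_gt0 in e0.
by rewrite !bitlen_le// ?(leq_ltn_trans (leq_pmull _ e0) nk) ?(leq_ltn_trans (leq_pmull _ e0) dk).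
Qed.

Lemma heightD a b : (height (a + b) <= (height a + height b).+1)%N.
Proof.
rewrite -{1}(divq_num_den a) -{1}(divq_num_den b) addf_div ?intr_eq0 ?denq_eq0//.
rewrite -!intrM -intrD; apply: height_frac => //.
  rewrite (leq_ltn_trans (_ : _ <= `|(numq a * denq b)%R|%N + `|(numq b * denq a)%R|%N)%N)//;
    first by lia.
  rewrite expnS mul2n -addnn expnD !abszM -addnS leq_add//.
    by rewrite ltnW// ltn_mul// ?height_ltnum ?height_ltden.
  by rewrite mulnC ltn_mul// ?height_ltnum ?height_ltden.
rewrite abszM (@leq_trans (2 ^ (height a + height b)))//.
  by rewrite expnD ltn_mul// height_ltden.
by rewrite leq_exp2l.
Qed.

Lemma heightM a b : (height (a * b) <= height a + height b)%N.
Proof.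
rewrite -{1}(divq_num_den a) -{1}(divq_num_den b) mulf_div -!intrM.
apply: height_frac; first by have := height_gt0 a; lia.
  by rewrite abszM expnD ltn_mul// height_ltnum.
by rewrite abszM expnD ltn_mul// height_ltden.
Qed.

Lemma heightV a : (height a^-1 <= height a)%N.
Proof.
rewrite -{1}(divq_num_den a) invf_div; apply: height_frac; first exact: height_gt0.
  exact: height_ltden.
exact: height_ltnum.
Qed.

Lemma height_nat n : (height n%:R <= n.+1)%N.
Proof.
have -> : n%:R = (n%:Z)%:~R / (1 : int)%:~R :> rat by rewrite divr1 -pmulrn.
apply: height_frac => //.
  by rewrite absz_nat (leq_trans (ltn_expl n (isT : 1 < 2)%N))// leq_exp2l.
by rewrite /= expnS; have := expn_gt0 2 n; lia.
Qed.

(** * Encoded types and polynomial-time functions *)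

Class Enc (A : Type) := encode : A -> data.
Instance enc_data : Enc data := id.
Instance enc_rat : Enc rat := Leaf.
Instance enc_bool : Enc bool := vbool.
(** A natural number is stored in binary. A loop of [n] rounds is thus exponential in the size of
    [n], and round counts have to come from the lengths of lists. *)
Instance enc_nat : Enc nat := fun n => Leaf n%:R.
Instance enc_prod A B {EA : Enc A} {EB : Enc B} : Enc (A * B) :=
  fun p => Pair (encode p.1) (encode p.2).
Instance enc_seq A {EA : Enc A} : Enc (seq A) :=
  fun s => enc_list (map encode s).

Definition vsz A (_ : Enc A) (a : A) : nat := vsize (encode a).
Arguments vsz {A _} a.

(** The bound is required at every value of type [A]; a restricted domain of inputs is expressed by
    a subtype. *)
Definition polytime A B (_ : Enc A) (_ : Enc B) (F : A -> B) : Prop :=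
  exists f (q : {poly nat}), forall a, exists t,
    exec f (encode a) (encode (F a)) t /\ (t <= q.[vsz a])%N.
Arguments polytime {A B _ _} F.

Lemma polytimeP A B {EA : Enc A} {EB : Enc B} (F : A -> B) :
  polytime F <-> exists f g, polybounded g /\
    forall a, exists t, exec f (encode a) (encode (F a)) t /\ (t <= g (vsz a))%N.
Proof.
split=> [[f [q H]]|[f [g [[q gq] H]]]].
  by exists f, (fun n => q.[n]); split=> //; exists q.
exists f, q => a; have [t [ft tg]] := H a.
by exists t; split => //; exact: leq_trans tg (gq _).
Qed.

Lemma polytime_size A B {EA : Enc A} {EB : Enc B} (F : A -> B) :
  polytime F -> exists q : {poly nat}, forall a, (vsz (F a) <= q.[vsz a])%N.
Proof.
move=> [f [q H]]; exists q => a; have [t [ft tq]] := H a.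
by have [_ /leq_trans ->] := exec_size ft.
Qed.

Section Closure.
Context {A B C D : Type} {EA : Enc A} {EB : Enc B} {EC : Enc C} {ED : Enc D}.

Lemma polytime_eq (F G : A -> B) : F =1 G -> polytime F -> polytime G.
Proof. by move=> /funext ->. Qed.

(** The second program is only required to work on data of the form [encode (F a)], and its result
    may depend on [a]. This suits a subroutine that is specified on well-formed inputs alone. *)
Lemma polytime_after (F : A -> B) (H : A -> C) : polytime F ->
  (exists g (q : {poly nat}), forall a, exists t,
    exec g (encode (F a)) (encode (H a)) t /\ (t <= q.[vsz (F a)])%N) ->
  polytime H.
Proof.
move=> [f [p Hf]] [g [q Hg]]; apply/polytimeP.
exists (Comp g f), (fun n => (p.[n] + q.[p.[n]]).+1)%N; split; first by solve_polybounded.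
move=> a; have [s [es sp]] := Hf a; have [t [et tq]] := Hg a.
exists (s + t).+1; split; first exact: ExecComp es et.
rewrite ltnS leq_add// (leq_trans tq)// horner_nat_homo// (leq_trans _ sp)//.
by case: (exec_size es).
Qed.

Lemma polytime_comp (F : A -> B) (G : B -> C) :
  polytime F -> polytime G -> polytime (fun x => G (F x)).
Proof.
move=> pF [g [q Hg]]; apply: (polytime_after pF).
by exists g, q => a; exact: Hg.
Qed.

Lemma polytime_pair (F : A -> B) (G : A -> C) :
  polytime F -> polytime G -> polytime (fun x => (F x, G x)).
Proof.
move=> [f [p Hf]] [g [q Hg]]; apply/polytimeP.
exists (Fork f g), (fun n => (p.[n] + q.[n]) + 1)%N; split; first by solve_polybounded.
move=> a; have [s [es sp]] := Hf a; have [t [et tq]] := Hg a.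
exists (s + t).+1; split; first exact: ExecFork es et.
by rewrite addn1 ltnS leq_add.
Qed.

Lemma polytime_prim (F : A -> B) o (q : {poly nat}) :
  (forall a, encode (F a) = prim_sem o (encode a)) ->
  (forall a, (vsz (F a) <= q.[vsz a])%N) -> polytime F.
Proof.
move=> Fo Fq; apply/polytimeP; exists (Prim o), (fun n => n + q.[n])%N; split; first by
  solve_polybounded.
move=> a; exists (vsz a + vsz (F a))%N; split; last by rewrite leq_add2l.
by rewrite /vsz Fo; exact: ExecPrim.
Qed.

Lemma polytime_cst (b : B) : polytime (fun _ : A => b).
Proof.
apply/polytimeP; exists (Const (encode b)), (fun n => n + vsz b)%N; split; first by
  solve_polybounded.
by move=> a; exists (vsz a + vsz b)%N; split => //; exact: ExecConst.
Qed.

End Closure.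

Lemma polytime_id A {EA : Enc A} : polytime (fun x : A => x).
Proof. by apply: (@polytime_prim _ _ _ _ _ PId 'X) => // a; rewrite hornerX. Qed.

Section Closure2.
Context {A B C D : Type} {EA : Enc A} {EB : Enc B} {EC : Enc C} {ED : Enc D}.

Lemma polytime_fst (F : A -> B * C) : polytime F -> polytime (fun x => (F x).1).
Proof.
move=> pF; apply: (polytime_comp (G := fst) pF); apply: (@polytime_prim _ _ _ _ _ PFst 'X) =>
  // a.
by rewrite hornerX /vsz /=; lia.
Qed.

Lemma polytime_snd (F : A -> B * C) : polytime F -> polytime (fun x => (F x).2).
Proof.
move=> pF; apply: (polytime_comp (G := snd) pF); apply: (@polytime_prim _ _ _ _ _ PSnd 'X) =>
  // a.
by rewrite hornerX /vsz /=; lia.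
Qed.

Lemma polytime_op2 (H : B -> C -> D) (F : A -> B) (G : A -> C) :
  polytime (fun p : B * C => H p.1 p.2) -> polytime F -> polytime G ->
  polytime (fun x => H (F x) (G x)).
Proof. by move=> pH pF pG; exact: (polytime_comp (polytime_pair pF pG) pH). Qed.

(** A nonempty list has the same encoding as the pair of its head and its tail, so the program for
    pairing serves unchanged. *)
Lemma polytime_cons (F : A -> B) (G : A -> seq B) :
  polytime F -> polytime G -> polytime (fun x => F x :: G x).
Proof. by move=> pF pG; have [f] := polytime_pair pF pG; exists f. Qed.

Lemma polytime_if (b : A -> bool) (F G : A -> B) :
  polytime b -> polytime F -> polytime G ->
  polytime (fun x => if b x then F x else G x).
Proof.
move=> [c [r Hc]] [f [p Hf]] [g [q Hg]]; apply/polytimeP.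
exists (If c f g), (fun n => r.[n] + (p.[n] + q.[n]) + 1)%N; split; first by solve_polybounded.
move=> a; have [s [es sp]] := Hf a; have [t [et tq]] := Hg a.
have [u [eu ur]] := Hc a.
rewrite /encode /enc_bool /vbool in eu; case: (b a) eu => eu.
  exists (u + s).+1; split; first exact: ExecIfTrue eu _ es.
  by rewrite /vsz addn1 ltnS leq_add// (leq_trans sp)// leq_addr.
exists (u + t).+1; split; first exact: ExecIfFalse eu _ et.
by rewrite /vsz addn1 ltnS leq_add// (leq_trans tq)// leq_addl.
Qed.

Lemma polytime_nilp (F : A -> seq B) : polytime F -> polytime (fun x => ~~ nilp (F x)).
Proof.
move=> pF; apply: (polytime_comp (G := fun s => ~~ nilp s) pF).
apply: (@polytime_prim _ _ _ _ _ PIsPair 5%N%:P); first by case.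
by case=> [|b s]; rewrite hornerC.
Qed.

End Closure2.

Ltac polytime_step :=
  lazymatch goal with
  | |- @polytime _ _ _ _ (fun _ => ?c) => exact: polytime_cst
  | |- @polytime _ _ _ _ (fun x => x) => exact: polytime_id
  | |- @polytime _ _ _ _ (fun x => fst (@?F x)) => refine (@polytime_fst _ _ _ _ _ _ F _)
  | |- @polytime _ _ _ _ (fun x => snd (@?F x)) => refine (@polytime_snd _ _ _ _ _ _ F _)
  | |- @polytime _ _ _ _ (fun x => pair (@?F x) (@?G x)) =>
      refine (@polytime_pair _ _ _ _ _ _ F G _ _)
  | |- @polytime _ _ _ _ (fun x => cons (@?F x) (@?G x)) =>
      refine (@polytime_cons _ _ _ _ F G _ _)
  | |- _ => simple apply polytime_if
  end.
Ltac solve_polytime := repeat polytime_step.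

Section Case.
Context {A B C : Type} {EA : Enc A} {EB : Enc B} {EC : Enc C}.

(* On a nonempty list, reading the encoding as that of a pair gives head and tail. *)
Lemma polytime_case (L : A -> seq B) (F : A -> C) (G : A -> B -> seq B -> C) :
  polytime L -> polytime F ->
  polytime (fun p : A * (B * seq B) => G p.1 p.2.1 p.2.2) ->
  polytime (fun a => match L a with [::] => F a | b :: s => G a b s end).
Proof.
move=> pL; have [l [r Hl]] := pL; have [c [k Hc]] := polytime_nilp pL.
move=> [f [p Hf]] [g [q Hg]]; apply/polytimeP.
exists (If c (Comp g (Fork (Prim PId) l)) f).
exists (fun n => k.[n] + (p.[n] + (q.[(n + r.[n]).+1] + (n + n + r.[n] + 1) + 1)) + 1)%N;
  split; first by solve_polybounded.
move=> a; have [s [es sp]] := Hf a; have [u [eu ur]] := Hc a.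
have [w [ew wr]] := Hl a.
rewrite -/(vsz a) in sp ur wr *.
case: (L a) eu ew => [|b t] eu ew.
  exists (u + s).+1; split; first exact: ExecIfFalse eu _ es.
  by rewrite addn1 ltnS leq_add// (leq_trans sp)// leq_addr.
have [z [ez zq]] := Hg (a, (b, t)).
exists (u + ((vsz a + vsz a + w).+1 + z).+1).+1; split.
  apply: ExecIfTrue eu _ _ => //; apply: (ExecComp _ ez).
  exact: (ExecFork (ExecPrim PId _) ew).
have zz : (z <= q.[(vsz a + r.[vsz a]).+1])%N.
  apply: (leq_trans zq); apply: horner_nat_homo.
  have [_ zw] := exec_size ew.
  by rewrite /vsz /= ltnS leq_add2l (leq_trans _ wr).
lia.
Qed.

End Case.

(** * Loops and folds *)

Lemma exec_while c f (st : nat -> data) n T :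
  (forall k, (k < n)%N -> exists b t, [/\ exec c (st k) b t, vtrue b & (t <= T)%N]) ->
  (forall k, (k < n)%N -> exists t, exec f (st k) (st k.+1) t /\ (t <= T)%N) ->
  (exists b t, [/\ exec c (st n) b t, ~~ vtrue b & (t <= T)%N]) ->
  exists t, exec (While c f) (st 0%N) (st n) t /\ (t <= n.+1 * (T + T + 1))%N.
Proof.
elim: n st => [|n IH] st Hc Hf [b [t [eb bF tT]]].
  by exists t.+1; split; [exact: ExecWhileStop eb bF|lia].
have [b0 [t0 [eb0 b0T t0T]]] := Hc 0%N isT.
have [t1 [e1 t1T]] := Hf 0%N isT.
have [|||t2 [e2 t2T]] := IH (st \o succn).
- by move=> k kn; exact: Hc.
- by move=> k kn; exact: Hf.
- by exists b, t.
exists (t0 + t1 + t2).+1; split; last by rewrite mulSn; lia.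
exact: ExecWhileStep eb0 b0T e1 e2.
Qed.

Lemma vtrueE (b : bool) : vtrue (encode b) = b.
Proof. by case: b. Qed.

Section Iter.
Context {A B : Type} {EA : Enc A} {EB : Enc B}.

(** A polynomial number of rounds does not suffice, since repeated squaring doubles the size in each
    round. Hence [r] has to bound the state throughout the run. *)
Lemma polytime_iter (init : A -> B) (cond : B -> bool) (step : B -> B) (n : A -> nat)
    (q r : {poly nat}) :
  polytime init -> polytime cond -> polytime step ->
  (forall a k, (k < n a)%N -> cond (iter k step (init a))) ->
  (forall a, ~~ cond (iter (n a) step (init a))) ->
  (forall a, (n a <= q.[vsz a])%N) ->
  (forall a k, (k <= n a)%N -> (vsz (iter k step (init a)) <= r.[vsz a])%N) ->
  polytime (fun a => iter (n a) step (init a)).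
Proof.
move=> [i [pi Hi]] [c [pc Hc]] [f [pf Hf]] ct cf nq sr; apply/polytimeP.
exists (Comp (While c f) i).
pose T m := (pc.[r.[m]] + pf.[r.[m]])%N.
exists (fun m => pi.[m] + (q.[m] + 1) * (T m + T m + 1) + 1)%N; split; first by solve_polybounded.
move=> a; have [t0 [e0 t0i]] := Hi a.
pose st k := @encode B EB (iter k step (init a)).
have [|||t [et tT]] := @exec_while c f st (n a) (T (vsz a)).
- move=> k ka; have [t [et tc]] := Hc (iter k step (init a)).
  eexists; exists t; split; [exact: et| |].
    by rewrite ct.
  rewrite (leq_trans tc)// /T (leq_trans _ (leq_addr _ _))// horner_nat_homo//.
  by rewrite sr// ltnW.
- move=> k ka; have [t [et tc]] := Hf (iter k step (init a)).
  exists t; split => //.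
  rewrite (leq_trans tc)// /T (leq_trans _ (leq_addl _ _))// horner_nat_homo//.
  by rewrite sr// ltnW.
- have [t [et tc]] := Hc (iter (n a) step (init a)).
  eexists; exists t; split; [exact: et| |].
    by rewrite vtrueE; exact: cf.
  rewrite (leq_trans tc)// /T (leq_trans _ (leq_addr _ _))// horner_nat_homo//.
  by rewrite sr.
exists (t0 + t).+1; split; first exact: ExecComp e0 et.
rewrite addn1 ltnS leq_add// (leq_trans tT)// leq_mul// addn1 ltnS; exact: nq.
Qed.

End Iter.

Lemma vsz_cons A {EA : Enc A} (x : A) s : vsz (x :: s) = (vsz x + vsz s).+1.
Proof. by []. Qed.

Lemma vsz_cat A {EA : Enc A} (s1 s2 : seq A) : (vsz (s1 ++ s2) <= vsz s1 + vsz s2)%N.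
Proof. by elim: s1 => [|x s1 IH]; [rewrite leq_addl|rewrite cat_cons !vsz_cons; lia]. Qed.

Lemma vsz_catl A {EA : Enc A} (s1 s2 : seq A) : (vsz s1 <= vsz (s1 ++ s2) + 3)%N.
Proof. by elim: s1 => [|x s1 IH]; [rewrite leq_addl|rewrite cat_cons !vsz_cons; lia]. Qed.

Lemma vsz_catr A {EA : Enc A} (s1 s2 : seq A) : (vsz s2 <= vsz (s1 ++ s2))%N.
Proof. by elim: s1 => [|x s1 IH] //; rewrite cat_cons !vsz_cons; lia. Qed.

Lemma size_vsz A {EA : Enc A} (s : seq A) : (size s <= vsz s)%N.
Proof. by elim: s => [|x s1 IH] //=; rewrite vsz_cons; lia. Qed.

Lemma vsz_rev A {EA : Enc A} (s : seq A) : vsz (rev s) = vsz s.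
Proof.
elim: s => // x s IH; rewrite rev_cons -cats1 vsz_cons -IH.
by elim: (rev s) => [|y t]; rewrite ?cat_cons !vsz_cons /= ?addn0; lia.
Qed.

Lemma vsz_pair A B {EA : Enc A} {EB : Enc B} (p : A * B) : vsz p = (vsz p.1 + vsz p.2).+1.
Proof. by []. Qed.

Section Fold.
Context {A B C : Type} {EA : Enc A} {EB : Enc B} {EC : Enc C}.

(** The loop state carries the argument [a], the unread part of the list and the accumulator; only
    the accumulator can grow, so it is the one to be bounded, on every prefix. *)
Lemma polytime_foldl (L : A -> seq B) (f : A -> C -> B -> C) (z : A -> C) (r : {poly nat}) :
  polytime L -> polytime z ->
  polytime (fun p : A * (B * C) => f p.1 p.2.2 p.2.1) ->
  (forall a s1 s2, L a = s1 ++ s2 -> (vsz (foldl (f a) (z a) s1) <= r.[vsz a])%N) ->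
  polytime (fun a => foldl (f a) (z a) (L a)).
Proof.
move=> pL pz pf rP.
pose st := (A * (seq B * C))%type.
pose init a : st := (a, (L a, z a)).
pose cond (p : st) := ~~ nilp p.2.1.
pose step (p : st) : st :=
  match p.2.1 with [::] => p | b :: s => (p.1, (s, f p.1 p.2.2 b)) end.
have iterE a k : (k <= size (L a))%N ->
    iter k step (init a) = (a, (drop k (L a), foldl (f a) (z a) (take k (L a)))).
  elim: k => [|k IH] ka; first by rewrite drop0 take0.
  rewrite iterS IH ?(ltnW ka)// /step /=.
  have [b [s1 [s2 [sk Ls]]]] : exists b s1 s2, size s1 = k /\ L a = s1 ++ b :: s2.
    case: (L a) ka => // b0 t0; set t := b0 :: t0 => ka.
    exists (nth b0 t k), (take k t), (drop k.+1 t).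
    by rewrite size_takel ?(ltnW ka)// -drop_nth// cat_take_drop.
  rewrite Ls drop_size_cat// take_size_cat// -cat_rcons.
  by rewrite drop_size_cat ?size_rcons ?sk// take_size_cat ?size_rcons ?sk// foldl_rcons.
have -> : (fun a => foldl (f a) (z a) (L a)) = (fun a => (iter (size (L a)) step (init a)).2.2).
  by apply/funext => a; rewrite iterE// take_size.
do 2!apply: polytime_snd.
have [q qP] := polytime_size pL.
apply: (@polytime_iter _ _ _ _ init cond step (fun a => size (L a)) q ('X + (q + 3%N%:P + r) +
  3%N%:P)).
- apply: polytime_pair; first exact: polytime_id.
  exact: polytime_pair.
- apply: polytime_nilp; apply: polytime_fst; apply: polytime_snd; exact: polytime_id.
- apply: polytime_case; first by apply: polytime_fst; apply: polytime_snd; exact: polytime_id.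
    exact: polytime_id.
  apply: polytime_pair; first by do 2!apply: polytime_fst; exact: polytime_id.
  apply: polytime_pair; first by do 2!apply: polytime_snd; exact: polytime_id.
  apply: (polytime_comp (F := fun p : st * (B * seq B) => (p.1.1, (p.2.1, p.1.2.2))) _ pf).
  solve_polytime.
- by move=> a k ka; rewrite iterE ?(ltnW ka)// /cond /= /nilp size_drop subn_eq0 -ltnNge.
- by move=> a; rewrite iterE// /cond /= drop_size.
- by move=> a; exact: leq_trans (size_vsz _) (qP a).
move=> a k ka; rewrite iterE// !horner_natD hornerX !hornerC !vsz_pair /=.
have := rP a _ _ (esym (cat_take_drop k (L a))).
have := @vsz_catr _ EB (take k (L a)) (drop k (L a)); rewrite cat_take_drop.
have := qP a.
lia.
Qed.

End Fold.

Lemma polytime_rev A B {EA : Enc A} {EB : Enc B} (L : A -> seq B) :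
  polytime L -> polytime (fun a => rev (L a)).
Proof.
move=> pL; apply: (polytime_comp (G := rev) pL).
have revE (s t : seq B) : foldl (fun acc b => b :: acc) t s = rev s ++ t.
  by elim: s t => //= x s IH t; rewrite IH rev_cons cat_rcons.
apply: (@polytime_eq _ _ _ _ (fun s : seq B => foldl (fun acc b => b :: acc) [::] s)).
  by move=> s; rewrite revE cats0.
apply: (@polytime_foldl _ _ _ _ _ _ (fun s : seq B => s) (fun _ acc b => b :: acc) (fun=> [::])
  ('X + 3%N%:P)).
- exact: polytime_id.
- exact: polytime_cst.
- solve_polytime.
move=> a s1 s2 ->; rewrite revE cats0 vsz_rev horner_natD hornerX hornerC.
exact: vsz_catl.
Qed.

Section Foldr.
Context {A B C : Type} {EA : Enc A} {EB : Enc B} {EC : Enc C}.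

(** One step raises [mu] by an amount that depends on the argument and the list entry but not on the
    accumulator, so the growth is linear in the length of the list. The measure is left open because
    rational accumulators need [height], while lists can use [vsize]. *)
Lemma polytime_foldr (L : A -> seq B) (f : A -> B -> C -> C) (z : A -> C)
    (mu : C -> nat) (r g : {poly nat}) :
  polytime L -> polytime z ->
  polytime (fun p : A * (B * C) => f p.1 p.2.1 p.2.2) ->
  (forall c, (mu c <= r.[vsz c])%N) ->
  (forall c, (vsz c <= r.[mu c])%N) ->
  (forall a b c, (mu (f a b c) <= mu c + g.[(vsz a + vsz b)%N])%N) ->
  polytime (fun a => foldr (f a) (z a) (L a)).
Proof.
move=> pL pz pf mur rmu fg.
have [q qP] := polytime_size pL; have [qz qzP] := polytime_size pz.
apply: (@polytime_eq _ _ _ _ (fun a => foldl (fun c b => f a b c) (z a) (rev (L a)))).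
  by move=> a; rewrite foldl_rev.
apply: (@polytime_foldl _ _ _ _ _ _ (fun a => rev (L a)) (fun a c b => f a b c) z
  (r \Po (r \Po qz + q * (g \Po ('X + q))))) => //.
  exact: polytime_rev.
move=> a s1 s2 Ls; rewrite !horner_nat_comp horner_natD horner_natM !horner_nat_comp
  horner_natD hornerX.
apply: (leq_trans (rmu _)); apply: horner_nat_homo.
have main : forall s, (vsz s <= q.[vsz a])%N ->
    (mu (foldr (f a) (z a) s) <= r.[qz.[vsz a]] + size s * g.[(vsz a + q.[vsz a])%N])%N.
  elim=> [|b s IH] sq /=.
    by rewrite mul0n addn0 (leq_trans (mur _))// horner_nat_homo.
  rewrite vsz_cons in sq; rewrite mulSn (leq_trans (fg _ _ _))//.
  rewrite (addnC g.[_]) addnA leq_add ?IH//; first by lia.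
  by apply: horner_nat_homo; rewrite leq_add2l; lia.
have s1q : (vsz (rev s1) <= q.[vsz a])%N.
  rewrite (leq_trans _ (qP a))// -(revK (L a)) Ls rev_cat.
  exact: vsz_catr.
have := main _ s1q; rewrite -foldl_rev revK => /leq_trans; apply.
by rewrite leq_add2l leq_mul2r (leq_trans (size_vsz _) s1q) orbT.
Qed.

Lemma polytime_foldr_vsz (L : A -> seq B) (f : A -> B -> C -> C) (z : A -> C) (g : {poly nat}) :
  polytime L -> polytime z ->
  polytime (fun p : A * (B * C) => f p.1 p.2.1 p.2.2) ->
  (forall a b c, (vsz (f a b c) <= vsz c + g.[(vsz a + vsz b)%N])%N) ->
  polytime (fun a => foldr (f a) (z a) (L a)).
Proof.
move=> pL pz pf fg; apply: (polytime_foldr (mu := vsz) (r := 'X) pL pz pf _ _ fg).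
  by move=> c; rewrite hornerX.
by move=> c; rewrite hornerX.
Qed.

End Foldr.

(** * Arithmetic on rationals and naturals *)

Lemma vsz_nat (n : nat) : vsz n = (bitlen n + 2)%N.
Proof.
have -> : vsz n = (bitlen `|numq n%:R| + bitlen `|denq n%:R|).+1 by [].
have -> : n%:R = (n%:Z)%:~R :> rat by rewrite -pmulrn.
by rewrite numq_int denq_int absz_nat /= {2}/bitlen trunc_log1; lia.
Qed.

Lemma bitlenS n : (bitlen n.+1 <= (bitlen n).+1)%N.
Proof.
apply: bitlen_le => //; rewrite expnS.
by have := bitlenP n; have := expn_gt0 2 (bitlen n); lia.
Qed.

Lemma bitlen_leq n : (bitlen n <= n.+1)%N.
Proof. by apply: bitlen_le => //; rewrite (leq_trans (ltn_expl n (isT : 1 < 2)%N))// leq_exp2l.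
  Qed.

Section Arith.
Context {A : Type} {EA : Enc A}.

Lemma polytime_ratD (F G : A -> rat) : polytime F -> polytime G -> polytime (fun x => F x + G x).
Proof.
apply: (polytime_op2 (H := fun a b : rat => a + b)); apply: (@polytime_prim _ _ _ _ _ PAdd ('X
  + 'X + 3%N%:P)) => // -[a b].
rewrite !horner_natD !hornerX hornerC vsz_pair /=.
by have := heightD a b; have := vsize_Leaf (a + b); have := vsize_Leaf a; have := vsize_Leaf b;
  rewrite /vsz /encode /enc_rat; lia.
Qed.

Lemma polytime_ratM (F G : A -> rat) : polytime F -> polytime G -> polytime (fun x => F x * G x).
Proof.
apply: (polytime_op2 (H := fun a b : rat => a * b)); apply: (@polytime_prim _ _ _ _ _ PMul ('X
  + 'X + 3%N%:P)) => // -[a b].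
rewrite !horner_natD !hornerX hornerC vsz_pair /=.
by have := heightM a b; have := vsize_Leaf (a * b); have := vsize_Leaf a; have := vsize_Leaf b;
  rewrite /vsz /encode /enc_rat; lia.
Qed.

Lemma polytime_ratdiv (F G : A -> rat) : polytime F -> polytime G -> polytime (fun x => F x / G
  x).
Proof.
apply: (polytime_op2 (H := fun a b : rat => a / b)); apply: (@polytime_prim _ _ _ _ _ PDiv ('X
  + 'X + 3%N%:P)) => // -[a b].
rewrite !horner_natD !hornerX hornerC vsz_pair /=.
by have := heightM a b^-1; have := heightV b; have := vsize_Leaf (a / b); have := vsize_Leaf a;
  have := vsize_Leaf b;
  rewrite /vsz /encode /enc_rat; lia.
Qed.

Lemma polytime_ratV (F : A -> rat) : polytime F -> polytime (fun x => (F x)^-1).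
Proof.
move=> pF; apply: (@polytime_eq _ _ _ _ (fun x => 1 / F x)); first by move=> x; rewrite div1r.
by apply: polytime_ratdiv => //; exact: polytime_cst.
Qed.

Lemma vsz_bool (b : bool) : (vsz b <= 3)%N.
Proof. by case: b. Qed.

Lemma polytime_ratle (F G : A -> rat) : polytime F -> polytime G -> polytime (fun x => F x <= G
  x).
Proof.
apply: (polytime_op2 (H := fun a b : rat => a <= b)); apply: (@polytime_prim _ _ _ _ _ PLeq
  (3%N%:P)) => // -[a b].
by rewrite hornerC vsz_bool.
Qed.

Lemma polytime_and (F G : A -> bool) : polytime F -> polytime G -> polytime (fun x => F x && G x).
Proof. by move=> pF pG; apply: polytime_if => //; exact: polytime_cst. Qed.

Lemma polytime_or (F G : A -> bool) : polytime F -> polytime G -> polytime (fun x => F x || G x).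
Proof. by move=> pF pG; apply: polytime_if => //; exact: polytime_cst. Qed.

Lemma polytime_neg (F : A -> bool) : polytime F -> polytime (fun x => ~~ F x).
Proof. by move=> pF; apply: polytime_if => //; exact: polytime_cst. Qed.

Lemma polytime_ratlt (F G : A -> rat) : polytime F -> polytime G -> polytime (fun x => F x < G x).
Proof.
move=> pF pG; under eq_fun do rewrite ltNge.
by apply: polytime_neg; exact: polytime_ratle.
Qed.

Lemma polytime_rateq (F G : A -> rat) : polytime F -> polytime G -> polytime (fun x => F x == G
  x).
Proof.
move=> pF pG; under eq_fun do rewrite eq_le.
by apply: polytime_and; exact: polytime_ratle.
Qed.

(** Both sides unfold to the same statement, because a natural number is encoded as the
    corresponding rational; arithmetic on naturals is thus inherited from the rationals. *)
Lemma polytime_of_natr (F : A -> nat) : polytime (fun x => (F x)%:R : rat) -> polytime F.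
Proof. by []. Qed.

Lemma polytime_natle (F G : A -> nat) : polytime F -> polytime G -> polytime (fun x => (F x <=
  G x)%N).
Proof.
move=> pF pG; under eq_fun do rewrite -(ler_nat rat).
exact: polytime_ratle.
Qed.

Lemma polytime_addn (F G : A -> nat) : polytime F -> polytime G -> polytime (fun x => (F x + G
  x)%N).
Proof.
move=> pF pG; apply: polytime_of_natr; under eq_fun do rewrite natrD.
exact: polytime_ratD.
Qed.

Lemma polytime_succn (F : A -> nat) : polytime F -> polytime (fun x => (F x).+1).
Proof.
move=> pF; under eq_fun do rewrite -addn1.
by apply: polytime_addn => //; exact: polytime_cst.
Qed.

Lemma polytime_muln (F G : A -> nat) : polytime F -> polytime G -> polytime (fun x => (F x * G
  x)%N).
Proof.
move=> pF pG; apply: polytime_of_natr; under eq_fun do rewrite natrM.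
exact: polytime_ratM.
Qed.

Lemma polytime_nateq (F G : A -> nat) : polytime F -> polytime G -> polytime (fun x => F x == G
  x).
Proof.
move=> pF pG; under eq_fun do rewrite eqn_leq.
by apply: polytime_and; exact: polytime_natle.
Qed.

Lemma polytime_booleq (F G : A -> bool) : polytime F -> polytime G -> polytime (fun x => F x ==
  G x).
Proof.
move=> pF pG; apply: (@polytime_eq _ _ _ _ (fun x => if F x then G x else ~~ G x)).
  by move=> x; case: (F x); case: (G x).
by apply: polytime_if => //; exact: polytime_neg.
Qed.

End Arith.

(** * Functions on lists *)

Section Lists.
Context {A B C : Type} {EA : Enc A} {EB : Enc B} {EC : Enc C}.

Lemma polytime_map (L : A -> seq B) (H : A -> B -> C) :
  polytime L -> polytime (fun p : A * B => H p.1 p.2) ->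
  polytime (fun a => [seq H a b | b <- L a]).
Proof.
move=> pL pH; have [q qP] := polytime_size pH.
apply: (@polytime_foldr_vsz _ _ _ _ _ _ L (fun a b acc => H a b :: acc) (fun=> [::])
  ((q \Po ('X + 1%N%:P)) + 1%N%:P)) => //; first exact: polytime_cst.
  by solve_polytime; apply: (polytime_comp (F := fun p : A * (B * seq C) => (p.1, p.2.1)) _ pH);
    solve_polytime.
move=> a b c; rewrite vsz_cons horner_natD horner_nat_comp !horner_natD !hornerX !hornerC.
have := qP (a, b); rewrite vsz_pair /= !addn1; lia.
Qed.

Lemma polytime_flatten (L : A -> seq (seq B)) : polytime L -> polytime (fun a => flatten (L a)).
Proof.
have catE (s t : seq B) : s ++ t = foldr cons t s by elim: s => //= x s ->.
move=> pL; apply: (@polytime_foldr_vsz _ _ _ _ _ _ L (fun _ s acc => s ++ acc) (fun=> [::]) 'X)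
  => //.
- exact: polytime_cst.
- under eq_fun do rewrite catE.
  apply: (@polytime_foldr_vsz _ _ _ _ _ _ (fun p : A * (seq B * seq B) => p.2.1) (fun _ b acc
    => b :: acc)
    (fun p => p.2.2) ('X + 1%N%:P)); [solve_polytime..|].
  by move=> a b c; rewrite vsz_cons horner_natD hornerX hornerC; lia.
by move=> a b c; rewrite hornerX (leq_trans (vsz_cat _ _))//; lia.
Qed.

Lemma polytime_cat (F G : A -> seq B) : polytime F -> polytime G -> polytime (fun a => F a ++ G
  a).
Proof.
move=> pF pG; apply: (@polytime_eq _ _ _ _ (fun a => flatten [:: F a; G a])).
  by move=> a; rewrite /= cats0.
by apply: polytime_flatten; repeat apply: polytime_cons => //; exact: polytime_cst.
Qed.

Lemma polytime_filter (L : A -> seq B) (P : A -> B -> bool) :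
  polytime L -> polytime (fun p : A * B => P p.1 p.2) ->
  polytime (fun a => [seq b <- L a | P a b]).
Proof.
move=> pL pP; apply: (@polytime_foldr_vsz _ _ _ _ _ _ L (fun a b acc => if P a b then b :: acc
  else acc)
   (fun=> [::]) ('X + 1%N%:P)) => //; first exact: polytime_cst.
  solve_polytime; apply: (polytime_comp (F := fun p : A * (B * seq B) => (p.1, p.2.1)) _ pP).
  solve_polytime.
move=> a b c; rewrite horner_natD hornerX hornerC; case: ifP => _; rewrite ?vsz_cons; lia.
Qed.

Lemma polytime_has (L : A -> seq B) (P : A -> B -> bool) :
  polytime L -> polytime (fun p : A * B => P p.1 p.2) ->
  polytime (fun a => has (P a) (L a)).
Proof.
move=> pL pP; apply: (@polytime_eq _ _ _ _ (fun a => ~~ nilp [seq b <- L a | P a b])).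
  by move=> a; rewrite /nilp size_filter has_count lt0n.
by apply: polytime_nilp; exact: polytime_filter.
Qed.

Lemma polytime_find (L : A -> seq B) (P : A -> B -> bool) :
  polytime L -> polytime (fun p : A * B => P p.1 p.2) ->
  polytime (fun a => find (P a) (L a)).
Proof.
move=> pL pP; apply: (@polytime_eq _ _ _ _
    (fun a => foldr (fun b n => if P a b then 0%N else n.+1) 0%N (L a))).
  by move=> a; elim: (L a) => //= b s <-; case: (P a b).
apply: (@polytime_foldr_vsz _ _ _ _ _ _ L (fun a b n => if P a b then 0%N else n.+1) _ 1%N%:P)
  => //;
  first exact: polytime_cst.
  apply: polytime_if; first by apply: (polytime_comp (F := fun p : A * (B * nat) => (p.1,
    p.2.1)) _ pP);
    solve_polytime.
    exact: polytime_cst.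
  by apply: polytime_succn; solve_polytime.
move=> a b c; rewrite hornerC; case: ifP => _; rewrite !vsz_nat; first by rewrite /bitlen
  trunc_log0; lia.
by have := bitlenS c; lia.
Qed.

Lemma polytime_size_seq (L : A -> seq B) : polytime L -> polytime (fun a => size (L a)).
Proof.
move=> pL; apply: (@polytime_eq _ _ _ _ (fun a => foldr (fun _ n => n.+1) 0%N (L a))).
  by move=> a; elim: (L a) => //= b s <-.
apply: (@polytime_foldr_vsz _ _ _ _ _ _ L (fun _ _ n => n.+1) _ 1%N%:P) => //;
  first exact: polytime_cst.
  by apply: polytime_succn; solve_polytime.
by move=> a b c; rewrite hornerC !vsz_nat; have := bitlenS c; lia.
Qed.

End Lists.

Lemma polytime_all {A B : Type} {EA : Enc A} {EB : Enc B} (L : A -> seq B) (P : A -> B -> bool) :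
  polytime L -> polytime (fun p : A * B => P p.1 p.2) ->
  polytime (fun a => all (P a) (L a)).
Proof.
move=> pL pP; under eq_fun do rewrite -[all _ _]negbK -has_predC.
by apply: polytime_neg; apply: (polytime_has (P := fun a b => ~~ P a b)) => //; exact:
  polytime_neg.
Qed.

(** Ranges arise only as the positions of an existing list, which keeps their length below the size
    of the data at hand. *)
Definition indices A (s : seq A) : seq nat := iota 0 (size s).

Lemma polytime_indices {A B : Type} {EA : Enc A} {EB : Enc B} (L : A -> seq B) :
  polytime L -> polytime (fun a => indices (L a)).
Proof.
move=> pL; apply: (polytime_comp (G := @indices B) pL).
have iotaE (s : seq B) : foldl (fun l _ => size l :: l) [::] s = rev (indices s).
  elim/last_ind: s => // s x IH.
  by rewrite foldl_rcons IH size_rev /indices size_iota size_rcons -addn1 iotaD rev_cat.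
apply: (@polytime_eq _ _ _ _ (fun s : seq B => rev (foldl (fun l _ => size l :: l) [::] s))).
  by move=> s; rewrite iotaE revK.
apply: polytime_rev.
apply: (@polytime_foldl _ _ _ _ _ _ (fun s : seq B => s) (fun _ (l : seq nat) _ => size l :: l)
  (fun=> [::])
   ('X * ('X + 7%N%:P) + 3%N%:P)).
- exact: polytime_id.
- exact: polytime_cst.
- by solve_polytime; apply: polytime_size_seq; solve_polytime.
move=> a s1 s2 ->; rewrite iotaE vsz_rev horner_natD horner_natM horner_natD !hornerX !hornerC.
have := @size_vsz _ EB (s1 ++ s2); rewrite size_cat.
move: (vsz (s1 ++ s2)) => v sv.
have : (forall m n, m + n <= v -> vsz (iota m n) <= n * (v + 7) + 3)%N.
  move=> m n; elim: n m => [|n IH] m mn //; rewrite [iota _ _]/= vsz_cons vsz_nat mulSn.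
  have := bitlen_leq m; have := IH m.+1; rewrite addSnnS => /(_ mn); lia.
move=> /(_ 0%N (size s1)); rewrite -/(indices s1) => H.
apply: (leq_trans (H _)); first by rewrite add0n (leq_trans _ sv)// leq_addr.
by rewrite leq_add2r leq_mul2r (leq_trans _ sv) ?orbT// leq_addr.
Qed.

(** Reading from the right, position [i] is reached when the length of the suffix read plus [i]
    equals the length of the list. A position beyond the end never triggers this, and the default
    survives. *)
Lemma polytime_nth {A B : Type} {EA : Enc A} {EB : Enc B} (d : A -> B) (L : A -> seq B) (n : A
  -> nat) :
  polytime d -> polytime L -> polytime n -> polytime (fun a => nth (d a) (L a) (n a)).
Proof.
move=> pd pL pn.
pose st (t : seq B) (i : nat) (b : B) (r : nat * B) := (r.1.+1, if r.1.+1 + i == size t then b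
  else r.2)%N.
apply: (@polytime_eq _ _ _ _ (fun a => (foldr (st (L a) (n a)) (0%N, d a) (L a)).2)).
  move=> a; move: (L a) (n a) (d a) => s i x0.
  have H (s2 s1 : seq B) : s = s1 ++ s2 ->
      foldr (st s i) (0%N, x0) s2 = (size s2, if (i < size s1)%N then x0 else nth x0 s i).
    elim: s2 s1 => [|b s2 IH] s1 Es /=.
      by rewrite Es cats0; case: ltnP => // /(nth_default x0) ->.
    rewrite (IH (rcons s1 b)) ?cat_rcons// /st /= size_rcons; congr pair.
    rewrite Es size_cat /= addnC eqn_add2r; case: (ltngtP i (size s1)) => [i1|i1|->].
    - by rewrite ltnS ltnW.
    - by rewrite ltnS leqNgt i1.
    - by rewrite nth_cat ltnn subnn.
  by rewrite (H s [::]).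
apply: polytime_snd.
apply: (@polytime_foldr_vsz _ _ _ _ _ _ L (fun a => st (L a) (n a)) (fun a => (0%N, d a)) ('X +
  2%N%:P)) => //.
- by apply: polytime_pair => //; exact: polytime_cst.
- rewrite /st; solve_polytime.
  + by apply: polytime_succn; solve_polytime.
  + apply: polytime_nateq.
      apply: polytime_addn; first by apply: polytime_succn; solve_polytime.
      by apply: (polytime_comp (F := fun p : A * (B * (nat * B)) => p.1) _ pn); solve_polytime.
    apply: polytime_size_seq.
    by apply: (polytime_comp (F := fun p : A * (B * (nat * B)) => p.1) _ pL); solve_polytime.
move=> a b [k c]; rewrite horner_natD hornerX hornerC !vsz_pair /= !vsz_nat.
by have := bitlenS k; case: ifP => _; lia.
Qed.

(** Big operators with list and summand as plain arguments, in a form that syntax-directed tactics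
    can recognise. *)
Definition rsum A (s : seq A) (F : A -> rat) : rat := \sum_(i <- s) F i.
Definition rprod A (s : seq A) (F : A -> rat) : rat := \prod_(i <- s) F i.

Lemma height_vsz (q : rat) : (height q <= vsz q <= (height q).*2.+1)%N.
Proof. by have /andP[/ltnW ? ?] := vsize_Leaf q; apply/andP. Qed.

Section Big.
Context {A B : Type} {EA : Enc A} {EB : Enc B}.

Lemma polytime_rsum (L : A -> seq B) (F : A -> B -> rat) :
  polytime L -> polytime (fun p : A * B => F p.1 p.2) -> polytime (fun a => rsum (L a) (F a)).
Proof.
move=> pL pF; have [q qP] := polytime_size pF.
apply: (@polytime_eq _ _ _ _ (fun a => foldr (fun b x => F a b + x) 0 (L a))).
  by move=> a; rewrite /rsum unlock.
apply: (@polytime_foldr A B rat _ _ _ L (fun a b x => F a b + x) (fun=> 0) height ('X + 'X +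
  1%N%:P)
  ((q \Po ('X + 1%N%:P)) + 1%N%:P)) => //.
- exact: polytime_cst.
- apply: polytime_ratD; last by solve_polytime.
  by apply: (polytime_comp (F := fun p : A * (B * rat) => (p.1, p.2.1)) _ pF); solve_polytime.
- by move=> c; rewrite !horner_natD hornerX hornerC; have := height_vsz c; lia.
- by move=> c; rewrite !horner_natD hornerX hornerC; have := height_vsz c; lia.
move=> a b c; rewrite horner_natD horner_nat_comp !horner_natD hornerX !hornerC !addn1.
have := heightD (F a b) c; have := qP (a, b); rewrite vsz_pair /=.
by have := height_vsz (F a b); lia.
Qed.

Lemma polytime_rprod (L : A -> seq B) (F : A -> B -> rat) :
  polytime L -> polytime (fun p : A * B => F p.1 p.2) -> polytime (fun a => rprod (L a) (F a)).
Proof.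
move=> pL pF; have [q qP] := polytime_size pF.
apply: (@polytime_eq _ _ _ _ (fun a => foldr (fun b x => F a b * x) 1 (L a))).
  by move=> a; rewrite /rprod unlock.
apply: (@polytime_foldr A B rat _ _ _ L (fun a b x => F a b * x) (fun=> 1) height ('X + 'X +
  1%N%:P)
  ((q \Po ('X + 1%N%:P)) + 1%N%:P)) => //.
- exact: polytime_cst.
- apply: polytime_ratM; last by solve_polytime.
  by apply: (polytime_comp (F := fun p : A * (B * rat) => (p.1, p.2.1)) _ pF); solve_polytime.
- by move=> c; rewrite !horner_natD hornerX hornerC; have := height_vsz c; lia.
- by move=> c; rewrite !horner_natD hornerX hornerC; have := height_vsz c; lia.
move=> a b c; rewrite horner_natD horner_nat_comp !horner_natD hornerX !hornerC !addn1.
have := heightM (F a b) c; have := qP (a, b); rewrite vsz_pair /=.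
by have := height_vsz (F a b); lia.
Qed.

End Big.

(* The zeros are irrelevant: lists serve as unary numbers, which drive the loops. *)
Definition log_fuel (q : rat) : seq nat :=
  nseq (find (fun k => q <= 2 ^+ k) (iota 0 (bitlen `|numq q|))) 0%N.

Lemma le_exp_bitlen (q : rat) : q <= 2 ^+ bitlen `|numq q|.
Proof.
have : q <= `|numq q|%N%:R.
  apply: (le_trans (ler_norm q)); rewrite -{1}(divq_num_den q) normrM normfV.
  rewrite -!intr_norm -!abszE -!pmulrn ler_pdivrMr; last by rewrite ltr0n absz_gt0 denq_eq0.
  by rewrite ler_peMr// ler1n absz_gt0 denq_eq0.
move=> /le_trans; apply.
by rewrite -natrX ler_nat ltnW// bitlenP.
Qed.

Lemma log_fuelP (q : rat) : q <= 2 ^+ size (log_fuel q).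
Proof.
rewrite /log_fuel size_nseq.
set b := bitlen _; pose P k := q <= 2 ^+ k; rewrite -/P.
have [bf|fb] := leqP b (find P (iota 0 b)).
  by rewrite (le_trans (le_exp_bitlen q))// ler_weXn2l// ler1n.
have hP : has P (iota 0 b) by rewrite has_find size_iota.
by have := nth_find 0%N hP; rewrite nth_iota.
Qed.

(** The number is halved until it is at most 1, with one list entry added per halving. The bit
    length of the numerator bounds the number of rounds. *)
Lemma polytime_log_fuel {A : Type} {EA : Enc A} (F : A -> rat) :
  polytime F -> polytime (fun a => log_fuel (F a)).
Proof.
move=> pF; apply: (polytime_comp (G := log_fuel) pF).
pose step (p : rat * seq nat) := (p.1 / 2, 0%N :: p.2).
pose n q := find (fun k => q <= 2 ^+ k) (iota 0 (bitlen `|numq q|)).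
have nb (q : rat) : (n q <= vsz q)%N.
  rewrite (leq_trans (find_size _ _))// size_iota.
  by have := height_vsz q; rewrite /height; lia.
have iterE q k : iter k step (q, [::]) = (q / 2 ^+ k, nseq k 0%N).
  elim: k => [|k IH]; first by rewrite expr0 divr1.
  by rewrite iterS IH /step exprSr invfM mulrA.
apply: (@polytime_eq _ _ _ _ (fun q => (iter (n q) step (q, [::])).2)).
  by move=> q; rewrite iterE.
apply: polytime_snd.
apply: (@polytime_iter _ _ _ _ (fun q : rat => (q, [::])) (fun p => 1 < p.1) step n 'X
  (('X + 'X + 'X + 'X + 'X + 'X + 10%N%:P) + ('X * 4%N%:P))).
- solve_polytime.
- by apply: polytime_ratlt; [exact: polytime_cst|apply: polytime_fst; exact: polytime_id].
- apply: polytime_pair; last by solve_polytime.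
  by apply: polytime_ratdiv; [apply: polytime_fst; exact: polytime_id|exact: polytime_cst].
- move=> q k kn; rewrite iterE /= ltr_pdivlMr ?exprn_gt0// mul1r ltNge.
  have := before_find 0%N kn; rewrite nth_iota ?add0n; first by move=> ->.
  by rewrite (leq_trans kn)// -[X in (_ <= X)%N](size_iota 0) find_size.
- move=> q; rewrite iterE /= -leNgt ler_pdivrMr ?exprn_gt0// mul1r.
  by have := log_fuelP q; rewrite /log_fuel size_nseq.
- by move=> q; rewrite hornerX.
move=> q k kn; rewrite iterE vsz_pair /= !horner_natD horner_natM !hornerX !hornerC.
have kv := leq_trans kn (nb q).
have nsv : (vsz (nseq k 0%N) <= k * 4 + 3)%N.
  elim: k {kn kv} => // k IH; rewrite /= vsz_cons mulSn vsz_nat /bitlen trunc_log0; lia.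
have h2 : (height (2 ^- k) <= k.*2.+1)%N.
  rewrite (leq_trans (heightV _))//; elim: k {kn kv nsv} => [|k IH].
    by rewrite expr0; have := height_nat 0; rewrite /height.
  by rewrite exprS (leq_trans (heightM _ _))//.
have := heightM q (2 ^- k); have := height_vsz q; have := height_vsz (q / 2 ^+ k).
have : (vsz (nseq k 0%N) <= vsz q * 4 + 3)%N by rewrite (leq_trans nsv)// leq_add2r leq_mul2r
  kv orbT.
lia.
Qed.

(** * Multiplicative weights for packing and covering *)

Section MultiplicativeWeights.
Variables (PR CR U : eqType) (prs : seq PR) (crs : seq CR) (vs : seq U).
Variables (pc : PR -> U -> rat) (cc : CR -> U -> bool) (e : rat) (K : nat).
Implicit Types h : seq U.

Definition pack_weight h i := rprod h (fun u => 1 + e * pc i u).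
(** A row covered [K] times is dropped by giving it weight 0. Hence the total vanishes exactly when
    all rows are covered [K] times, and a nonzero weight is at least [(1 - e) ^+ K]. *)
Definition cover_weight h r :=
  if (count (cc r) h < K)%N then rprod h (fun u => if cc r u then 1 - e else 1) else 0.
Definition pack_total h := rsum prs (pack_weight h).
Definition cover_total h := rsum crs (cover_weight h).
Definition pack_gain h u := rsum prs (fun i => pack_weight h i * pc i u).
Definition cover_gain h u := rsum crs (fun r => if cc r u then cover_weight h r else 0).
(** This compares [pack_gain / pack_total] with [cover_gain / cover_total], multiplied out so that
    no total has to be nonzero. A positive covering gain ensures that some active row profits. *)
Definition eligible h u :=
  (0 < cover_gain h u) && (pack_gain h u * cover_total h <= cover_gain h u * pack_total h).
Definition mw_step h :=
  match [seq u <- vs | eligible h u] with [::] => h | u :: _ => u :: h end.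

Hypothesis e_bounds : 0 < e <= 2^-1.
Hypothesis pc_bounds : forall i u, i \in prs -> u \in vs -> 0 <= pc i u <= 1.

Let e_ge0 : 0 <= e. Proof. by case/andP: e_bounds => /ltW. Qed.
Let e'_gt0 : 0 < 1 - e. Proof. by case/andP: e_bounds => _ ?; lra. Qed.
Let e'_le1 : 1 - e <= 1. Proof. by rewrite lerBlDr lerDl. Qed.

Lemma cover_weightE h r :
  cover_weight h r = if (count (cc r) h < K)%N then (1 - e) ^+ count (cc r) h else 0.
Proof.
rewrite /cover_weight; case: ifP => // _; rewrite /rprod -big_mkcond /=.
by rewrite big_const_seq iter_mulr_1.
Qed.

Lemma cover_weight_ge0 h r : 0 <= cover_weight h r.
Proof. by rewrite cover_weightE; case: ifP => // _; rewrite exprn_ge0// ltW. Qed.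

Lemma cover_weight_gt0 h r : (0 < cover_weight h r) = (count (cc r) h < K)%N.
Proof. by rewrite cover_weightE; case: ifP; rewrite ?ltxx// exprn_gt0. Qed.

Lemma cover_weight_lb h r : 0 < cover_weight h r -> (1 - e) ^+ K <= cover_weight h r.
Proof.
rewrite cover_weight_gt0 cover_weightE => cK; rewrite cK.
by rewrite ler_wiXn2l ?(ltnW cK)// ltW.
Qed.

Lemma pack_weight_gt0 h i : i \in prs -> {subset h <= vs} -> 0 < pack_weight h i.
Proof.
move=> ip hv; rewrite /pack_weight /rprod big_seq; apply: prodr_gt0 => u /hv uv.
have /andP[p0 _] := pc_bounds ip uv.
by rewrite ltr_wpDr// mulr_ge0.
Qed.

Lemma pack_total_ge0 h : {subset h <= vs} -> 0 <= pack_total h.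
Proof. by move=> hv; rewrite /pack_total /rsum big_seq sumr_ge0// => i /pack_weight_gt0/(_
  hv)/ltW. Qed.

Lemma cover_total_ge0 h : 0 <= cover_total h.
Proof. by rewrite /cover_total /rsum sumr_ge0// => r _; exact: cover_weight_ge0. Qed.

Lemma pack_gain_ge0 h u : {subset h <= vs} -> u \in vs -> 0 <= pack_gain h u.
Proof.
move=> hv uv; rewrite /pack_gain /rsum big_seq sumr_ge0// => i ip.
by rewrite mulr_ge0 ?(ltW (pack_weight_gt0 _ _))//; case/andP: (pc_bounds ip uv).
Qed.

Lemma cover_gain_ge0 h u : 0 <= cover_gain h u.
Proof. by rewrite /cover_gain /rsum sumr_ge0// => r _; case: ifP => // _; exact:
  cover_weight_ge0. Qed.

(* Averaging over a feasible integral solution: were no variable eligible, every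
   variable would gain more relative packing weight than relative covering weight. *)
Lemma eligible_exists (sol : pred U) h : {subset h <= vs} ->
  (forall i, i \in prs -> \sum_(u <- vs | sol u) pc i u <= 1) ->
  (forall r, r \in crs -> has (fun u => sol u && cc r u) vs) ->
  0 < cover_total h -> has (eligible h) vs.
Proof.
move=> hv solP solC C0; apply/negPn/negP => /hasPn nel.
have D0 u : u \in vs -> 0 <= pack_gain h u * cover_total h - cover_gain h u * pack_total h.
  move=> uv; move: (nel u uv); rewrite /eligible negb_and -leNgt -ltNge subr_ge0 =>
    /orP[Bu|/ltW//].
  have -> : cover_gain h u = 0 by apply/eqP; rewrite eq_le Bu cover_gain_ge0.
  by rewrite mul0r mulr_ge0 ?cover_total_ge0// pack_gain_ge0.
have sumP : \sum_(u <- vs | sol u) pack_gain h u <= pack_total h.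
  rewrite /pack_gain /rsum exchange_big /= /pack_total /rsum [leLHS]big_seq [leRHS]big_seq.
  apply: ler_sum => i ip; rewrite -mulr_sumr ler_piMr ?solP//.
  exact: ltW (pack_weight_gt0 _ _).
have sumC : cover_total h <= \sum_(u <- vs | sol u) cover_gain h u.
  rewrite /cover_gain /rsum exchange_big /= /cover_total /rsum [leLHS]big_seq [leRHS]big_seq.
  apply: ler_sum => r /solC /hasP[u uv /andP[su ru]].
  rewrite (perm_big _ (perm_to_rem uv)) /= big_cons su ru lerDl sumr_ge0// => w _.
  by case: ifP => // _; exact: cover_weight_ge0.
have : \sum_(u <- vs | (u \in vs) && sol u) (pack_gain h u * cover_total h - cover_gain h u *
  pack_total h) <= 0.
  rewrite -big_seq_cond sumrB -!mulr_suml subr_le0 mulrC.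
  apply: (@le_trans _ _ (cover_total h * pack_total h)).
    by rewrite ler_wpM2l// cover_total_ge0.
  by rewrite ler_wpM2r// pack_total_ge0.
rewrite le_eqVlt ltNge sumr_ge0 ?orbF; last by move=> u /andP[/D0].
rewrite psumr_eq0; last by move=> u /andP[/D0].
move=> /allP Dz.
suff : \sum_(u <- vs | sol u) cover_gain h u <= 0 by move=> /(le_trans sumC); rewrite leNgt C0.
rewrite big_seq_cond sumr_le0// => u /andP[uv su]; rewrite leNgt; apply/negP => B0.
move: (nel u uv); rewrite /eligible B0 /= -ltNge -subr_gt0.
by have := Dz u uv; rewrite su uv /= => /eqP ->; rewrite ltxx.
Qed.

Lemma active_row h u : 0 < cover_gain h u ->
  exists2 r, r \in crs & cc r u && (count (cc r) h < K)%N.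
Proof.
move=> B0; suff /hasP[r rc ?] : has (fun r => cc r u && (count (cc r) h < K)%N) crs by exists r.
apply/negPn/negP => /hasPn noact; move: B0; rewrite /cover_gain /rsum big_seq big1 ?ltxx// => r
  rc.
by have := noact r rc; case: (cc r u) => //=; rewrite cover_weightE => /negbTE ->.
Qed.

Lemma pack_total_cons h u : pack_total (u :: h) = pack_total h + e * pack_gain h u.
Proof.
rewrite /pack_total /pack_gain /rsum mulr_sumr -big_split; apply: eq_bigr => i _ /=.
by rewrite /pack_weight /rprod big_cons mulrDl mul1r mulrA mulrAC mulrC mulrA (mulrC (pc _ _));
  ring.
Qed.

(** Only an inequality, because a row that reaches [K] loses all of its weight instead of the
    fraction [e]. *)
Lemma cover_total_cons h u : cover_total (u :: h) <= cover_total h - e * cover_gain h u.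
Proof.
rewrite /cover_total /cover_gain /rsum mulr_sumr -sumrB; apply: ler_sum => r _.
rewrite !cover_weightE /=; case: (cc r u); last by rewrite add0n mulr0 subr0.
rewrite add1n exprS; have [cK|Kc] := ltnP (count (cc r) h) K.
  move: ((1 - e) ^+ _) (exprn_ge0 (count (cc r) h) (ltW e'_gt0)) => c c0.
  have -> : c - e * c = (1 - e) * c by ring.
  case: ifP => // _; by rewrite mulr_ge0// ltW.
by rewrite ltnNge (leqW Kc) mulr0 subr0.
Qed.

(** With totals P, C and gains p, c one has (P + e p)(C - e c) = P C - e (c P - p C) - e^2 p c, and
    eligibility says c P - p C >= 0. Using the product as potential avoids logarithms in the
    invariant. *)
Lemma eligible_potential h u : {subset h <= vs} -> u \in vs -> eligible h u ->
  pack_total (u :: h) * cover_total (u :: h) <= pack_total h * cover_total h.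
Proof.
move=> hv uv /andP[_ el].
have uhv : {subset u :: h <= vs} by move=> w; rewrite inE => /predU1P[->|/hv].
apply: (le_trans (ler_wpM2l (pack_total_ge0 uhv) (cover_total_cons h u))).
rewrite pack_total_cons.
have : 0 <= e * (cover_gain h u * pack_total h - pack_gain h u * cover_total h).
  by rewrite mulr_ge0// subr_ge0.
have : 0 <= e * e * (pack_gain h u * cover_gain h u).
  by rewrite !mulr_ge0// ?cover_gain_ge0// pack_gain_ge0.
lra.
Qed.

Variables (sol : pred U) (Kp : rat).
Hypothesis sol_pack : forall i, i \in prs -> \sum_(u <- vs | sol u) pc i u <= 1.
Hypothesis sol_cover : forall r, r \in crs -> has (fun u => sol u && cc r u) vs.
Hypothesis Kp_ge0 : 0 <= Kp.
(** The one analytic estimate, isolated here because its proof needs the real exponential while the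
    algorithm is rational. The extra 1 pays for the variable about to be added. *)
Hypothesis widthP : forall h i, i \in prs -> {subset h <= vs} ->
  pack_weight h i * (1 - e) ^+ K <= (size prs)%:R * (size crs)%:R ->
  \sum_(u <- h) pc i u + 1 <= Kp.

Let inv h := [/\ {subset h <= vs},
  pack_total h * cover_total h <= (size prs)%:R * (size crs)%:R &
  forall i, i \in prs -> \sum_(u <- h) pc i u <= Kp].

Lemma mw_inv_nil : inv [::].
Proof.
split=> // [|i _]; last by rewrite big_nil.
rewrite ler_pM ?pack_total_ge0 ?cover_total_ge0//.
  rewrite /pack_total /rsum -sum1_size natr_sum ler_sum// => i _.
  by rewrite /pack_weight /rprod big_nil.
rewrite /cover_total /rsum -sum1_size natr_sum ler_sum// => r _.
by rewrite cover_weightE /=; case: ifP; rewrite ?expr0.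
Qed.

Lemma mw_inv_step h : inv h -> inv (mw_step h).
Proof.
move=> [hv potP sumP]; rewrite /mw_step.
case E: [seq u <- vs | eligible h u] => [|u s]; first by split.
have : u \in [seq u <- vs | eligible h u] by rewrite E mem_head.
rewrite mem_filter => /andP[el uv].
split.
- by move=> w; rewrite inE => /predU1P[->|/hv].
- exact: le_trans (eligible_potential hv uv el) potP.
move=> i ip; rewrite big_cons addrC.
apply: (@le_trans _ _ (\sum_(j <- h) pc i j + 1)).
  by rewrite lerD2l; case/andP: (pc_bounds ip uv).
(* The estimate is applied before [u] is added. At that moment a row is still active, so the
   covering total is at least [(1 - e) ^+ K]; afterwards it may be 0. *)
apply: widthP => //; apply: le_trans potP.
case/andP: el => /active_row[r rc /andP[_ cK]] _.
have cw0 : 0 < cover_weight h r by rewrite cover_weight_gt0.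
have pw := pack_weight_gt0 ip hv.
rewrite ler_pM//; first exact: ltW.
- by rewrite exprn_ge0// ltW.
- rewrite /pack_total /rsum (perm_big _ (perm_to_rem ip)) big_cons lerDl big_seq sumr_ge0// => k.
  by move=> /mem_rem kp; exact: ltW (pack_weight_gt0 kp hv).
apply: le_trans (cover_weight_lb cw0) _.
rewrite /cover_total /rsum (perm_big _ (perm_to_rem rc)) big_cons lerDl sumr_ge0// => k _.
exact: cover_weight_ge0.
Qed.

Lemma mw_inv n : inv (iter n mw_step [::]).
Proof. by elim: n => [|n]; [exact: mw_inv_nil|exact: mw_inv_step]. Qed.

(** Counts truncated at [K] measure progress: an eligible variable covers an active row, and no
    truncated count ever decreases. Their sum is at most [size crs * K], which gives the number of
    rounds. *)
Lemma mw_step_progress h : inv h -> cover_total h != 0 ->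
  (\sum_(r <- crs) minn (count (cc r) h) K < \sum_(r <- crs) minn (count (cc r) (mw_step h)) K)%N.
Proof.
move=> [hv _ _] C0; have : has (eligible h) vs.
  by apply: (eligible_exists hv sol_pack sol_cover); rewrite lt_def C0 cover_total_ge0.
rewrite has_filter /mw_step; case E: [seq u <- vs | eligible h u] => [|u s]// _.
have : u \in [seq u <- vs | eligible h u] by rewrite E mem_head.
rewrite mem_filter => /andP[/andP[/active_row[r rc /andP[ru cK]] _] _].
rewrite !(perm_big _ (perm_to_rem rc)) !big_cons /= ru -addSn leq_add//.
  by rewrite add1n /minn cK; case: ifP => //; lia.
by apply: leq_sum => k _; rewrite leq_min geq_minr andbT (leq_trans (geq_minl _ _))// leq_addl.
Qed.

(** Once all rows are dropped no variable can have a positive covering gain, so surplus rounds do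
    nothing. *)
Lemma mw_step_stop h : cover_total h = 0 -> mw_step h = h.
Proof.
move=> C0; rewrite /mw_step; case E: [seq u <- vs | eligible h u] => [|u s]//.
have : u \in [seq u <- vs | eligible h u] by rewrite E mem_head.
rewrite mem_filter => /andP[/andP[/active_row[r rc /andP[_ cK]] _] _].
move: C0 => /eqP; rewrite /cover_total /rsum psumr_eq0; last by move=> ? _; exact:
  cover_weight_ge0.
by move=> /allP/(_ r rc)/=; rewrite gt_eqF// cover_weight_gt0.
Qed.

Lemma mw_progress n :
  (n <= \sum_(r <- crs) minn (count (cc r) (iter n mw_step [::])) K)%N \/
  cover_total (iter n mw_step [::]) = 0.
Proof.
elim: n => [|n IH]; first by left.
have [C0|C0] := eqVneq (cover_total (iter n mw_step [::])) 0.
  by right; rewrite iterS mw_step_stop.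
case: IH => [IH|/eqP]; last by rewrite (negbTE C0).
by left; rewrite iterS (leq_ltn_trans IH)// mw_step_progress//; exact: mw_inv.
Qed.

Lemma mw_correct n : (size crs * K <= n)%N ->
  let h := iter n mw_step [::] in
  [/\ {subset h <= vs}, forall i, i \in prs -> \sum_(u <- h) pc i u <= Kp &
      forall r, r \in crs -> (K <= count (cc r) h)%N].
Proof.
move=> nK h; have [hv _ hP] := mw_inv n; split => // r rc.
have [] := mw_progress n; rewrite -/h; last first.
  move=> /eqP; rewrite /cover_total /rsum psumr_eq0; last by move=> ? _; exact: cover_weight_ge0.
  move=> /allP/(_ r rc)/= /eqP cw; rewrite leqNgt; apply/negP => cK.
  by move: cK; rewrite -cover_weight_gt0 cw ltxx.
move=> /(leq_trans nK).
(* Each truncated count is at most [K] and they add up to at least [K] per row, so none falls short;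
   cancelling the rows other than [r] shows it for [r]. *)
rewrite -sum1_size big_distrl /= (perm_big _ (perm_to_rem rc)) [X in (_ <= X)%N](perm_big _
  (perm_to_rem rc)).
rewrite !big_cons /= mul1n => H.
rewrite -(leq_add2r (\sum_(k <- rem r crs) K)%N); apply: (leq_trans H).
by rewrite leq_add ?geq_minl//; apply: leq_sum => k _; rewrite geq_minr.
Qed.

End MultiplicativeWeights.

(** Taking logarithms, [e / (1 + e) * S] is at most ln M + K e / (1 - e). The crude bound ln M <= M
    is good enough because [K] is M / e^2, so that M contributes only about e K to [S]. One more e K
    absorbs the 1 in [S + 1]. *)
Lemma mw_width_real (R : realType) (e S P M : R) (K : nat) :
  0 < e <= 2^-1 -> 0 < M -> K%:R = M / e ^+ 2 -> 1 <= K%:R * e ->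
  expR (e / (1 + e) * S) <= P -> P * (1 - e) ^+ K <= M -> S + 1 <= K%:R * (1 + 7 * e).
Proof.
move=> /andP[e0 e1] M0 KE Ke SP PM.
have e'0 : 0 < 1 - e by lra.
have expK : 1 <= (1 - e) ^+ K * expR (K%:R * (e / (1 - e))).
  rewrite expRM_natl -exprMn exprn_ege1// -ler_pdivrMl// mulr1.
  apply: le_trans (expR_ge1Dx _).
  by rewrite le_eqVlt; apply/orP; left; apply/eqP; field; lra.
have : expR (e / (1 + e) * S) <= expR (M + K%:R * (e / (1 - e))).
  rewrite expRD; apply: (le_trans SP).
  have E0 : 0 <= expR (K%:R * (e / (1 - e))) by exact: expR_ge0.
  have ME : M <= expR M by apply: le_trans (expR_ge1Dx _); lra.
  apply: (le_trans _ (ler_wpM2r E0 ME)).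
  apply: (@le_trans _ _ (P * ((1 - e) ^+ K * expR (K%:R * (e / (1 - e)))))).
    by rewrite ler_peMr// (le_trans (expR_ge0 _) SP).
  by rewrite (mulrA P) ler_wpM2r.
rewrite ler_expR => H.
have ME : M = K%:R * e ^+ 2 by rewrite KE divfK// expf_neq0// gt_eqF.
have : S <= (1 + e) / e * (K%:R * e ^+ 2 + K%:R * (e / (1 - e))).
  have -> : S = (1 + e) / e * (e / (1 + e) * S) by field; apply/andP; split; lra.
  by rewrite -ME ler_wpM2l// divr_ge0//; lra.
have -> : (1 + e) / e * (K%:R * e ^+ 2 + K%:R * (e / (1 - e))) =
    K%:R * ((1 + e) * (e + (1 - e)^-1)) by field; apply/andP; split; lra.
have i2 : (1 - e)^-1 <= 1 + 2 * e.
  rewrite -[leLHS]mul1r ler_pdivrMr//.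
  have : 0 <= e * (1 - 2 * e) by rewrite mulr_ge0//; lra.
  by lra.
have : K%:R * ((1 + e) * (e + (1 - e)^-1)) <= K%:R * (1 + 6 * e) :> R.
  rewrite ler_wpM2l//; apply: (@le_trans _ _ ((1 + e) * (1 + 3 * e))).
    by rewrite ler_wpM2l//; lra.
  have : 0 <= e * (1 - 2 * e) by rewrite mulr_ge0//; lra.
  by lra.
by lra.
Qed.

(** With x = e / (1 + e) one has exp(x s) <= 1 / (1 - x s). This x is the solution of e - x - e x =
    0, which leaves (1 + e s)(1 - x s) = 1 + e x s (1 - s) >= 1. *)
Lemma expR_le_linear (R : realType) (e s : R) : 0 < e -> 0 <= s <= 1 ->
  expR (e / (1 + e) * s) <= 1 + e * s.
Proof.
move=> e0 /andP[s0 s1]; set x := e / (1 + e).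
have x0 : 0 <= x by rewrite divr_ge0//; lra.
have xs1 : x * s < 1.
  rewrite (@le_lt_trans _ _ x)//; first by rewrite ler_piMr.
  by rewrite /x ltr_pdivrMr; lra.
have H := expR_ge1Dx (- (x * s)); rewrite expRN in H.
have : expR (x * s) <= (1 - x * s)^-1.
  by rewrite -[leLHS]invrK lef_pV2 ?posrE ?invr_gt0 ?expR_gt0 ?subr_gt0.
move=> /le_trans; apply; rewrite -[leLHS]mul1r ler_pdivrMr; last by lra.
have -> : (1 + e * s) * (1 - x * s) = 1 + s * ((e - x - e * x) + e * x * (1 - s)) by ring.
have -> : e - x - e * x = 0 by rewrite /x; field; lra.
by rewrite lerDl add0r !mulr_ge0 ?subr_ge0 ?invr_ge0 ?addr_ge0// ltW.
Qed.

Lemma mw_width (R : realType) (N M : nat) (U : eqType) (h : seq U) (s : U -> rat) :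
  (1 < N)%N -> (0 < M)%N -> {in h, forall u, 0 <= s u <= 1} ->
  rprod h (fun u => 1 + N%:R^-1 * s u) * (1 - N%:R^-1) ^+ (N * N * M) <= M%:R ->
  \sum_(u <- h) s u + 1 <= (N * N * M)%:R * (1 + 7 * N%:R^-1).
Proof.
move=> N1 M0 s01 H.
have N0 : (0 : R) < N%:R by rewrite ltr0n ltnW.
have N2 : (2 : R) <= N%:R by rewrite ler_nat.
rewrite -(ler_rat R) rmorphD rmorph1.
have -> : ratr ((N * N * M)%:R * (1 + 7 * N%:R^-1)) = (N * N * M)%:R * (1 + 7 * N%:R^-1) :> R.
  by rewrite [LHS]rmorphM rmorphD rmorph1 fmorph_div /= !ratr_nat.
apply: (@mw_width_real R _ _ (ratr (rprod h (fun u => 1 + N%:R^-1 * s u))) M%:R).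
- by rewrite invr_gt0 N0 lef_pV2 ?posrE.
- by rewrite ltr0n.
- by rewrite !natrM; field; rewrite gt_eqF.
- rewrite !natrM mulrAC mulfK ?gt_eqF// -natrM ler1n muln_gt0 M0 ltnW//.
- rewrite raddf_sum mulr_sumr expR_sum /rprod rmorph_prod /=.
  rewrite big_seq [leRHS]big_seq; apply: ler_prod => u uh; rewrite expR_ge0 /=.
  rewrite rmorphD rmorph1 rmorphM fmorphV /= ratr_nat expR_le_linear ?invr_gt0//.
  by have /andP[s0 s1] := s01 u uh; rewrite ler0q s0 -[1 : R](ratr_nat R 1) ler_rat.
by move: H; rewrite -(ler_rat R) rmorphM rmorphXn rmorphB rmorph1 fmorphV /= !ratr_nat.
Qed.

(** * The stages: algorithm *)

Definition rmax A (s : seq A) (F : A -> rat) : rat := \big[Num.max/0]_(i <- s) F i.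

(* Processing requirements, groups with their weights, rows of the matrix, and
   the description of the allowed rates, which is only handed on. *)
Definition raw : Type := (seq rat * (seq (seq bool * rat) * (seq (seq rat) * data)))%type.

Section Algorithm.
Variable N : nat.
Implicit Types (x : raw) (h : seq (bool * (nat * nat))).

Definition growth : rat := 1 + N%:R^-1.

Definition jobs x := indices x.1.
Definition clients x := indices x.2.1.
Definition machines x := indices x.2.2.1.
Definition member x s j := nth false (nth ([::], 0) x.2.1 s).1 j.
Definition wt x s : rat := (nth ([::], 0) x.2.1 s).2.
Definition demand x d j : rat := nth 0 (nth [::] x.2.2.1 d) j * nth 0 x.1 j.
(* As 1 / 0 = 0, the scale exceeds the inverse of every nonzero demand, so that all
   nonzero scaled demands exceed 1. *)
Definition scale x : rat :=
  1 + rsum (machines x) (fun d => rsum (jobs x) (fun j => (demand x d j)^-1)).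
Definition sdemand x d j : rat := demand x d j * scale x.
(** Jobs without any demand add no load. They go to stage 0, whose load is 0, and so cannot delay a
    group. *)
Definition busy x j := has (fun d => demand x d j != 0) (machines x).
Definition relevant x s := has (fun j => member x s j && busy x j) (jobs x).
(** Its length k0 satisfies that 2^k0 is at least the total scaled demand. As [growth ^ N] is at
    least 2, the N k0 levels reach so far that one further stage can take all remaining jobs. *)
Definition fuel x : seq nat :=
  log_fuel (rsum (machines x) (fun d => rsum (jobs x) (fun j => sdemand x d j))).
Definition level_fuel x : seq nat := flatten [seq nseq N 0%N | _ <- fuel x].
Definition levels x := indices (level_fuel x).
(** The guesses [weight_total x * growth ^ g] have to reach the missing cost, which is at most
    [weight_total x] times N a^(N k0). The additional N N powers pay for the factor N, since a^(N N)
    >= 2^N > N. *)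
Definition guess_fuel x : seq nat := level_fuel x ++ nseq (N * N).+1 0%N.
Definition guesses x := indices (guess_fuel x).
(** Equals [growth ^ m] for all exponents in use. The product runs over an available list because
    the binary number [m] cannot drive a loop. *)
Definition power x m : rat := rprod (guesses x) (fun i => if (i < m)%N then growth else 1).
Definition weight_total x : rat := rsum (clients x) (fun s => if relevant x s then wt x s else 0).

(* A variable [(true, (m, j))] stands for the part of job [j] processed by time
   [growth ^ m], a variable [(false, (m, s))] for the part of group [s] missing at
   that time.  The packing row [(true, (m, d))] is the capacity of machine [d] up to
   that time, [(false, _)] is the budget row; the covering row [(m, (s, j))] says that
   group [s] misses what its job [j] misses. *)
Definition pack_coef x (V : rat) (row u : bool * (nat * nat)) : rat :=
  if row.1 then
    if u.1 && (u.2.1 == row.2.1) then sdemand x row.2.2 u.2.2 / power x row.2.1 else 0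
  else
    if u.1 then 0 else wt x u.2.2 * power x u.2.1 / V.
Definition cover_coef (row : nat * (nat * nat)) (u : bool * (nat * nat)) : bool :=
  (u.2.1 == row.1) && (u.2.2 == (if u.1 then row.2.2 else row.2.1)).
Definition all_vars x : seq (bool * (nat * nat)) :=
  flatten [seq [seq (true, (m, j)) | j <- jobs x] | m <- levels x] ++
  flatten [seq [seq (false, (m, s)) | s <- clients x] | m <- levels x].
Definition pack_rows x : seq (bool * (nat * nat)) :=
  (false, (0%N, 0%N)) :: flatten [seq [seq (true, (m, d)) | d <- machines x] | m <- levels x].
Definition cover_rows x : seq (nat * (nat * nat)) :=
  flatten [seq flatten [seq [seq (m, (s, j)) | j <- [seq j <- jobs x | member x s j && busy x j]]
                       | s <- clients x] | m <- levels x].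
(** The number [K] of units per variable, in unary. It is M / e^2 for e = 1 / N and M the product of
    the numbers of packing and covering rows, as the width estimate demands. *)
Definition unit_fuel x : seq nat :=
  flatten [seq flatten [seq nseq (N * N) 0%N | _ <- cover_rows x] | _ <- pack_rows x].
(** A variable with a coefficient above 1 in some packing row cannot occur in a 0/1 solution;
    removing it bounds the width by 1. *)
Definition small_vars x V :=
  [seq u <- all_vars x | all (fun row => pack_coef x V row u <= 1) (pack_rows x)].
Definition solver_step x V h : seq (bool * (nat * nat)) :=
  mw_step (pack_rows x) (cover_rows x) (small_vars x V) (pack_coef x V) cover_coef
    N%:R^-1 (size (unit_fuel x)) h.
Definition solver_fuel x : seq nat :=
  flatten [seq [seq 0%N | _ <- unit_fuel x] | _ <- cover_rows x].
Definition solver x V := foldr (fun _ h => solver_step x V h) [::] (solver_fuel x).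

(* The stages of shift [s] end at the times [growth ^ (N * k + s)]. *)
Definition stage x h i s j : nat :=
  if busy x j then
    (find (fun k => (i < count (fun u => [&& u.1, u.2.1 == (N * k + s)%N & u.2.2 == j]) h)%N)
      (indices (fuel x))).+1
  else 0%N.
Definition candidate x g i s : seq nat :=
  [seq stage x (solver x (weight_total x * power x g)) i s j | j <- jobs x].
Definition candidates x : seq (seq nat) :=
  flatten [seq flatten [seq [seq candidate x g i s | s <- iota 0 N]
                       | i <- indices (unit_fuel x)] | g <- guesses x].
(** The indices 0 to k0 + 1: stage 0 holds jobs without demand, stage k + 1 the jobs found at the
    k-th level of the shift, and stage k0 + 1 those never found, where [find] returns k0. *)
Definition stages x := indices [:: 0%N, 0%N & fuel x].
Definition load x (st : seq nat) (k : nat) : rat :=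
  rmax (machines x) (fun d => rsum (jobs x) (fun j => if nth 0%N st j == k then demand x d j
    else 0)).
(** Up to the factor lost by the subroutine, a bound on the objective of the concatenated schedule:
    a group waits for all stages up to that of its last job. *)
Definition cost x st : rat :=
  rsum (clients x) (fun s => wt x s * rsum (stages x) (fun k =>
    if has (fun j => member x s j && (k <= nth 0%N st j)%N) (jobs x) then load x st k else 0)).
(** Settles the case of no relevant group: then [weight_total] is 0 and the guesses carry no
    information, but this candidate costs nothing. *)
Definition default_candidate x : seq nat := [seq if busy x j then 1%N else 0%N | j <- jobs x].
Definition best x : seq nat :=
  foldr (fun c b => if cost x c <= cost x b then c else b) (default_candidate x) (candidates x).

End Algorithm.

(** * The stages: running time *)

Lemma polytime_op1 {A B C : Type} {EA : Enc A} {EB : Enc B} {EC : Enc C} (f : B -> C) (F : A ->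
  B) :
  polytime f -> polytime F -> polytime (fun a => f (F a)).
Proof. by move=> pf pF; exact: polytime_comp pF pf. Qed.

Section MoreClosure.
Context {A B C D E : Type} {EA : Enc A} {EB : Enc B} {EC : Enc C} {ED : Enc D} {EE : Enc E}.

Lemma polytime_count (L : A -> seq B) (P : A -> B -> bool) :
  polytime L -> polytime (fun p : A * B => P p.1 p.2) ->
  polytime (fun a => count (P a) (L a)).
Proof.
move=> pL pP; under eq_fun do rewrite -size_filter.
by apply: polytime_size_seq; exact: polytime_filter.
Qed.

Lemma polytime_rmax (L : A -> seq B) (F : A -> B -> rat) :
  polytime L -> polytime (fun p : A * B => F p.1 p.2) -> polytime (fun a => rmax (L a) (F a)).
Proof.
move=> pL pF; have [q qP] := polytime_size pF.
apply: (@polytime_eq _ _ _ _ (fun a => foldr (fun b x => if F a b < x then x else F a b) 0 (L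
  a))).
  by move=> a; rewrite /rmax unlock.
have pF' : polytime (fun p : A * (B * rat) => F p.1 p.2.1).
  by apply: (polytime_comp (F := fun p : A * (B * rat) => (p.1, p.2.1)) _ pF); solve_polytime.
apply: (@polytime_foldr_vsz A B rat _ _ _ L (fun a b x => if F a b < x then x else F a b)
  (fun=> 0)
  (q \Po ('X + 1%N%:P))) => //.
- exact: polytime_cst.
- by apply: polytime_if => //; [apply: polytime_ratlt => //|]; solve_polytime.
move=> a b c; rewrite horner_nat_comp horner_natD hornerX hornerC addn1.
by have := qP (a, b); rewrite vsz_pair /=; case: ifP => _; lia.
Qed.

Lemma polytime_op3 (f : B -> C -> D -> E) (F : A -> B) (G : A -> C) (H : A -> D) :
  polytime (fun p : B * (C * D) => f p.1 p.2.1 p.2.2) ->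
  polytime F -> polytime G -> polytime H -> polytime (fun a => f (F a) (G a) (H a)).
Proof.
move=> pf pF pG pH; apply: (polytime_comp (F := fun a => (F a, (G a, H a))) _ pf).
by do !apply: polytime_pair.
Qed.

End MoreClosure.

Lemma polytime_op4 {A B1 B2 B3 B4 C : Type} {EA : Enc A} {E1 : Enc B1} {E2 : Enc B2}
    {E3 : Enc B3} {E4 : Enc B4} {EC : Enc C} (f : B1 -> B2 -> B3 -> B4 -> C)
    (F1 : A -> B1) (F2 : A -> B2) (F3 : A -> B3) (F4 : A -> B4) :
  polytime (fun p : B1 * (B2 * (B3 * B4)) => f p.1 p.2.1 p.2.2.1 p.2.2.2) ->
  polytime F1 -> polytime F2 -> polytime F3 -> polytime F4 ->
  polytime (fun a => f (F1 a) (F2 a) (F3 a) (F4 a)).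
Proof.
move=> pf p1 p2 p3 p4; apply: (polytime_comp (F := fun a => (F1 a, (F2 a, (F3 a, F4 a)))) _ pf).
by do !apply: polytime_pair.
Qed.

Ltac polytime_rule :=
  lazymatch goal with
  | |- @polytime _ _ _ _ (fun _ => ?c) => exact: polytime_cst
  | |- @polytime _ _ _ _ (fun x => x) => exact: polytime_id
  | |- @polytime _ _ _ _ fst => exact: polytime_fst polytime_id
  | |- @polytime _ _ _ _ snd => exact: polytime_snd polytime_id
  | |- @polytime _ _ _ _ (fun x => fst (@?F x)) => refine (@polytime_fst _ _ _ _ _ _ F _)
  | |- @polytime _ _ _ _ (fun x => snd (@?F x)) => refine (@polytime_snd _ _ _ _ _ _ F _)
  | |- @polytime _ _ _ _ (fun x => pair (@?F x) (@?G x)) =>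
      refine (@polytime_pair _ _ _ _ _ _ F G _ _)
  | |- @polytime _ _ _ _ (fun x => cons (@?F x) (@?G x)) =>
      refine (@polytime_cons _ _ _ _ F G _ _)
  | |- @polytime _ _ _ _ (fun x => cat (@?F x) (@?G x)) => refine (@polytime_cat _ _ _ _ F G _ _)
  | |- @polytime _ _ _ _ (fun x => flatten (@?F x)) => refine (@polytime_flatten _ _ _ _ F _)
  | |- @polytime _ _ _ _ (fun x => size (@?F x)) => refine (@polytime_size_seq _ _ _ _ F _)
  | |- @polytime _ _ _ _ (fun x => indices (@?F x)) => refine (@polytime_indices _ _ _ _ F _)
  | |- @polytime _ _ _ _ (fun x => log_fuel (@?F x)) => refine (@polytime_log_fuel _ _ F _)
  | |- @polytime _ _ _ _ (fun x => nth (@?F x) (@?G x) (@?H x)) =>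
      refine (@polytime_nth _ _ _ _ F G H _ _ _)
  | |- @polytime _ _ _ _ (fun x => map (@?F x) (@?L x)) =>
      refine (@polytime_map _ _ _ _ _ _ L F _ _); cbv beta
  | |- @polytime _ _ _ _ (fun x => seq.filter (@?F x) (@?L x)) =>
      refine (@polytime_filter _ _ _ _ L F _ _); cbv beta
  | |- @polytime _ _ _ _ (fun x => has (@?F x) (@?L x)) =>
      refine (@polytime_has _ _ _ _ L F _ _); cbv beta
  | |- @polytime _ _ _ _ (fun x => all (@?F x) (@?L x)) =>
      refine (@polytime_all _ _ _ _ L F _ _); cbv beta
  | |- @polytime _ _ _ _ (fun x => find (@?F x) (@?L x)) =>
      refine (@polytime_find _ _ _ _ L F _ _); cbv beta
  | |- @polytime _ _ _ _ (fun x => count (@?F x) (@?L x)) =>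
      refine (@polytime_count _ _ _ _ L F _ _); cbv beta
  | |- @polytime _ _ _ _ (fun x => rsum (@?L x) (@?F x)) =>
      refine (@polytime_rsum _ _ _ _ L F _ _); cbv beta
  | |- @polytime _ _ _ _ (fun x => rprod (@?L x) (@?F x)) =>
      refine (@polytime_rprod _ _ _ _ L F _ _); cbv beta
  | |- @polytime _ _ _ _ (fun x => rmax (@?L x) (@?F x)) =>
      refine (@polytime_rmax _ _ _ _ L F _ _); cbv beta
  | |- @polytime _ _ _ _ (fun x => @Algebra.add _ (@?F x) (@?G x)) =>
      refine (@polytime_ratD _ _ F G _ _)
  | |- @polytime _ _ _ _ (fun x => @GRing.mul _ (@?F x) (@GRing.inv _ (@?G x))) =>
      refine (@polytime_ratdiv _ _ F G _ _)
  | |- @polytime _ _ _ _ (fun x => @GRing.mul _ (@?F x) (@?G x)) =>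
      refine (@polytime_ratM _ _ F G _ _)
  | |- @polytime _ _ _ _ (fun x => @GRing.inv _ (@?F x)) => refine (@polytime_ratV _ _ F _)
  | |- @polytime _ _ _ _ (fun x => @Order.le _ _ (@?F x) (@?G x)) =>
      refine (@polytime_ratle _ _ F G _ _)
  | |- @polytime _ _ _ _ (fun x => @Order.lt _ _ (@?F x) (@?G x)) =>
      refine (@polytime_ratlt _ _ F G _ _)
  | |- @polytime _ _ _ _ (fun x => leq (@?F x) (@?G x)) => refine (@polytime_natle _ _ F G _ _)
  | |- @polytime _ _ _ _ (fun x => addn (@?F x) (@?G x)) => refine (@polytime_addn _ _ F G _ _)
  | |- @polytime _ _ _ _ (fun x => muln (@?F x) (@?G x)) => refine (@polytime_muln _ _ F G _ _)
  | |- @polytime _ _ _ _ (fun x => S (@?F x)) => refine (@polytime_succn _ _ F _)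
  | |- @polytime _ _ _ _ (fun x => negb (@?F x)) => refine (@polytime_neg _ _ F _)
  | |- @polytime _ _ _ _ (fun x => andb (@?F x) (@?G x)) => refine (@polytime_and _ _ F G _ _)
  | |- @polytime _ _ _ _ (fun x => orb (@?F x) (@?G x)) => refine (@polytime_or _ _ F G _ _)
  | |- @polytime _ _ _ _ (fun x => @eq_op _ (@?F x) (@?G x)) =>
      first [ refine (@polytime_nateq _ _ F G _ _) | refine (@polytime_rateq _ _ F G _ _)
            | refine (@polytime_booleq _ _ F G _ _) ]
  | |- _ => simple apply polytime_if
  end.

Tactic Notation "solve_polytime" "using" tactic(t) := repeat first [ polytime_rule | t ].

(** Treats a defined function as a leaf of the syntax-directed search, closed by its own
    polynomial-time lemma, so that definitions are unfolded one at a time. *)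
Ltac call1 f lem :=
  lazymatch goal with
  | |- @polytime _ _ _ _ f => exact: lem
  | |- @polytime _ _ _ _ (fun x => f (@?F x)) => refine (@polytime_op1 _ _ _ _ _ _ f F lem _)
  end.
Ltac call2 f lem :=
  lazymatch goal with
  | |- @polytime _ _ _ _ (fun x => f (@?F x) (@?G x)) =>
      refine (@polytime_op2 _ _ _ _ _ _ _ _ f F G lem _ _)
  end.
Ltac call3 f lem :=
  lazymatch goal with
  | |- @polytime _ _ _ _ (fun x => f (@?F x) (@?G x) (@?H x)) =>
      refine (@polytime_op3 _ _ _ _ _ _ _ _ _ _ f F G H lem _ _ _)
  end.
Ltac call4 f lem :=
  lazymatch goal with
  | |- @polytime _ _ _ _ (fun x => f (@?F x) (@?G x) (@?H x) (@?K x)) =>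
      refine (@polytime_op4 _ _ _ _ _ _ _ _ _ _ _ _ f F G H K lem _ _ _ _)
  end.

Section AlgorithmPolytime.
Variable N : nat.

Lemma polytime_jobs : polytime jobs.
Proof. by rewrite /jobs; solve_polytime using fail. Qed.

Lemma polytime_clients : polytime clients.
Proof. by rewrite /clients; solve_polytime using fail. Qed.

Lemma polytime_machines : polytime machines.
Proof. by rewrite /machines; solve_polytime using fail. Qed.

Ltac sizes := first [ call1 jobs polytime_jobs | call1 clients polytime_clients
  | call1 machines polytime_machines ].

Lemma polytime_member : polytime (fun p : raw * (nat * nat) => member p.1 p.2.1 p.2.2).
Proof. by rewrite /member; solve_polytime using fail. Qed.

Lemma polytime_demand : polytime (fun p : raw * (nat * nat) => demand p.1 p.2.1 p.2.2).
Proof. by rewrite /demand; solve_polytime using fail. Qed.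

Lemma polytime_scale : polytime scale.
Proof.
rewrite /scale; solve_polytime using first [ sizes | call3 (demand) polytime_demand].
Qed.

Ltac basics := first [ sizes | call3 (demand) polytime_demand
  | call3 (member) polytime_member | call1 scale polytime_scale ].

Lemma polytime_wt : polytime (fun p : raw * nat => wt p.1 p.2).
Proof. by rewrite /wt; solve_polytime using fail. Qed.

Lemma polytime_sdemand : polytime (fun p : raw * (nat * nat) => sdemand p.1 p.2.1 p.2.2).
Proof. by rewrite /sdemand; solve_polytime using first [ basics ]. Qed.

Lemma polytime_busy : polytime (fun p : raw * nat => busy p.1 p.2).
Proof. by rewrite /busy; solve_polytime using first [ basics ]. Qed.

Lemma polytime_relevant : polytime (fun p : raw * nat => relevant p.1 p.2).
Proof. by rewrite /relevant; solve_polytime using first [ basics | call2 (busy) polytime_busy].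
  Qed.

Lemma polytime_fuel : polytime fuel.
Proof. by rewrite /fuel; solve_polytime using first [ basics | call3 (sdemand)
  polytime_sdemand]. Qed.

Lemma polytime_level_fuel : polytime (level_fuel N).
Proof. by rewrite /level_fuel; solve_polytime using first [ call1 fuel polytime_fuel ]. Qed.

Lemma polytime_levels : polytime (levels N).
Proof. by rewrite /levels; solve_polytime using first [ call1 (level_fuel N)
  polytime_level_fuel ]. Qed.

Lemma polytime_guesses : polytime (guesses N).
Proof.
by rewrite /guesses /guess_fuel; solve_polytime using first [ call1 (level_fuel N)
  polytime_level_fuel ].
Qed.

Lemma polytime_power : polytime (fun p : raw * nat => power N p.1 p.2).
Proof. by rewrite /power; solve_polytime using first [ call1 (guesses N) polytime_guesses ]. Qed.

Lemma polytime_weight_total : polytime weight_total.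
Proof.
by rewrite /weight_total; solve_polytime using first [ basics
  | call2 (relevant) polytime_relevant | call2 (wt) polytime_wt].
Qed.

Ltac basics2 := first [ sizes | call3 (sdemand) polytime_sdemand
  | call3 (member) polytime_member | call2 (wt) polytime_wt
  | call2 (busy) polytime_busy | call1 (levels N) polytime_levels
  | call1 (guesses N) polytime_guesses | call2 ((power N)) polytime_power ].

Notation index := (bool * (nat * nat))%type.

Lemma polytime_pack_coef :
  polytime (fun p : raw * (rat * (index * index)) => pack_coef N p.1 p.2.1 p.2.2.1 p.2.2.2).
Proof. by rewrite /pack_coef; solve_polytime using first [ basics2 ]. Qed.

Lemma polytime_cover_coef : polytime (fun p : (nat * (nat * nat)) * index => cover_coef p.1 p.2).
Proof. by rewrite /cover_coef; solve_polytime using fail. Qed.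

Lemma polytime_all_vars : polytime (all_vars N).
Proof. by rewrite /all_vars; solve_polytime using first [ basics2 ]. Qed.

Lemma polytime_pack_rows : polytime (pack_rows N).
Proof. by rewrite /pack_rows; solve_polytime using first [ basics2 ]. Qed.

Lemma polytime_cover_rows : polytime (cover_rows N).
Proof. by rewrite /cover_rows; solve_polytime using first [ basics2 ]. Qed.

Ltac rows := first [ call1 (all_vars N) polytime_all_vars
  | call1 (pack_rows N) polytime_pack_rows | call1 (cover_rows N) polytime_cover_rows
  | call4 ((pack_coef N)) polytime_pack_coef | call2 (cover_coef) polytime_cover_coef ].

Lemma polytime_unit_fuel : polytime (unit_fuel N).
Proof. by rewrite /unit_fuel; solve_polytime using first [ rows ]. Qed.

Lemma polytime_small_vars : polytime (fun p : raw * rat => small_vars N p.1 p.2).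
Proof. by rewrite /small_vars; solve_polytime using first [ rows ]. Qed.

Ltac rows2 := first [ rows | call1 (unit_fuel N) polytime_unit_fuel
  | call2 ((small_vars N)) polytime_small_vars ].

(** The generic weights take coefficient functions as arguments, and functions have no encoding.
    Running times are therefore stated for the instance, as functions of the data that determine the
    coefficients. *)
Lemma polytime_pack_weight : polytime (fun p : raw * (rat * (seq index * index)) =>
  pack_weight (pack_coef N p.1 p.2.1) N%:R^-1 p.2.2.1 p.2.2.2).
Proof. by rewrite /pack_weight; solve_polytime using first [ rows ]. Qed.

Lemma polytime_cover_weight : polytime (fun p : raw * (seq index * (nat * (nat * nat))) =>
  cover_weight cover_coef N%:R^-1 (size (unit_fuel N p.1)) p.2.1 p.2.2).
Proof. by rewrite /cover_weight; solve_polytime using first [ rows2 ]. Qed.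

Ltac call_pack_weight :=
  lazymatch goal with
  | |- @polytime _ _ _ _ (fun x => pack_weight (pack_coef N (@?F x) (@?V x)) _ (@?H x) (@?I x)) =>
      refine (@polytime_op4 _ _ _ _ _ _ _ _ _ _ _ _ (fun x v h i => pack_weight (pack_coef N x
        v) N%:R^-1 h i)
        F V H I polytime_pack_weight _ _ _ _)
  end.

Ltac call_cover_weight :=
  lazymatch goal with
  | |- @polytime _ _ _ _ (fun x => cover_weight cover_coef _ (size (unit_fuel N (@?F x))) (@?H
    x) (@?I x)) =>
      refine (@polytime_op3 _ _ _ _ _ _ _ _ _ _
        (fun x h r => cover_weight cover_coef N%:R^-1 (size (unit_fuel N x)) h r)
        F H I polytime_cover_weight _ _ _)
  end.

Lemma polytime_solver_step : polytime (fun p : raw * (rat * seq index) =>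
  solver_step N p.1 p.2.1 p.2.2).
Proof.
rewrite /solver_step /mw_step; apply: polytime_case; cbv beta; [|by solve_polytime using fail..].
rewrite /eligible /cover_gain /pack_gain /cover_total /pack_total.
by solve_polytime using first [rows2
  | call_pack_weight | call_cover_weight].
Qed.

Lemma polytime_solver_fuel : polytime (solver_fuel N).
Proof. by rewrite /solver_fuel; solve_polytime using first [ rows2 ]. Qed.

Lemma mem_vsz (A : eqType) (EA : Enc A) (a : A) (s : seq A) : a \in s -> (vsz a <= vsz s)%N.
Proof. by elim: s => // b s IH; rewrite inE vsz_cons => /predU1P[->|/IH]; lia. Qed.

(** A round adds at most one element of [small_vars] to the history, and that element is no larger
    than the list containing it. *)
Lemma polytime_solver : polytime (fun p : raw * rat => solver N p.1 p.2).
Proof.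
have [q qP] := polytime_size polytime_small_vars.
apply: (@polytime_foldr_vsz _ _ _ _ _ _ (fun p : raw * rat => solver_fuel N p.1)
  (fun p _ h => solver_step N p.1 p.2 h) (fun=> [::]) (q + 1%N%:P)).
- by solve_polytime using first [ call1 (solver_fuel N) polytime_solver_fuel ].
- exact: polytime_cst.
- by solve_polytime using first [ call3 (solver_step N) polytime_solver_step ].
move=> p b h; rewrite horner_natD hornerC /solver_step /mw_step.
case E: [seq _ <- _ | _] => [|u s]; first by rewrite leq_addr.
have : u \in small_vars N p.1 p.2.
  by have : u \in u :: s by [exact: mem_head]; rewrite -E mem_filter => /andP[].
move=> /mem_vsz; move/(leq_trans)/(_ (qP p)) => uq.
have : (q.[vsz p] <= q.[(vsz p + vsz b)%N])%N by apply: horner_nat_homo; rewrite leq_addr.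
by move=> /(leq_trans uq) H; rewrite vsz_cons addn1 addnS ltnS addnC leq_add2l.
Qed.

Lemma polytime_stage : polytime (fun p : raw * (seq index * (nat * (nat * nat))) =>
  stage N p.1 p.2.1 p.2.2.1 p.2.2.2.1 p.2.2.2.2).
Proof.
by rewrite /stage; solve_polytime using first [ call2 busy polytime_busy | call1 fuel
  polytime_fuel ].
Qed.

Lemma polytime_candidate : polytime (fun p : raw * (nat * (nat * nat)) =>
  candidate N p.1 p.2.1 p.2.2.1 p.2.2.2).
Proof.
rewrite /candidate; solve_polytime using first [ call1 jobs polytime_jobs ].
apply: (polytime_comp (F := fun p : raw * (nat * (nat * nat)) * nat =>
   (p.1.1, (solver N p.1.1 (weight_total p.1.1 * power N p.1.1 p.1.2.1),
     (p.1.2.2.1, (p.1.2.2.2, p.2))))) _ polytime_stage).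
by solve_polytime using first [ call2 (solver N) polytime_solver
  | call1 weight_total polytime_weight_total | call2 (power N) polytime_power ].
Qed.

Lemma polytime_candidates : polytime (candidates N).
Proof.
by rewrite /candidates; solve_polytime using first [ call4 (candidate N) polytime_candidate
  | call1 (guesses N) polytime_guesses | call1 (unit_fuel N) polytime_unit_fuel ].
Qed.

Lemma polytime_stages : polytime stages.
Proof. by rewrite /stages; solve_polytime using first [ call1 fuel polytime_fuel ]. Qed.

Lemma polytime_load : polytime (fun p : raw * (seq nat * nat) => load p.1 p.2.1 p.2.2).
Proof. by rewrite /load; solve_polytime using first [ basics ]. Qed.

Lemma polytime_cost : polytime (fun p : raw * seq nat => cost p.1 p.2).
Proof.
by rewrite /cost; solve_polytime using first [ basics2 | call3 load polytime_load
  | call1 stages polytime_stages ].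
Qed.

Lemma polytime_best : polytime (best N).
Proof.
apply: (@polytime_foldr_vsz _ _ _ _ _ _ (candidates N)
  (fun x c b => if cost x c <= cost x b then c else b) default_candidate 'X).
- exact: polytime_candidates.
- by rewrite /default_candidate; solve_polytime using first [ basics2 ].
- by solve_polytime using first [ call2 cost polytime_cost ].
by move=> x b c; rewrite hornerX; case: ifP => _; lia.
Qed.

End AlgorithmPolytime.

(** * The stages: cost *)

Lemma sum_delta_le (T : eqType) (s : seq T) (c : T) (F : T -> rat) : uniq s -> 0 <= F c ->
  \sum_(j <- s) (if c == j then F j else 0) <= F c.
Proof.
move=> us F0; have [cs|cs] := boolP (c \in s).
  by rewrite (bigD1_seq c)//= eqxx big1 ?addr0// => j; rewrite eq_sym => /negbTE ->.
by rewrite big_seq big1// => j js; case: eqP => // cj; move: cs; rewrite cj js.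
Qed.

Lemma sum_pow_iota (N n : nat) (N0 : (0 < N)%N) :
  \sum_(m <- iota 0 n) growth N ^+ m = N%:R * (growth N ^+ n - 1).
Proof.
elim: n => [|n IH]; first by rewrite big_nil expr0 subrr mulr0.
rewrite -addn1 iotaD big_cat /= big_seq1 IH add0n addn1 exprSr.
move: (growth N ^+ n) => c; rewrite /growth.
have : (N%:R : rat) != 0 by rewrite pnatr_eq0 -lt0n.
by move=> ?; field.
Qed.

Lemma sum_iota_mul (N n : nat) (F : nat -> rat) :
  \sum_(m <- iota 0 (N * n)) F m = \sum_(k <- iota 0 n) \sum_(s <- iota 0 N) F (N * k + s)%N.
Proof.
elim: n => [|n IH]; first by rewrite muln0 !big_nil.
rewrite mulnSr -(addn1 n) !iotaD !big_cat IH big_seq1 !add0n; congr (_ + _).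
by rewrite -[X in iota X]addn0 iotaDl big_map.
Qed.

Lemma count_all (T : Type) (P : pred T) s : all P s -> count P s = size s.
Proof. by rewrite all_count => /eqP. Qed.

Lemma count_none (T : Type) (P : pred T) s : ~~ has P s -> count P s = 0%N.
Proof. by rewrite has_count -leqNgt leqn0 => /eqP. Qed.

(** Discrete form of the fact that a random threshold t satisfies z >= 1 - t with probability z. *)
Lemma sum_threshold (c K : nat) :
  \sum_(i <- iota 0 K) (if (K <= c + i)%N then 1 else 0) <= c%:R :> rat.
Proof.
rewrite -big_mkcond /= big_const_seq iter_addr_0 ler_nat.
have [cK|Kc] := leqP c K; last by rewrite (leq_trans (count_size _ _))// size_iota ltnW.
rewrite -[in iota 0 K](subnK cK) iotaD count_cat add0n.
rewrite count_none ?add0n; last by apply/hasPn => i; rewrite mem_iota; lia.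
by rewrite (leq_trans (count_size _ _))// size_iota.
Qed.

(** The total weight of the thresholds; its 1/2 is the source of the factor 2 in the ratio. *)
Lemma sum_succ_ge (K : nat) : (K%:R ^+ 2) / 2 <= \sum_(i <- iota 0 K) i.+1%:R :> rat.
Proof.
elim: K => [|K IH]; first by rewrite big_nil expr0n mul0r.
rewrite -addn1 iotaD big_cat big_seq1 /= add0n.
apply: le_trans (lerD IH (lexx _)); rewrite -[K.+1]addn1 !natrD sqrrD; lra.
Qed.

Lemma bernoulli (y : rat) n : 0 <= y -> 1 + n%:R * y <= (1 + y) ^+ n.
Proof.
move=> y0; elim: n => [|n IH]; first by rewrite mul0r addr0 expr0.
rewrite exprS; apply: le_trans (ler_wpM2l _ IH); last by rewrite addr_ge0.
have : 0 <= n%:R * y * y by rewrite !mulr_ge0.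
by rewrite -[n.+1]addn1 natrD; lra.
Qed.

Lemma rmax_ge0 A (s : seq A) (F : A -> rat) : 0 <= rmax s F.
Proof. exact: bigmax_ge_id. Qed.

Lemma nth_indices_map A (s : seq A) (F : nat -> nat) j : j \in indices s ->
  nth 0%N [seq F i | i <- indices s] j = F j.
Proof.
rewrite mem_iota => /andP[_ js].
by rewrite (nth_map 0%N) ?size_iota// nth_iota.
Qed.

Lemma count_cover_coef m s j (h : seq (bool * (nat * nat))) :
  (count (cover_coef (m, (s, j))) h <=
   count (fun u => [&& u.1, u.2.1 == m & u.2.2 == j]) h +
   count (fun u => [&& ~~ u.1, u.2.1 == m & u.2.2 == s]) h)%N.
Proof.
elim: h => //= -[b [m' j']] h IH.
rewrite {1}/cover_coef /=; case: b => /=; case: (m' == m) => /=.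
- by case: (j' == j) => /=; lia.
- lia.
- by case: (j' == s) => /=; lia.
- lia.
Qed.

Lemma rounding_arith (k y a b n w z v : rat) :
  0 <= k -> 1 <= y -> 1 <= a -> 0 <= b -> 0 <= n * w -> v <= a * z ->
  k * y * b * (k * n * w + k * y * v) <= k ^+ 2 * (y ^+ 2 * (a * b) * (n * w + z)).
Proof.
move=> k0 y1 a1 b0 nw0 vz; have y0 : 0 <= y by exact: le_trans y1.
have -> : k * y * b * (k * n * w + k * y * v) = k ^+ 2 * (y * b) * (n * w + y * v) by ring.
have -> : k ^+ 2 * (y ^+ 2 * (a * b) * (n * w + z)) =
   k ^+ 2 * (y * b) * (y * a * (n * w) + y * (a * z)) by ring.
apply: ler_wpM2l; first by apply: mulr_ge0; [exact: exprn_ge0|exact: mulr_ge0].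
by apply: lerD; [rewrite ler_peMl// mulr_ege1|exact: ler_wpM2l].
Qed.

Section Correctness.
Variables (R : realType) (N : nat) (x : raw) (done : nat -> nat -> bool).
Hypothesis N1 : (1 < N)%N.
Hypothesis demand_ge0 : forall d j, 0 <= demand x d j.
Hypothesis wt_gt0 : forall s, s \in clients x -> 0 < wt x s.

Let a := growth N.
Let k0 := size (fuel x).
Let K := size (unit_fuel N x).
Let Kp : rat := K%:R * (1 + 7 * N%:R^-1).
Let W := weight_total x.
Let Kp_ge0 : 0 <= Kp. Proof. by rewrite mulr_ge0// addr_ge0// mulr_ge0// invr_ge0. Qed.

Definition missing m s := has (fun j => member x s j && busy x j && ~~ done m j) (jobs x).
(** What the 0/1 point spends in the budget row, before division by the guess. The times [a ^+ m] at
    which a group is unfinished sum to about N times its completion time, so this is about N times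
    the objective in scaled time. *)
Definition missing_cost : rat :=
  \sum_(s <- clients x) (if relevant x s then wt x s else 0) *
    \sum_(m <- levels N x) a ^+ m * (if missing m s then 1 else 0).
Let Z := missing_cost.

Hypothesis done_pack : forall m d, m \in levels N x -> d \in machines x ->
  \sum_(j <- jobs x | done m j) sdemand x d j <= a ^+ m.

Lemma growth_gt1 : 1 < a.
Proof. by rewrite /a /growth ltrDl invr_gt0 ltr0n ltnW. Qed.

Let a_gt0 : 0 < a. Proof. exact: lt_trans growth_gt1. Qed.

Lemma scale_ge1 : 1 <= scale x.
Proof.
rewrite lerDl /rsum sumr_ge0// => d _; rewrite sumr_ge0// => j _.
by rewrite invr_ge0.
Qed.

Lemma sdemand_ge0 d j : 0 <= sdemand x d j.
Proof. by rewrite mulr_ge0// (le_trans ler01)// scale_ge1. Qed.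

Lemma size_level_fuel : size (level_fuel N x) = (N * k0)%N.
Proof.
rewrite size_flatten /shape -map_comp /k0; elim: (fuel x) => [|y s IH] /=; first by rewrite muln0.
by rewrite size_nseq IH mulnS.
Qed.

Lemma levelsE : levels N x = iota 0 (N * k0).
Proof. by rewrite /levels /indices size_level_fuel. Qed.

Lemma guessesE : guesses N x = iota 0 (N * k0 + (N * N).+1).
Proof. by rewrite /guesses /indices size_cat size_level_fuel size_nseq. Qed.

Lemma powerE m : (m <= N * k0 + (N * N).+1)%N -> power N x m = a ^+ m.
Proof.
move=> mb; rewrite /power guessesE /rprod -big_mkcond /= big_const_seq iter_mulr_1.
congr (_ ^+ _); rewrite -(subnKC mb) iotaD count_cat add0n.
rewrite count_all ?size_iota; last by apply/allP => i; rewrite mem_iota; lia.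
by rewrite count_none ?addn0//; apply/hasPn => i; rewrite mem_iota; lia.
Qed.

Lemma power_level m : m \in levels N x -> power N x m = a ^+ m.
Proof. by rewrite levelsE mem_iota => /andP[_ mb]; apply: powerE; lia. Qed.

Lemma big_all_vars (P : pred (bool * (nat * nat))) (F : bool * (nat * nat) -> rat) :
  \sum_(u <- all_vars N x | P u) F u =
  \sum_(m <- levels N x) \sum_(j <- jobs x | P (true, (m, j))) F (true, (m, j)) +
  \sum_(m <- levels N x) \sum_(s <- clients x | P (false, (m, s))) F (false, (m, s)).
Proof.
rewrite /all_vars big_cat !big_flatten !big_map.
by congr (_ + _); apply: eq_bigr => m _; rewrite big_map.
Qed.

Lemma mem_all_vars u : u \in all_vars N x =
  (u.2.1 \in levels N x) && (u.2.2 \in if u.1 then jobs x else clients x).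
Proof.
case: u => -[] [m j] /=; rewrite mem_cat.
  rewrite orbC (negbTE (_ : _ \notin flatten [seq [seq (false, (_, _)) | _ <- _] | _ <- _]))
    /=; last first.
    by apply/negP => /flatten_mapP[k _ /mapP[l _ []]].
  apply/flatten_mapP/andP => [[k kl /mapP[l lj [-> ->]]]//|[ml jj]].
  by exists m => //; apply/mapP; exists j.
rewrite (negbTE (_ : _ \notin flatten [seq [seq (true, (_, _)) | _ <- _] | _ <- _])) /=; last
  first.
  by apply/negP => /flatten_mapP[k _ /mapP[l _ []]].
apply/flatten_mapP/andP => [[k kl /mapP[l lj [-> ->]]]//|[ml jj]].
by exists m => //; apply/mapP; exists j.
Qed.

Lemma mem_cover_rows m s j : (m, (s, j)) \in cover_rows N x =
  [&& m \in levels N x, s \in clients x, j \in jobs x, member x s j & busy x j].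
Proof.
apply/flatten_mapP/and5P => [[m' mm /flatten_mapP[s' ss /mapP[j']]]|[ml sc jj jm jb]].
  by rewrite mem_filter => /andP[/andP[? ?] ?] [-> -> ->].
exists m => //; apply/flatten_mapP; exists s => //; apply/mapP; exists j => //.
by rewrite mem_filter jm jb jj.
Qed.

Lemma mem_pack_rows row : row \in pack_rows N x ->
  row = (false, (0, 0))%N \/ exists m d, [/\ row = (true, (m, d)), m \in levels N x & d \in
    machines x].
Proof.
rewrite inE => /predU1P[->|/flatten_mapP[m ml /mapP[d dm ->]]]; first by left.
by right; exists m, d.
Qed.

Section Guess.
Variable V : rat.
Hypothesis V0 : 0 < V.
Hypothesis ZV : Z <= V.

Let pc := pack_coef N x V.

Lemma wt_ge0 s : s \in clients x -> 0 <= wt x s.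
Proof. by move=> /wt_gt0/ltW. Qed.

Lemma pack_coef_ge0 row u : row \in pack_rows N x -> u \in all_vars N x -> 0 <= pc row u.
Proof.
move=> /mem_pack_rows rowP; rewrite mem_all_vars => /andP[ul uj].
case: rowP => [->|[m [d [-> ml dm]]]]; rewrite /pc /pack_coef /=.
  case: ifP uj => // _ sc; rewrite divr_ge0 ?(ltW V0)// mulr_ge0 ?wt_ge0//.
  by rewrite power_level// exprn_ge0// ltW.
by case: ifP => // _; rewrite divr_ge0 ?sdemand_ge0// power_level// exprn_ge0// ltW.
Qed.

Definition solution (u : bool * (nat * nat)) :=
  if u.1 then done u.2.1 u.2.2 else relevant x u.2.2 && missing u.2.1 u.2.2.

Lemma solution_pack_all row : row \in pack_rows N x ->
  \sum_(u <- all_vars N x | solution u) pc row u <= 1.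
Proof.
move=> /mem_pack_rows[->|[m [d [-> ml dm]]]]; rewrite big_all_vars /pc /pack_coef /solution /=.
  rewrite big1 ?add0r; last by move=> m _; rewrite big1.
  apply: (@le_trans _ _ (Z / V)); last by rewrite ler_pdivrMr// mul1r.
  under eq_bigr do rewrite big_mkcond.
  rewrite exchange_big /= /Z /missing_cost mulr_suml; apply: ler_sum => s _.
  rewrite mulr_sumr mulr_suml big_seq [leRHS]big_seq; apply: ler_sum => m ml.
  rewrite power_level//; case: (relevant x s) => /=; last by rewrite !mul0r.
  by case: (missing m s); rewrite ?mulr1// !mulr0 mul0r.
rewrite [X in _ + X]big1 ?addr0; last by move=> m' _; rewrite big1.
rewrite (bigD1_seq m)//=; last by rewrite levelsE iota_uniq.
rewrite [X in _ + X]big1 ?addr0; last first.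
  by move=> m' /negbTE m'm; rewrite big1// => j _; rewrite m'm.
under eq_bigr do rewrite eqxx power_level//.
by rewrite -mulr_suml ler_pdivrMr ?exprn_gt0// mul1r done_pack.
Qed.

(** Coefficients are nonnegative, so each one used by the solution is at most its row sum, hence at
    most 1: discarding large variables loses nothing of the solution. *)
Lemma solution_small u : u \in all_vars N x -> solution u -> u \in small_vars N x V.
Proof.
move=> uv su; rewrite mem_filter uv andbT; apply/allP => row rp.
apply: le_trans (solution_pack_all rp).
rewrite (perm_big _ (perm_to_rem uv)) big_cons su lerDl big_seq_cond sumr_ge0// => w /andP[wr _].
exact: pack_coef_ge0 rp (mem_rem wr).
Qed.

Lemma solution_pack row : row \in pack_rows N x ->
  \sum_(u <- small_vars N x V | solution u) pc row u <= 1.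
Proof.
move=> rp; apply: le_trans (solution_pack_all rp).
rewrite big_filter_cond [leLHS]big_mkcond [leRHS]big_mkcond big_seq [leRHS]big_seq.
apply: ler_sum => u uv; case: (all _ _) => //=.
by case: ifP => // _; exact: pack_coef_ge0.
Qed.

Lemma solution_cover r : r \in cover_rows N x ->
  has (fun u => solution u && cover_coef r u) (small_vars N x V).
Proof.
case: r => m [s j]; rewrite mem_cover_rows => /and5P[ml sc jj jm jb].
have [dj|dj] := boolP (done m j).
  apply/hasP; exists (true, (m, j)); last by rewrite /solution /cover_coef /= dj !eqxx.
  by apply: solution_small => //; rewrite mem_all_vars /= ml jj.
have ms : missing m s by apply/hasP; exists j => //; rewrite jm jb.
have rs : relevant x s by apply/hasP; exists j => //; rewrite jm jb.
apply/hasP; exists (false, (m, s)); last by rewrite /solution /cover_coef /= rs ms !eqxx.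
by apply: solution_small => //; [rewrite mem_all_vars /= ml sc|rewrite /solution /= rs ms].
Qed.

Lemma solverE : solver N x V = iter (size (cover_rows N x) * K)
  (mw_step (pack_rows N x) (cover_rows N x) (small_vars N x V) pc cover_coef N%:R^-1 K) [::].
Proof.
rewrite /solver.
have -> : (size (cover_rows N x) * K)%N = size (solver_fuel N x).
  rewrite /solver_fuel /K; elim: (cover_rows N x) => //= y s IH.
  by rewrite size_cat size_map mulSn IH.
by elim: (solver_fuel N x) => //= y s ->.
Qed.

Lemma KE : K = (N * N * (size (pack_rows N x) * size (cover_rows N x)))%N.
Proof.
rewrite /K /unit_fuel; elim: (pack_rows N x) => [|y s IH] /=; first by rewrite mul0n muln0.
rewrite size_cat IH mulSn mulnDr; congr (_ + _)%N.
by elim: (cover_rows N x) => [|z t IHt] /=; rewrite ?muln0// size_cat size_nseq IHt mulnS.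
Qed.

Local Opaque unit_fuel solver.

Lemma small_vars_all u : u \in small_vars N x V -> u \in all_vars N x.
Proof. by rewrite mem_filter => /andP[]. Qed.

Hypothesis K0 : (0 < K)%N.

Lemma solver_correct : let h := solver N x V in
  [/\ {subset h <= all_vars N x},
      forall row, row \in pack_rows N x -> \sum_(u <- h) pc row u <= Kp &
      forall r, r \in cover_rows N x -> (K <= count (cover_coef r) h)%N].
Proof.
have e_bounds : 0 < (N%:R^-1 : rat) <= 2^-1.
  by rewrite invr_gt0 ltr0n ltnW//= lef_pV2 ?posrE ?ltr0n ?(ltnW N1)// ler_nat.
have pcb row u : row \in pack_rows N x -> u \in small_vars N x V -> 0 <= pc row u <= 1.
  move=> rp uv; rewrite pack_coef_ge0 ?small_vars_all//=.
  by move: uv; rewrite mem_filter => /andP[/allP/(_ row rp)].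
have width h row : row \in pack_rows N x -> {subset h <= small_vars N x V} ->
    pack_weight pc N%:R^-1 h row * (1 - N%:R^-1) ^+ K <=
      (size (pack_rows N x))%:R * (size (cover_rows N x))%:R ->
    \sum_(u <- h) pc row u + 1 <= Kp.
  move=> rp hv; rewrite -natrM /Kp KE => H; apply: (mw_width R) => //.
    by move: K0; rewrite KE muln_gt0 => /andP[].
  by move=> u /hv uv; exact: pcb.
have := mw_correct e_bounds pcb solution_pack solution_cover Kp_ge0 width (leqnn _).
by rewrite -solverE => -[hv H1 H2]; split => // u /hv/small_vars_all.
Qed.

Let h := solver N x V.
(** Divided by [K], the counts are the fractional values: the part of a job that is done and the
    part of a group that is missing. *)
Definition count_job m j := count (fun u => [&& u.1, u.2.1 == m & u.2.2 == j]) h.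
Definition count_client m s := count (fun u => [&& ~~ u.1, u.2.1 == m & u.2.2 == s]) h.

Lemma count_natr (P : pred (bool * (nat * nat))) :
  (count P h)%:R = \sum_(u <- h) (if P u then 1 else 0) :> rat.
Proof. by rewrite -big_mkcond big_const_seq iter_addr_0. Qed.

Lemma count_job_pack m d : m \in levels N x -> d \in machines x ->
  \sum_(j <- jobs x) sdemand x d j * (count_job m j)%:R <= Kp * a ^+ m.
Proof.
move=> ml dm; have [hv hp _] := solver_correct.
have rp : (true, (m, d)) \in pack_rows N x.
  by rewrite inE; apply/orP; right; apply/flatten_mapP; exists m => //; apply/mapP; exists d.
have := hp _ rp; rewrite -(ler_pM2r (exprn_gt0 m a_gt0)) => /(le_trans _); apply.
rewrite mulr_suml; under eq_bigr do rewrite count_natr mulr_sumr.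
rewrite exchange_big /=; apply: ler_sum => -[b [m' j']] _.
rewrite /pc /pack_coef /= power_level//.
case: b => /=; last by rewrite mul0r big1// => j _; rewrite mulr0.
case: (m' == m) => /=; last by rewrite mul0r big1// => j _; rewrite mulr0.
rewrite divfK ?gt_eqF ?exprn_gt0//.
apply: le_trans (sum_delta_le (F := sdemand x d) (iota_uniq _ _) (sdemand_ge0 d j')).
by apply: ler_sum => j _; case: eqP => _; rewrite ?mulr1 ?mulr0.
Qed.

Lemma count_client_pack :
  \sum_(s <- clients x) wt x s * \sum_(m <- levels N x) a ^+ m * (count_client m s)%:R <= Kp * V.
Proof.
have [hv hp _] := solver_correct.
have rp : (false, (0, 0))%N \in pack_rows N x by rewrite inE eqxx.
have := hp _ rp; rewrite -(ler_pM2r V0) => /(le_trans _); apply.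
rewrite mulr_suml.
under eq_bigr => s _.
  rewrite mulr_sumr; under eq_bigr do rewrite count_natr mulr_sumr mulr_sumr.
  rewrite exchange_big /=; over.
rewrite exchange_big /= big_seq [leRHS]big_seq; apply: ler_sum => -[b [m' s']] uh.
have := hv _ uh; rewrite mem_all_vars /pc /pack_coef /= => /andP[ml].
case: b {uh} => /= sc.
  by rewrite mul0r big1// => s _; rewrite big1// => m _; rewrite !mulr0.
rewrite power_level// divfK ?gt_eqF//.
apply: le_trans (sum_delta_le (F := fun s => wt x s * a ^+ m') (iota_uniq _ _) _); last first.
  by rewrite mulr_ge0 ?wt_ge0// exprn_ge0// ltW.
rewrite big_seq [leRHS]big_seq; apply: ler_sum => s sc'; case: eqP => _; last first.
  by rewrite big1// => m _; rewrite andbF !mulr0.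
rewrite -mulr_sumr ler_wpM2l ?wt_ge0//.
apply: le_trans (sum_delta_le (F := fun m => a ^+ m) (iota_uniq _ _) _); last first.
  by rewrite exprn_ge0// ltW.
by rewrite levelsE; apply: ler_sum => m _; case: eqP => _; rewrite ?mulr1 ?mulr0.
Qed.

Lemma count_cover m s j : m \in levels N x -> s \in clients x -> j \in jobs x ->
  member x s j -> busy x j -> (K <= count_job m j + count_client m s)%N.
Proof.
move=> ml sc jj jm jb; have [_ _ hc] := solver_correct.
apply: leq_trans (hc (m, (s, j)) _) _; first by rewrite mem_cover_rows ml sc jj jm jb.
exact: count_cover_coef.
Qed.

Lemma two_le_growth : 2 <= a ^+ N.
Proof.
apply: le_trans (bernoulli _ (_ : 0 <= N%:R^-1)); last by rewrite invr_ge0.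
by rewrite divff ?pnatr_eq0 -?lt0n ?(ltnW N1).
Qed.

Section Shift.
Variables (i sh : nat).
Hypothesis iK : (i < K)%N.
Hypothesis shN : (sh < N)%N.
Variable st : seq nat.
Hypothesis stE : forall j, j \in jobs x -> nth 0%N st j = stage N x h i sh j.

Lemma level_lt k : (k < k0)%N -> (N * k + sh)%N \in levels N x.
Proof.
move=> kk; rewrite levelsE mem_iota add0n /=.
by apply: (@leq_trans (N * k.+1)%N); [rewrite mulnS addnC ltn_add2r|rewrite leq_mul2l kk orbT].
Qed.

(** A job of stage [k.+1] was found with at least [i.+1] units at level N k + sh, so [i.+1] times
    the scaled load is at most the packed demand at that level. *)
Lemma load_bound k : (k <= k0)%N ->
  load x st k.+1 * scale x <= Kp / i.+1%:R * a ^+ (N * k + sh).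
Proof.
have rhs0 : 0 <= Kp / i.+1%:R * a ^+ (N * k + sh).
  by apply: mulr_ge0; [exact: divr_ge0|exact: exprn_ge0 (ltW a_gt0)].
have s0 : 0 < scale x by exact: lt_le_trans scale_ge1.
rewrite leq_eqVlt => kk; rewrite -ler_pdivlMr//.
rewrite /load /rmax big_seq; apply: bigmax_le => [|d dm]; first by rewrite divr_ge0// ltW.
rewrite ler_pdivlMr// /rsum mulr_suml.
case/predU1P: kk => [->|kk].
  (* The last stage holds jobs that were never found. It is bounded by the total scaled demand, at
     most 2^k0 and so at most a^(N k0); the factor [Kp / i.+1%:R] is at least 1. *)
  apply: (@le_trans _ _ (a ^+ (N * k0))).
    apply: (@le_trans _ _ (2 ^+ k0)); last by rewrite exprM lerXn2r ?nnegrE ?exprn_ge0 ?(ltW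
      a_gt0)// two_le_growth.
    apply: le_trans (log_fuelP _); rewrite /rsum (perm_big _ (perm_to_rem dm)) big_cons.
    apply: ler_wpDr; first by rewrite sumr_ge0// => ? _; rewrite sumr_ge0// => ? _; exact:
      sdemand_ge0.
    by apply: ler_sum => j _; case: ifP => _; rewrite ?mul0r ?sdemand_ge0.
  rewrite exprD mulrCA ler_peMr ?exprn_ge0 ?(ltW a_gt0)// mulr_ege1//; last by rewrite
    exprn_ege1// ltW// growth_gt1.
  rewrite ler_pdivlMr// mul1r (@le_trans _ _ K%:R) ?ler_nat// /Kp ler_peMr// lerDl mulr_ge0//
    invr_ge0//.
have ml := level_lt kk.
rewrite mulrAC ler_pdivlMr// -(ler_pM2r (_ : 0 < 1)) // !mulr1.
apply: le_trans (count_job_pack ml dm); rewrite mulr_suml big_seq [leRHS]big_seq; apply: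
  ler_sum => j jj.
rewrite stE//; case: ifP => [/eqP stk|_]; last by rewrite !mul0r mulr_ge0// sdemand_ge0.
rewrite -/(sdemand x d j) ler_wpM2l ?sdemand_ge0// ler_nat.
move: stk; rewrite /stage; case: ifP => // _ [fk].
pose P k' := (i < count_job (N * k' + sh) j)%N; have {}fk : find P (indices (fuel x)) = k := fk.
have hP : has P (indices (fuel x)) by rewrite has_find fk size_iota.
by have := nth_find 0%N hP; rewrite fk nth_iota.
Qed.

Lemma load0 : load x st 0 = 0.
Proof.
apply/eqP; rewrite eq_le rmax_ge0 andbT /load /rmax big_seq; apply: bigmax_le => // d dm.
rewrite /rsum big_seq big1// => j jj; rewrite stE// /stage.
have [//|bj] := boolP (busy x j); rewrite eqxx.
by apply/eqP; apply: contraNT bj => dj; apply/hasP; exists d.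
Qed.

(** The first stage is charged to all relevant groups. Stage k + 2 is charged only if some busy job
    of the group has at most [i] units at level N k + sh; by covering, the group then misses at
    least [K - i] units there. The stage length exceeds this level by the factor [a ^+ N]. *)
Lemma cost_bound : i.+1%:R * (cost x st * scale x) <= Kp * \sum_(s <- clients x)
  (if relevant x s then wt x s else 0) * (a ^+ sh + a ^+ N * \sum_(k <- iota 0 k0)
     a ^+ (N * k + sh) * (if (K <= count_client (N * k + sh) s + i)%N then 1 else 0)).
Proof.
have s0 : 0 < scale x by exact: lt_le_trans scale_ge1.
have q0 : 0 <= Kp / i.+1%:R by rewrite divr_ge0.
rewrite -ler_pdivlMl// mulrA (mulrC _^-1) /cost /rsum mulr_suml mulr_sumr.
rewrite big_seq [leRHS]big_seq; apply: ler_sum => s sc.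
case: ifP => [rs|nrs]; last first.
  rewrite mul0r mulr0 [X in _ * X * _]big1 ?mulr0 ?mul0r// => k _; case: ifP => // /hasP[j jj
    /andP[jm]].
  have -> : nth 0%N st j = 0%N.
    rewrite stE// /stage; case: ifP => // jb; move: nrs.
    by rewrite (_ : relevant x s) //; apply/hasP; exists j => //; rewrite jm jb.
  by rewrite leqn0 => /eqP ->; exact: load0.
rewrite [leRHS]mulrCA -[leLHS]mulrA ler_wpM2l ?wt_ge0//.
rewrite /stages /indices /= big_cons big_cons load0 !if_same add0r [leLHS]mulrDl [leRHS]mulrDr.
apply: lerD.
  have := load_bound (leq0n k0); rewrite muln0 add0n; case: ifP => // _ _.
  by rewrite mul0r mulr_ge0// exprn_ge0// ltW.
rewrite (iotaDl 2 0) big_map mulr_suml !mulr_sumr big_seq [leRHS]big_seq; apply: ler_sum => k.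
rewrite mem_iota add0n => /andP[_ kk].
case: ifP => [/hasP[j jj /andP[jm]]|_]; last first.
  by rewrite mul0r !mulr_ge0 ?exprn_ge0 ?(ltW a_gt0)//; case: ifP.
rewrite stE// /stage; case: ifP => // jb; rewrite add2n ltnS => kf.
have ml := level_lt kk.
have -> : (K <= count_client (N * k + sh) s + i)%N.
  have := before_find 0%N kf; rewrite nth_iota// add0n => /negbT; rewrite -leqNgt => ci.
  by have := count_cover ml sc jj jm jb; rewrite addnC => /leq_trans; apply; rewrite leq_add2l.
rewrite mulr1 -exprD addnA -mulnS.
exact: load_bound.
Qed.

End Shift.

(** The bounds of all pairs are added with weight [i.+1], which cancels the [i.+1] in the load
    bound. What remains is, for each level, the number of thresholds that a group fails, at most its
    missing units. The shifted levels N k + sh run over every level once, and the first stages sum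
    to N (a^N - 1). *)
Lemma guess_bound B :
  (forall i sh, (i < K)%N -> (sh < N)%N ->
    B <= cost x [seq stage N x h i sh j | j <- jobs x] * scale x) ->
  N%:R * (K%:R ^+ 2 / 2) * B <= Kp * a ^+ N * (K%:R * N%:R * W + Kp * V).
Proof.
move=> HB.
have a0 n : 0 <= a ^+ n by rewrite exprn_ge0// ltW.
have [B0|Bn] := leP 0 B; last first.
  apply: (@le_trans _ _ 0); first by rewrite mulr_ge0_le0 ?(ltW Bn)// mulr_ge0// divr_ge0//
    exprn_ge0.
  rewrite !mulr_ge0// addr_ge0// !mulr_ge0// ?(ltW V0)//.
  by rewrite /W /weight_total /rsum big_seq sumr_ge0// => s sc; case: ifP => // _; exact: wt_ge0.
pose w s := if relevant x s then wt x s else 0.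
have w0 s : s \in clients x -> 0 <= w s by move=> sc; rewrite /w; case: ifP => // _; exact:
  wt_ge0.
pose bnd s i sh := a ^+ sh + a ^+ N * \sum_(k <- iota 0 k0)
     a ^+ (N * k + sh) * (if (K <= count_client (N * k + sh) s + i)%N then 1 else 0).
apply: (@le_trans _ _ (\sum_(sh <- iota 0 N) \sum_(i <- iota 0 K) i.+1%:R * B)).
  rewrite -mulrA mulr_natl big_const_seq iter_addr_0 count_predT size_iota.
  rewrite lerMn2r -mulr_suml; apply/orP; right.
  by apply: ler_wpM2r => //; exact: sum_succ_ge.
apply: (@le_trans _ _ (\sum_(sh <- iota 0 N) \sum_(i <- iota 0 K) Kp * \sum_(s <- clients x) w
  s * bnd s i sh)).
  rewrite big_seq [leRHS]big_seq; apply: ler_sum => sh; rewrite mem_iota => /andP[_ shN].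
  rewrite big_seq [leRHS]big_seq; apply: ler_sum => i; rewrite mem_iota => /andP[_ iK].
  apply: (le_trans _ (cost_bound iK shN (st := [seq stage N x h i sh j | j <- jobs x]) _)).
    by rewrite ler_wpM2l// HB.
  by move=> j jj; rewrite nth_indices_map.
under eq_bigr do rewrite -mulr_sumr exchange_big /=.
rewrite -mulr_sumr exchange_big /= -mulrA ler_wpM2l//.
apply: (@le_trans _ _ (\sum_(s <- clients x) w s * (a ^+ N * (K%:R * N%:R +
    \sum_(m <- levels N x) a ^+ m * (count_client m s)%:R)))).
  rewrite big_seq [leRHS]big_seq; apply: ler_sum => s sc.
  under eq_bigr do rewrite -mulr_sumr.
  rewrite -mulr_sumr ler_wpM2l ?w0// /bnd.
  under eq_bigr do rewrite big_split /= -mulr_sumr exchange_big /=.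
  rewrite big_split /= -mulr_sumr mulrDr; apply: lerD.
    under eq_bigr do rewrite big_const_seq iter_addr_0 count_predT size_iota -mulr_natl.
    rewrite -mulr_sumr sum_pow_iota ?(ltnW N1)// mulrA mulrC ler_wpM2r ?mulr_ge0//.
    by rewrite gerBl.
  rewrite ler_wpM2l// levelsE sum_iota_mul exchange_big /=.
  apply: ler_sum => k _; apply: ler_sum => sh _.
  by rewrite -mulr_sumr ler_wpM2l// sum_threshold.
under eq_bigr do rewrite mulrCA.
rewrite -mulr_sumr ler_wpM2l//.
under eq_bigr do rewrite mulrDr.
rewrite big_split /= -mulr_suml mulrC; apply: lerD; first exact: lexx.
apply: le_trans count_client_pack; rewrite big_seq [leRHS]big_seq; apply: ler_sum => s sc.
rewrite ler_wpM2r ?sumr_ge0// => [m _|]; first by rewrite mulr_ge0.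
by rewrite /w; case: ifP => // _; exact: wt_ge0.
Qed.

End Guess.

Lemma best_le c : c \in candidates N x -> cost x (best N x) <= cost x c.
Proof.
rewrite /best; elim: (candidates N x) => //= b s IH; rewrite inE => /predU1P[->|/IH cs].
  by case: ifP => // /negbT; rewrite -ltNge => /ltW.
by case: ifP => // H; exact: le_trans cs.
Qed.

(** The guess used is the least power with Z <= W a^g. By minimality it overshoots Z by at most a
    factor a; for g = 0 this is the hypothesis W <= Z. The overshoot is the additional power in
    [a ^+ N.+1]. *)
Lemma best_rat : 0 < W -> W <= Z ->
  cost x (best N x) * scale x <=
    2 / N%:R * (1 + 7 * N%:R^-1) ^+ 2 * a ^+ N.+1 * (N%:R * W + Z).
Proof.
move=> W0 WZ.
have a0 n : 0 < a ^+ n by rewrite exprn_gt0.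
pose P g := Z <= W * a ^+ g.
(* Even if every group misses every level, Z is at most W times a geometric sum below N a^(N k0), so
   a suitable guess is in range. *)
have Zub : P (N * k0 + N * N)%N.
  rewrite /P /Z /missing_cost /W /weight_total /rsum mulr_suml big_seq [leRHS]big_seq.
  apply: ler_sum => s sc; rewrite ler_wpM2l//; first by case: ifP => // _; rewrite ltW// wt_gt0.
  apply: (@le_trans _ _ (\sum_(m <- levels N x) a ^+ m)).
    by apply: ler_sum => m _; case: ifP => _; rewrite ?mulr1// mulr0 ltW.
  rewrite levelsE sum_pow_iota ?(ltnW N1)// exprD mulrC.
  apply: ler_pM => //; first by rewrite subr_ge0 exprn_ege1// ltW// growth_gt1.
    by rewrite gerBl.
  rewrite exprM; apply: (@le_trans _ _ (2 ^+ N)).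
    by rewrite -natrX ler_nat ltnW// ltn_expl.
  by rewrite lerXn2r ?nnegrE ?(ltW (a0 _))// two_le_growth.
have [g [gP gmin]] : exists g, P g /\ forall g', (g' < g)%N -> ~~ P g'.
  have exP : exists g, P g by exists (N * k0 + N * N)%N.
  exists (ex_minn exP); case: ex_minnP => g Pg gm; split => // g' g'g.
  by apply/negP => /gm; rewrite leqNgt g'g.
have gb : (g <= N * k0 + N * N)%N by rewrite leqNgt; apply/negP => /gmin; rewrite Zub.
have gguess : g \in guesses N x by rewrite guessesE mem_iota; lia.
have VaZ : W * a ^+ g <= a * Z.
  case: g gP gmin {gb gguess} => [|g] gP gmin.
    by rewrite expr0 mulr1 (le_trans WZ)// ler_peMl ?(le_trans (ltW W0))// ltW// growth_gt1.
  by rewrite exprS mulrCA ler_wpM2l ?(ltW a_gt0)// ltW// ltNge gmin.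
set V := W * a ^+ g in gP VaZ.
have V0 : 0 < V by rewrite mulr_gt0.
(* Without covering rows no relevant group would have a busy job, and Z would be 0. *)
have K0 : (0 < K)%N.
  rewrite KE !muln_gt0 ltnW//=; rewrite lt0n size_eq0; apply/eqP => cr0.
  have : 0 < Z by exact: lt_le_trans WZ.
  rewrite /Z /missing_cost big_seq big1 ?ltxx// => s sc.
  have [rs|] := ifP; last by rewrite mul0r.
  rewrite big_seq big1 ?mulr0// => m ml; move: rs => /hasP[j jj /andP[jm jb]].
  by have := mem_cover_rows m s j; rewrite cr0 ml sc jj jm jb.
have s0 : 0 < scale x by exact: lt_le_trans scale_ge1.
have H : N%:R * (K%:R ^+ 2 / 2) * (cost x (best N x) * scale x) <=
    Kp * a ^+ N * (K%:R * N%:R * W + Kp * V).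
  apply: (guess_bound V0 gP K0) => i sh iK shN.
  rewrite ler_pM2r// best_le//; apply/flatten_mapP; exists g => //.
  apply/flatten_mapP; exists i; first by rewrite mem_iota.
  apply/mapP; exists sh; first by rewrite mem_iota.
  by rewrite /candidate powerE//; lia.
have Kr : 0 < K%:R :> rat by rewrite ltr0n.
have Nr : 0 < N%:R :> rat by rewrite ltr0n ltnW.
set y := 1 + 7 * N%:R^-1; have y1 : 1 <= y by rewrite /y lerDl mulr_ge0// invr_ge0.
have H2 : Kp * a ^+ N * (K%:R * N%:R * W + Kp * V) <=
   K%:R ^+ 2 * (y ^+ 2 * a ^+ N.+1 * (N%:R * W + Z)).
  rewrite (exprS a); apply: (@rounding_arith K%:R y a (a ^+ N) N%:R W Z V).
  - exact: ler0n.
  - exact: y1.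
  - exact: ltW growth_gt1.
  - exact: ltW (a0 N).
  - exact: mulr_ge0 (ltW Nr) (ltW W0).
  - exact: VaZ.
have := le_trans H H2; rewrite -/y.
set T := y ^+ 2 * _ * _; move: (cost _ _ * _) => B {}H.
have : K%:R ^+ 2 * (N%:R / 2 * B) <= K%:R ^+ 2 * T by apply: le_trans H; lra.
rewrite ler_pM2l ?exprn_gt0// => {}H.
rewrite -(ler_pM2l (_ : 0 < N%:R / 2)) ?divr_gt0//; apply: (le_trans H).
rewrite le_eqVlt; apply/orP; left; apply/eqP; rewrite /T.
have E (t c d : rat) : t ^+ 2 * c * d = N%:R / 2 * (2 / N%:R * t ^+ 2 * c * d).
  by field; rewrite gt_eqF.
exact: E.
Qed.


End Correctness.

Lemma no_relevant_cost N (x : raw) : (forall s, s \in clients x -> ~~ relevant x s) ->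
  cost x (best N x) <= 0.
Proof.
move=> nrel; apply: (@le_trans _ _ (cost x (default_candidate x))).
  rewrite /best; elim: (candidates N x) => //= b s IH.
  by case: ifP => // H; exact: le_trans IH.
rewrite /cost /rsum big_seq big1// => s sc; rewrite big1 ?mulr0// => k _.
case: ifP => // /hasP[j jj /andP[jm]].
have dE i : i \in jobs x -> nth 0%N (default_candidate x) i = if busy x i then 1%N else 0%N.
  by move=> ij; rewrite nth_indices_map.
have -> : nth 0%N (default_candidate x) j = 0%N.
  rewrite dE//; case: ifP => // jb; move: (nrel s sc).
  by rewrite (_ : relevant x s) //; apply/hasP; exists j => //; rewrite jm jb.
rewrite leqn0 => /eqP ->.
apply/eqP; rewrite eq_le rmax_ge0 andbT /load /rmax big_seq; apply: bigmax_le => // d dm.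
rewrite /rsum big_seq big1// => i ij; rewrite dE//.
have [//|bi] := boolP (busy x i); rewrite eqxx.
by apply/eqP; apply: contraNT bi => di; apply/hasP; exists d.
Qed.

(** As long as a^M < c, the full sum is N (a^(M+1) - 1), and the summand N just cancels the -N,
    leaving N a a^M < N a c. Later terms vanish. The added N accounts for the first stages of all
    shifts. *)
Lemma geometric_part (R : realType) (N M : nat) (c : R) : (0 < N)%N -> 1 < c ->
  N%:R + \sum_(m <- iota 0 M) ratr (growth N ^+ m) * (if ratr (growth N ^+ m) < c then 1 else 0)
  <= N%:R * ratr (growth N) * c.
Proof.
move=> N0 c1.
have a1 : 1 <= ratr (growth N) :> R.
  by rewrite -[leLHS](ratr_nat R 1) ler_rat lerDl invr_ge0.
have a0 : 0 < ratr (growth N) :> R by exact: lt_le_trans a1.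
elim: M => [|M IH]; first by rewrite big_nil addr0 -mulrA ler_peMr// mulr_ege1// ltW.
have [Mc|cM] := ltP (ratr (growth N ^+ M)) c; last first.
  by rewrite -addn1 iotaD big_cat big_seq1 add0n ltNge cM /= mulr0 addr0.
apply: (@le_trans _ _ (N%:R + \sum_(m <- iota 0 M.+1) ratr (growth N ^+ m))).
  rewrite lerD2l; apply: ler_sum => m _; case: ifP => _; rewrite ?mulr1// mulr0.
  by rewrite ler0q exprn_ge0// addr_ge0// invr_ge0.
rewrite -rmorph_sum sum_pow_iota// rmorphM rmorphB rmorph1 /= ratr_nat mulrBr mulr1 addrC subrK.
rewrite exprS rmorphM /= -mulrA; apply: ler_wpM2l => //.
by apply: ler_wpM2l; exact: ltW.
Qed.

(** * Comparison with the completion times of a schedule *)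

Section RealBound.
Variables (R : realType) (N : nat) (x : raw) (C Cs : nat -> R).
Hypothesis N1 : (1 < N)%N.
Hypothesis demand_ge0 : forall d j, 0 <= demand x d j.
Hypothesis wt_gt0 : forall s, s \in clients x -> 0 < wt x s.
Hypothesis Cs_ge0 : forall s, 0 <= Cs s.
Hypothesis CCs : forall s j, s \in clients x -> j \in jobs x -> member x s j -> C j <= Cs s.
Hypothesis C_load : forall d (tau : rat), d \in machines x -> 0 <= tau ->
  \sum_(j <- jobs x | C j <= ratr tau) demand x d j <= tau.

Let a := growth N.
Let finished m j := C j <= ratr (a ^+ m / scale x).

Let scale_gt0 : 0 < scale x.
Proof. by apply: lt_le_trans (scale_ge1 _). Qed.

Lemma demand_scale d j : d \in machines x -> j \in jobs x -> demand x d j != 0 ->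
  (scale x)^-1 < demand x d j.
Proof.
move=> dm jj q0; have qp : 0 < demand x d j by rewrite lt_def q0 demand_ge0.
rewrite -[ltRHS]invrK ltf_pV2 ?posrE ?invr_gt0// /scale.
have -> : (demand x d j)^-1 = 0 + (demand x d j)^-1 by rewrite add0r.
rewrite ltr_leD// /rsum (perm_big _ (perm_to_rem dm)) big_cons.
apply: ler_wpDr; first by rewrite sumr_ge0// => ? _; rewrite sumr_ge0// => ? _; rewrite invr_ge0.
rewrite (perm_big _ (perm_to_rem jj)) big_cons lerDl.
by rewrite sumr_ge0// => ? _; rewrite invr_ge0.
Qed.

(** By time 1 / scale the completed load on a machine is at most 1 / scale, which is less than any
    single nonzero demand. *)
Lemma completion_lb j : j \in jobs x -> busy x j -> ratr (scale x)^-1 < C j.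
Proof.
move=> jj /hasP[d dm q0]; rewrite ltNge; apply/negP => Cj.
have := C_load dm (ltW (_ : 0 < (scale x)^-1)); rewrite invr_gt0 => /(_ scale_gt0).
rewrite leNgt => /negP; apply; apply: lt_le_trans (demand_scale dm jj q0) _.
rewrite (perm_big _ (perm_to_rem jj)) big_cons Cj lerDl.
by rewrite sumr_ge0.
Qed.

Lemma best_bound :
  ratr (cost x (best N x)) <=
    2 * (1 + 7 * N%:R^-1) ^+ 2 * (1 + N%:R^-1) ^+ 2 * (1 + N%:R^-1) ^+ N *
    \sum_(s <- clients x) ratr (wt x s) * Cs s.
Proof.
have [nrel|] := boolP (all (fun s => ~~ relevant x s) (clients x)).
  apply: (@le_trans _ _ 0).
    by rewrite lerq0 no_relevant_cost// => s sc; exact: (allP nrel).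
  rewrite !mulr_ge0// ?exprn_ge0// ?addr_ge0// ?mulr_ge0// ?invr_ge0//.
  by rewrite big_seq sumr_ge0// => s sc; rewrite mulr_ge0// ler0q ltW// wt_gt0.
rewrite -has_predC => /hasP[s0 s0c /= /negPn rs0].
have done_pack m d : m \in levels N x -> d \in machines x ->
    \sum_(j <- jobs x | finished m j) sdemand x d j <= a ^+ m.
  move=> ml dm; rewrite -mulr_suml -ler_pdivlMr//; apply: C_load => //.
  by rewrite divr_ge0 ?(ltW scale_gt0)// exprn_ge0// addr_ge0// invr_ge0.
have sr0 : 0 < ratr (scale x) :> R by rewrite ltr0q.
have a1 : 1 < a by exact: growth_gt1.
have ra0 : 0 <= ratr a :> R by rewrite ler0q ltW// (lt_trans ltr01).
have w0 s : s \in clients x -> 0 <= (if relevant x s then wt x s else 0).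
  by move=> sc; case: ifP => // _; rewrite ltW// wt_gt0.
have W0 : 0 < weight_total x.
  rewrite /weight_total /rsum (perm_big _ (perm_to_rem s0c)) big_cons rs0 ltr_wpDr ?wt_gt0//.
  by rewrite big_seq sumr_ge0// => s /mem_rem/w0.
(* A relevant group has a scaled demand above 1, so the fuel is nonempty and level 0 exists. *)
have lv0 : 0%N \in levels N x.
  rewrite levelsE mem_iota add0n muln_gt0 (ltnW N1)/= lt0n.
  apply: contraTneq rs0 => f0; apply/hasP => -[j jj /andP[_ /hasP[d dm q0]]].
  have := log_fuelP (rsum (machines x) (fun d => rsum (jobs x) (fun j => sdemand x d j))).
  rewrite -/(fuel x) f0 expr0 leNgt => /negP; apply.
  have : 1 < sdemand x d j by rewrite -ltr_pdivrMr// mul1r demand_scale.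
  move=> /lt_le_trans; apply; rewrite /rsum (perm_big _ (perm_to_rem dm)) big_cons.
  apply: ler_wpDr; first by rewrite sumr_ge0// => ? _; rewrite sumr_ge0// => ? _; exact:
    sdemand_ge0.
  rewrite (perm_big _ (perm_to_rem jj)) big_cons lerDl sumr_ge0// => ? _; exact: sdemand_ge0.
(* Level 0 is the time 1 / scale, when no busy job is complete, so every relevant group contributes
   its full weight there. *)
have WZ : weight_total x <= missing_cost N x finished.
  rewrite /missing_cost /weight_total /rsum big_seq [leRHS]big_seq; apply: ler_sum => s sc.
  have [rs|] := boolP (relevant x s); last by rewrite mul0r.
  rewrite ler_peMr ?(ltW (wt_gt0 sc))// (perm_big _ (perm_to_rem lv0)) big_cons expr0 mul1r.
  have -> : missing x finished 0 s.
    move: rs => /hasP[j jj /andP[jm jb]]; apply/hasP; exists j => //.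
    by rewrite jm jb /= /finished expr0 mul1r -ltNge completion_lb.
  rewrite lerDl sumr_ge0// => m _; case: ifP => _; rewrite ?mulr1 ?mulr0//.
  by rewrite exprn_ge0// ltW// (lt_trans ltr01).
have := best_rat R N1 demand_ge0 wt_gt0 done_pack W0 WZ.
rewrite -(ler_rat R) => H.
have NZ : ratr (N%:R * weight_total x + missing_cost N x finished) <=
    N%:R * ratr a * ratr (scale x) * \sum_(s <- clients x) ratr (wt x s) * Cs s.
  rewrite /weight_total /missing_cost /rsum [X in ratr (X + _)]mulr_sumr -big_split /=
    rmorph_sum /= [leRHS]mulr_sumr.
  rewrite big_seq [leRHS]big_seq; apply: ler_sum => s sc.
  have wr : 0 <= ratr (wt x s) :> R by rewrite ler0q ltW// wt_gt0.
  have [rs|_] := boolP (relevant x s); last first.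
    rewrite mul0r mulr0 addr0 rmorph0.
    by apply: mulr_ge0; apply: mulr_ge0 => //; [exact: mulr_ge0|exact: ltW].
  rewrite [X in ratr (X + _)]mulrC -mulrDr rmorphM [leRHS]mulrCA; apply: ler_wpM2l => //=.
  rewrite rmorphD rmorph_sum /= ratr_nat.
  (* In scaled time a relevant group completes after time 1, as the geometric estimate requires. *)
  have c1 : 1 < ratr (scale x) * Cs s.
    move: rs => /hasP[j jj /andP[jm jb]].
    rewrite -ltr_pdivrMl// mulr1 -fmorphV; exact: lt_le_trans (completion_lb jj jb) (CCs sc jj
      jm).
  have G := geometric_part (N * size (fuel x)) (ltnW N1) c1.
  rewrite -[leRHS]mulrA. apply: (le_trans _ G).
  rewrite levelsE lerD2l; apply: ler_sum => m _.
  rewrite rmorphM /=; apply: ler_wpM2l; first by rewrite ler0q exprn_ge0// ltW// (lt_trans ltr01).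
  case: ifP => [/hasP[j jj /andP[/andP[jm jb]]]|_]; last by rewrite rmorph0; case: ifP.
  rewrite /finished -ltNge => aC; rewrite rmorph1 ifT//.
  rewrite -ltr_pdivrMl// mulrC -fmorph_div; exact: lt_le_trans aC (CCs sc jj jm).
have aE : ratr a = 1 + N%:R^-1 :> R by rewrite /a /growth rmorphD rmorph1 fmorphV /= ratr_nat.
have Nr : N%:R != 0 :> R by rewrite pnatr_eq0 -lt0n ltnW.
have E2 : ratr (2 / N%:R) = 2 / N%:R :> R by rewrite fmorph_div /= !ratr_nat.
have E7 : ratr (1 + 7 * N%:R^-1) = 1 + 7 * N%:R^-1 :> R.
  by rewrite rmorphD rmorph1 fmorph_div /= !ratr_nat.
have EQ : ratr (2 / N%:R * (1 + 7 * N%:R^-1) ^+ 2 * a ^+ N.+1) =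
    2 / N%:R * (1 + 7 * N%:R^-1) ^+ 2 * (1 + N%:R^-1) ^+ N.+1 :> R.
  by rewrite rmorphM rmorphM /= !rmorphXn /= E2 E7 aE.
rewrite [leRHS]rmorphM [leLHS]rmorphM /= EQ in H.
rewrite -(ler_pM2r sr0); apply: (le_trans H).
apply: le_trans (ler_wpM2l _ NZ) _.
  by rewrite !mulr_ge0// ?exprn_ge0// ?addr_ge0// ?mulr_ge0// ?invr_ge0.
have E (t u y c S : R) : 2 / N%:R * t ^+ 2 * (u * y) * (N%:R * u * c * S) =
    2 * t ^+ 2 * u ^+ 2 * y * S * c by field.
by rewrite aE (exprS (1 + N%:R^-1) N) E.
Qed.

End RealBound.

(** * Schedules *)

Section StepFunctions.
Variable R : realType.
Local Notation mu := (@lebesgue_measure R).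

Lemma integral_step (s e r t : R) : 0 <= s -> 0 <= t ->
  (\int[mu]_(u in `[0%R, t]) (if s <= u < e then r else 0)%:E)%E =
  (r * Num.max 0 (Num.min t e - s))%:E.
Proof.
move=> s0 t0.
have -> : (\int[mu]_(u in `[0%R, t]) (if s <= u < e then r else 0)%:E)%E =
    (\int[mu]_(u in `[0%R, t] `&` `[s, e[) r%:E)%E.
  rewrite integral_mkcondr; apply: eq_integral => u _; rewrite patchE.
  by rewrite mem_setE in_itv /=; case: ifP.
have [es|se] := leP e s.
  rewrite (_ : _ `&` _ = set0); last first.
    by rewrite -subset0 => u /= [_]; rewrite in_itv /= => /andP[su ue]; have := lt_le_trans ue
      es; rewrite ltNge su.
  rewrite integral_set0 max_l ?mulr0//.
  by rewrite subr_le0 (le_trans _ es)// ge_min lexx orbT.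
have [te|et] := ltP t e.
  rewrite (_ : _ `&` _ = `[s, t]%classic); last first.
    apply/seteqP; split => u /=; rewrite !in_itv /=; first by move=> [/andP[_ ->] /andP[->]].
    move=> /andP[su ut]; rewrite su ut (le_trans s0 su)/= (le_lt_trans ut te); by [].
  rewrite integral_cst//= lebesgue_measure_itv /= lte_fin EFinM.
  case: ltP => st; first by rewrite -EFinB max_r ?subr_ge0 ?ltW.
  by rewrite max_l ?subr_le0.
rewrite (_ : _ `&` _ = `[s, e[%classic); last first.
  apply/seteqP; split => u /=; rewrite !in_itv /=; first by case.
  by move=> /andP[su ue]; rewrite su ue (le_trans s0 su)/= (ltW (lt_le_trans ue et)).
rewrite integral_cst//= lebesgue_measure_itv /= lte_fin se EFinM -EFinB.
by rewrite max_r// subr_ge0 ltW.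
Qed.

Lemma measurable_step (s e r : R) D : measurable D ->
  measurable_fun D (fun u : R => if s <= u < e then r else 0).
Proof.
move=> mD; have -> : (fun u : R => if s <= u < e then r else 0) = (fun u => r * \1_(`[s,
  e[%classic) u).
  by apply/funext => u; rewrite indicE mem_setE in_itv /=; case: ifP; rewrite ?mulr1 ?mulr0.
by apply: measurable_funM => //; apply: measurable_indic.
Qed.

Section Schedule.
Variable I : instance R.
Local Notation n := (njobs I).

(** Integrate the row d of B y <= 1 over [0, tau]: every job completed by then has received its
    whole requirement. Measurability comes from each rate being a step function. *)
Lemma feasible_load (y : R -> 'rV[R]_n) (d : 'I_(nrows I)) (tau : R) :
  valid I -> feasible [set: 'I_n]%SET y -> 0 <= tau ->
  \sum_(j | completion y j <= tau) ratr (bmat I d j * proc I j) <= tau.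
Proof.
move=> [p0 _ b0 _ rP] [yr yf _] tau0.
have y0 t j : 0 <= t -> 0 <= y t 0 j by move=> /yr/rP[+ _]; exact.
have my j : measurable_fun `[0%R, tau]%classic (fun t => y t 0 j).
  have [_ [s [r [s0 yE]]]] := yf j (finset.in_setT j).
  apply: (eq_measurable_fun (fun u => if s <= u < completion y j then r else 0)).
    by move=> u; rewrite inE /= in_itv /= => /andP[u0 _]; rewrite yE.
  exact: measurable_step.
rewrite -lee_fin -sumEFin.
apply: (@le_trans _ _ (\sum_j (ratr (bmat I d j))%:E * \int[mu]_(u in `[0%R, tau]) (y u 0%R
  j)%:E)%E).
  rewrite big_mkcond; apply: lee_sum => j _.
  have int0 : (0 <= \int[mu]_(u in `[0%R, tau]) (y u 0%R j)%:E)%E.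
    by apply: integral_ge0 => u /=; rewrite in_itv /= => /andP[u0 _]; rewrite lee_fin y0.
  case: ifP => Cj; last by rewrite mule_ge0// lee_fin ler0q.
  rewrite rmorphM EFinM lee_wpmul2l ?lee_fin ?ler0q//.
  have [[C0 pC] _] := yf j (finset.in_setT j).
  apply: (le_trans pC); apply: ge0_subset_integral => //=.
  - by apply/measurable_EFinP; exact: my.
  - by move=> u /=; rewrite in_itv /= => /andP[u0 _]; rewrite lee_fin y0.
  - by move=> u /=; rewrite !in_itv /= => /andP[-> uC]; exact: le_trans Cj.
under eq_bigr => j _.
  rewrite -ge0_integralZl_EFin//=; last 3 first.
  - by move=> u; rewrite in_itv /= => /andP[u0 _]; rewrite lee_fin y0.
  - by apply/measurable_EFinP; exact: my.
  - by rewrite ler0q.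
  over.
rewrite -ge0_integral_sum//=; last 2 first.
- by move=> j; apply/measurable_EFinP; apply: measurable_funM; [exact: measurable_cst|exact: my].
- by move=> j u; rewrite in_itv /= => /andP[u0 _]; rewrite lee_fin mulr_ge0 ?ler0q ?y0.
apply: (@le_trans _ _ (\int[mu]_(u in `[0%R, tau]) 1%:E)%E).
  apply: ge0_le_integral => //=.
  - move=> u; rewrite in_itv /= => /andP[u0 _]; apply: sume_ge0 => j _.
    by rewrite lee_fin mulr_ge0 ?ler0q ?y0.
  - rewrite (_ : (fun u => _) = (fun u => (\sum_j ratr (bmat I d j) * y u 0 j)%:E)); last first.
      by apply/funext => u; rewrite -sumEFin.
    apply/measurable_EFinP.
    by apply: measurable_sum => j; apply: measurable_funM; [exact: measurable_cst|exact: my].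
  - move=> u; rewrite in_itv /= => /andP[u0 _]; 
    rewrite (_ : (\sum_j _)%E = (\sum_j ratr (bmat I d j) * y u 0 j)%:E); last by rewrite
      -sumEFin.
    by rewrite lee_fin; have [_] := rP _ (yr u u0); exact.
by rewrite integral_cst//= mul1e lebesgue_measure_itv /= lte_fin; case: ltP => //; rewrite
  ?sube0 ?lee_fin.
Qed.

Lemma inf_ge (e : R) : inf [set t : R | e <= t] = e.
Proof.
have lb : lbound [set t : R | e <= t] e by [].
apply/eqP; rewrite eq_le; apply/andP; split.
  by apply: ge_inf => //=; exists e.
by apply: lb_le_inf => //; exists e => /=.
Qed.

(** The set of finishing times is a closed half-line, so the infimum defining [completion] is
    attained. *)
Lemma completion_step (y : R -> 'rV[R]_n) (j : 'I_n) (s r : R) :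
  0 <= s -> 0 < r -> 0 < proc I j ->
  (forall t, 0 <= t -> y t 0 j = if s <= t < s + ratr (proc I j) / r then r else 0) ->
  finished y j = [set t | s + ratr (proc I j) / r <= t] /\
  completion y j = s + ratr (proc I j) / r.
Proof.
move=> s0 r0 p0 yE; set e := s + _ / r.
have pr : 0 < ratr (proc I j) / r by rewrite divr_gt0// ltr0q.
suff fE : finished y j = [set t | e <= t] by split => //; rewrite /completion fE inf_ge.
apply/seteqP; split => t /=; rewrite /finished /=.
  move=> [t0]; rewrite (_ : (\int[_]_(_ in _) _)%E = (r * Num.max 0 (Num.min t e - s))%:E);
    last first.
    rewrite -integral_step//; apply: eq_integral => u; rewrite inE /= in_itv /= => /andP[u0 _].
    by rewrite yE.
  rewrite lee_fin mulrC -ler_pdivrMr// => H; rewrite leNgt; apply/negP => te.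
  move: H; rewrite (min_l (ltW te)) leNgt gt_max pr /= ltrBlDl -/e => /negP; apply.
  exact: te.
move=> et; have t0 : 0 <= t by rewrite (le_trans _ et)// addr_ge0// ltW.
split => //; rewrite (_ : (\int[_]_(_ in _) _)%E = (r * Num.max 0 (Num.min t e - s))%:E); last
  first.
  rewrite -integral_step//; apply: eq_integral => u; rewrite inE /= in_itv /= => /andP[u0 _].
  by rewrite yE.
by rewrite lee_fin min_r// /e addrAC subrr add0r max_r ?(ltW pr)// mulrC divfK ?gt_eqF.
Qed.

Lemma completion_zero (y : R -> 'rV[R]_n) (j : 'I_n) :
  proc I j = 0 -> (forall t, 0 <= t -> y t 0 j = 0) ->
  finished y j 0 /\ completion y j = 0.
Proof.
move=> p0 y0; suff fE : finished y j = [set t | 0 <= t].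
  by rewrite /completion fE inf_ge; split => //=.
apply/seteqP; split => t /=; rewrite /finished /=; first by case.
move=> t0; split => //; rewrite p0 rmorph0; apply: integral_ge0 => u /=.
by rewrite in_itv /= => /andP[u0 _]; rewrite y0.
Qed.

Lemma schedule_ofE (start rate : 'I_n -> rat) (t : R) (j : 'I_n) :
  schedule_of start rate t 0 j =
  if ratr (start j) <= t < ratr (start j) + ratr (proc I j) / ratr (rate j) then ratr (rate j)
    else 0.
Proof. by rewrite mxE rmorphD fmorph_div. Qed.

Lemma schedule_of_proc0 (start rate : 'I_n -> rat) (t : R) (j : 'I_n) :
  proc I j = 0 -> schedule_of start rate t 0 j = 0.
Proof.
by move=> p0; rewrite schedule_ofE p0 rmorph0 mul0r addr0; case: leP => //= st; rewrite ltNge st.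
Qed.

Hypothesis vI : valid I.

(** Feasibility forces sensible output data: with a rate at most 0 nothing is ever processed, and
    with a negative start the part before time 0 is lost, so the job would never reach its
    requirement. *)
Lemma feasible_schedule_of (J : {set 'I_n}) (start rate : 'I_n -> rat) (j : 'I_n) :
  feasible J (schedule_of start rate : R -> _) -> j \in J -> 0 < proc I j ->
  [/\ 0 <= start j, 0 < rate j &
    completion (schedule_of start rate : R -> _) j = ratr (start j + proc I j / rate j)].
Proof.
have [_ _ _ _ rP] := vI.
move=> [_ yf _] jJ p0; have [[C0 pC] _] := yf j jJ.
move: pC; set C := completion _ _ in C0 *; set y := schedule_of start rate.
have pR : 0 < ratr (proc I j) :> R by rewrite ltr0q.
pose e : R := ratr (start j) + ratr (proc I j) / ratr (rate j).
have -> : (\int[mu]_(u in `[0%R, C]) (y u 0%R j)%:E)%E =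
    (ratr (rate j) * Num.max 0 (Num.min C e - Num.max 0 (ratr (start j))))%:E.
  rewrite -integral_step ?le_max ?lexx//; apply: eq_integral => u; rewrite inE /= in_itv /= =>
    /andP[u0 _].
  by rewrite schedule_ofE ge_max u0.
rewrite lee_fin => H.
have r0 : 0 < rate j.
  rewrite ltNge; apply/negP => rn; move: H; rewrite leNgt => /negP; apply.
  by apply: le_lt_trans pR; rewrite mulr_le0_ge0 ?lerq0// le_max lexx.
have rR : 0 < ratr (rate j) :> R by rewrite ltr0q.
have s0 : 0 <= start j.
  rewrite leNgt; apply/negP => sn; move: H; rewrite leNgt => /negP; apply.
  have sR : ratr (start j) < 0 :> R by rewrite ltrq0.
  rewrite mulrC -ltr_pdivlMr// gt_max divr_gt0//= max_l ?subr0 ?(ltW sR)//.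
  by rewrite gt_min; apply/orP; right; rewrite /e gtrDr.
have sR : 0 <= ratr (start j) :> R by rewrite ler0q.
have [_ cE] := completion_step sR rR p0 (fun t _ => schedule_ofE start rate t j).
by split => //; rewrite /C /y cE rmorphD fmorph_div.
Qed.

(** * Concatenation of schedules *)

Section Concatenation.
Variables (stage : 'I_n -> nat) (nb : nat) (starts rts : nat -> 'I_n -> rat) (len : nat -> rat).
Hypothesis stage_lt : forall j, (stage j < nb)%N.
Hypothesis feas : forall k, feasible [set j | stage j == k]%SET (schedule_of (starts k) (rts k)
  : R -> _).
(** After the last block all rates are zero, but the set of allowed rates need not be downward
    closed. A feasible schedule of no jobs shows that the zero vector is allowed. *)
Hypothesis feas0 : exists start rate, feasible finset.set0 (schedule_of start rate : R ->
  'rV[R]_n).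
Hypothesis len_ge0 : forall k, 0 <= len k.
Hypothesis lenP : forall j, 0 < proc I j ->
  starts (stage j) j + proc I j / rts (stage j) j <= len (stage j).

Definition offset k : rat := \sum_(i <- iota 0 k) len i.
Definition cstart j := offset (stage j) + starts (stage j) j.
Definition crate j := rts (stage j) j.
Let y : R -> 'rV[R]_n := schedule_of cstart crate.

Lemma offsetS k : offset k.+1 = offset k + len k.
Proof. by rewrite /offset -addn1 iotaD big_cat big_seq1. Qed.

Lemma offset_mono k k' : (k <= k')%N -> offset k <= offset k'.
Proof.
move=> /subnKC <-; elim: (_ - _)%N => [|m IH]; first by rewrite addn0.
by rewrite addnS offsetS (le_trans IH)// lerDl.
Qed.

Lemma offset_ge0 k : 0 <= offset k.
Proof. by rewrite sumr_ge0. Qed.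

Lemma proc_cases j : proc I j = 0 \/ 0 < proc I j.
Proof.
have [p0 _ _ _ _] := vI; have := p0 j; rewrite le_eqVlt => /predU1P[<-|]; by [left|right].
Qed.

Lemma part_bounds j : 0 < proc I j -> [/\ 0 <= starts (stage j) j, 0 < crate j,
  0 <= cstart j & cstart j + proc I j / crate j <= offset (stage j).+1].
Proof.
move=> p0; have jJ : j \in [set i | stage i == stage j]%SET by rewrite inE.
have [s0 r0 _] := feasible_schedule_of (feas (stage j)) jJ p0.
split => //; first by rewrite addr_ge0// offset_ge0.
by rewrite offsetS /cstart -addrA lerD2l lenP.
Qed.

Lemma concat_completion j : finished y j (completion y j) /\
  completion y j <= ratr (offset (stage j).+1).
Proof.
case: (proc_cases j) => p0.
  have [f0 ->] := @completion_zero y j p0 (fun t _ => schedule_of_proc0 _ _ t p0).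
  by rewrite ler0q offset_ge0.
have [s0 r0 c0 cb] := part_bounds p0.
have cR : 0 <= ratr (cstart j) :> R by rewrite ler0q.
have rR : 0 < ratr (crate j) :> R by rewrite ltr0q.
have [fE ->] := completion_step cR rR p0 (fun t _ => schedule_ofE cstart crate t j).
by rewrite fE /=; split => //; rewrite -fmorph_div -rmorphD ler_rat.
Qed.

(** Within block k jobs of earlier stages have ended and those of later stages have not started, so
    the rate vector is exactly that of the k-th schedule at the shifted time, where jobs outside its
    stage have rate 0 as well. *)
Lemma concat_rates t : 0 <= t -> rates I (y t).
Proof.
move=> t0.
have zero : rates I 0.
  have [s [r [yr _ y0]]] := feas0; have := yr t t0.
  by rewrite (_ : schedule_of s r t = 0)//; apply/rowP => j; rewrite [RHS]mxE y0 ?finset.in_set0.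
have before j k : (stage j < k)%N -> ratr (offset k) <= t -> y t 0 j = 0.
  move=> jk kt; case: (proc_cases j) => p0; first exact: schedule_of_proc0.
  have [_ r0 c0 cb] := part_bounds p0.
  rewrite schedule_ofE ifN// negb_and -!ltNge -leNgt; apply/orP; right.
  by rewrite -fmorph_div -rmorphD (le_trans _ kt)// ler_rat (le_trans cb)// offset_mono.
have [tn|nt] := ltP t (ratr (offset nb)); last first.
  rewrite (_ : y t = 0)//; apply/rowP => j; rewrite [RHS]mxE; exact: before (stage_lt j) nt.
have ex : exists k, t < ratr (offset k) by exists nb.
(* The block containing [t] ends at the first offset beyond [t]; offset 0 is time 0 and is
   excluded. *)
case: (ex_minnP ex) => -[|k] tk kmin; first by move: tk; rewrite /offset big_nil rmorph0 ltNge t0.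
have kt : ratr (offset k) <= t by rewrite leNgt; apply/negP => /kmin; rewrite ltnn.
have tk0 : 0 <= t - ratr (offset k) by rewrite subr_ge0.
have [yr _ y0] := feas k.
rewrite (_ : y t = schedule_of (starts k) (rts k) (t - ratr (offset k))); first exact: yr.
apply/rowP => j; have [jk|jk] := eqVneq (stage j) k.
  rewrite !schedule_ofE /cstart /crate jk rmorphD lerBrDl ltrBlDl.
  by rewrite addrA.
rewrite (y0 j)//; last by rewrite inE.
case: (ltngtP (stage j) k) jk => // jk _; first exact: before jk kt.
case: (proc_cases j) => p0; first exact: schedule_of_proc0.
have [s0 r0 c0 cb] := part_bounds p0.
rewrite schedule_ofE ifN// negb_and -!ltNge; apply/orP; left.
by rewrite (lt_le_trans tk)// ler_rat /cstart (le_trans (offset_mono jk))// lerDl.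
Qed.

Lemma concat_feasible : feasible [set: 'I_n]%SET y.
Proof.
split; first exact: concat_rates.
  move=> j _; have [fj _] := concat_completion j; split => //.
  case: (proc_cases j) => p0.
    exists 0, 0; split => // t t0; rewrite [LHS]schedule_of_proc0//.
    by case: ifP.
  have [s0 r0 c0 cb] := part_bounds p0.
  exists (ratr (cstart j)), (ratr (crate j)); rewrite ler0q; split => // t t0.
  have cR : 0 <= ratr (cstart j) :> R by rewrite ler0q.
  have rR : 0 < ratr (crate j) :> R by rewrite ltr0q.
  have [_ ->] := completion_step cR rR p0 (fun t _ => schedule_ofE cstart crate t j).
  by rewrite schedule_ofE.
by move=> j; rewrite finset.in_setT.
Qed.

End Concatenation.
End Schedule.
End StepFunctions.

(** * Instances as inputs *)

Lemma nth_best_lt N x j : (nth 0%N (best N x) j < size (stages x))%N.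
Proof.
move: j.
have szE : size (stages x) = (size (fuel x)).+2 by rewrite /stages /indices size_iota.
have key (F : nat -> nat) : (forall j, (F j < (size (fuel x)).+2)%N) ->
    forall j, (nth 0%N [seq F j | j <- jobs x] j < (size (fuel x)).+2)%N.
  move=> HF j; have [js|sj] := ltnP j (size (jobs x)).
    by rewrite (nth_map 0%N).
  by rewrite nth_default// size_map.
rewrite szE /best.
have : {in candidates N x, forall c, forall j, (nth 0%N c j < (size (fuel x)).+2)%N}.
  move=> c /flatten_mapP[g _ /flatten_mapP[i _ /mapP[s _ ->]]].
  apply: key => j; rewrite /stage; case: ifP => // _; rewrite !ltnS.
  by apply: leq_trans (find_size _ _) _; rewrite size_iota.
elim: (candidates N x) => [_|c s IH H] /=.
  by apply: key => j; case: ifP.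
case: ifP => _; first exact: H (mem_head _ _).
by apply: IH => d ds; apply: H; rewrite inE ds orbT.
Qed.

Section Instances.
Variable R : realType.

Definition bits n (A : {set 'I_n}) : seq bool := [seq j \in A | j <- enum 'I_n].

(** Arranged so that its encoding is literally [enc_instance I] and reading the input is the
    identity program; the final [Leaf 0] is the end of the outer list. *)
Definition raw_of (I : instance R) : raw :=
  ([seq proc I j | j <- enum 'I_(njobs I)],
   ([seq (bits A, weight I A) | A <- enum (groups I)],
    ([seq [seq bmat I d j | j <- enum 'I_(njobs I)] | d <- enum 'I_(nrows I)],
     Pair (rates_code I) (Leaf 0)))).

Lemma encode_bits n (A : {set 'I_n}) : encode (bits A) = enc_set A.
Proof. by rewrite /encode /enc_seq -map_comp. Qed.

Lemma encode_seqE A (EA : Enc A) (s : seq A) : encode s = enc_list (map encode s).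
Proof. by []. Qed.

Lemma encode_pairE A B (EA : Enc A) (EB : Enc B) (p : A * B) :
  encode p = Pair (encode p.1) (encode p.2).
Proof. by []. Qed.

Lemma encode_raw_of I : encode (raw_of I) = enc_instance I.
Proof.
rewrite /raw /enc_instance /= !encode_pairE /= !encode_seqE -!map_comp.
congr (Pair _ (Pair (enc_list _) (Pair (enc_list _) _))); apply: eq_map => i /=.
  by rewrite encode_pairE /= encode_bits.
by rewrite encode_seqE -map_comp.
Qed.

Section Raw.
Variable I : instance R.
Let x := raw_of I.
Local Notation n := (njobs I).

Lemma jobsE : jobs x = iota 0 n.
Proof. by rewrite /jobs /indices size_map size_enum_ord. Qed.

Lemma machinesE : machines x = iota 0 (nrows I).
Proof. by rewrite /machines /indices size_map size_enum_ord. Qed.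

Lemma clientsE : clients x = iota 0 #|groups I|.
Proof. by rewrite /clients /indices size_map -cardE. Qed.

Lemma nth_proc (j : 'I_n) : nth 0 x.1 j = proc I j.
Proof. by rewrite (nth_map j) ?size_enum_ord// nth_ord_enum. Qed.

Lemma demandE (d : 'I_(nrows I)) (j : 'I_n) : demand x d j = bmat I d j * proc I j.
Proof.
rewrite /demand nth_proc; congr (_ * _).
by rewrite (nth_map d) ?size_enum_ord// nth_ord_enum (nth_map j) ?size_enum_ord// nth_ord_enum.
Qed.

Definition group s : {set 'I_n} := nth finset.set0 (enum (groups I)) s.

Lemma memberE s (j : 'I_n) : (s < #|groups I|)%N -> member x s j = (j \in group s).
Proof.
move=> sg; rewrite /member (nth_map finset.set0) -?cardE//=.
by rewrite (nth_map j) ?size_enum_ord// nth_ord_enum.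
Qed.

Lemma wtE s : (s < #|groups I|)%N -> wt x s = weight I (group s).
Proof. by move=> sg; rewrite /wt (nth_map finset.set0) -?cardE. Qed.

Lemma sum_clients (V : nmodType) (F : {set 'I_n} -> V) :
  \sum_(s <- clients x) F (group s) = \sum_(S in groups I) F S.
Proof.
rewrite -big_enum clientsE cardE /group.
by rewrite (big_nth finset.set0) /index_iota subn0.
Qed.

Lemma big_iota_ord (V : Type) (idx : V) (op : V -> V -> V) m (F : nat -> V) :
  \big[op/idx]_(i <- iota 0 m) F i = \big[op/idx]_(i < m) F i.
Proof. by rewrite -(big_mkord xpredT F) /index_iota subn0. Qed.

Hypothesis vI : valid I.

Lemma demand_raw_ge0 d j : 0 <= demand x d j.
Proof.
have [p0 _ b0 _ _] := vI.
have [dn|dn] := ltnP d (nrows I); last first.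
  have rd : nth [::] x.2.2.1 d = [::] by rewrite nth_default// size_map size_enum_ord.
  by rewrite /demand rd nth_nil mul0r.
have [jn|jn] := ltnP j n; last first.
  by rewrite /demand [nth 0 x.1 j]nth_default ?mulr0// size_map size_enum_ord.
by have := demandE (Ordinal dn) (Ordinal jn) => /= ->; rewrite mulr_ge0.
Qed.

Lemma wt_raw_gt0 s : s \in clients x -> 0 < wt x s.
Proof.
rewrite clientsE mem_iota => /andP[_ sg]; rewrite wtE//; have [_ w0 _ _ _] := vI.
by apply: w0; rewrite -mem_enum mem_nth// -cardE.
Qed.

Lemma best_objective N (y : R -> 'rV[R]_n) : (1 < N)%N ->
  feasible [set: 'I_n]%SET y ->
  ratr (cost x (best N x)) <=
    2 * (1 + 7 * N%:R^-1) ^+ 2 * (1 + N%:R^-1) ^+ 2 * (1 + N%:R^-1) ^+ N * objective y.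
Proof.
move=> N1 fy.
pose C (j : nat) : R := if insub j is Some i then completion y i else 0.
have CE (j : 'I_n) : C j = completion y j by rewrite /C valK.
pose Cs s := group_completion y (group s).
have -> : objective y = \sum_(s <- clients x) ratr (wt x s) * Cs s.
  rewrite /objective -sum_clients big_seq [RHS]big_seq; apply: eq_bigr => s.
  by rewrite clientsE mem_iota => /andP[_ sg]; rewrite wtE.
apply: (@best_bound R N x C Cs N1).
- exact: demand_raw_ge0.
- exact: wt_raw_gt0.
- by move=> s; rewrite /Cs /group_completion bigmax_ge_id.
- move=> s j; rewrite clientsE jobsE !mem_iota !add0n => /andP[_ sg] /andP[_ jn].
  rewrite -[j]/(nat_of_ord (Ordinal jn)) memberE// CE /Cs => js.
  exact: le_bigmax_cond.
move=> d tau; rewrite machinesE jobsE mem_iota add0n => /andP[_ dn] tau0.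
rewrite big_mkcond big_iota_ord -big_mkcond /=.
rewrite -(ler_rat R) rmorph_sum /=.
have tauR : 0 <= ratr tau :> R by rewrite ler0q.
apply: le_trans (feasible_load (Ordinal dn) vI fy tauR).
rewrite le_eqVlt; apply/orP; left; apply/eqP; apply: eq_big => j; first by rewrite CE.
by move=> _; rewrite -demandE.
Qed.

End Raw.
End Instances.

Lemma ratr_rmax_le (R : realType) A (s : seq A) (F : A -> rat) (B : R) :
  0 <= B -> (forall i, ratr (F i) <= B) -> ratr (rmax s F) <= B.
Proof.
move=> B0 FB; rewrite /rmax; elim/big_ind: _ => // [|u v uB vB]; first by rewrite rmorph0.
by rewrite /Num.max; case: ifP.
Qed.

Lemma rmax_ge (A : eqType) (s : seq A) (F : A -> rat) i : i \in s -> F i <= rmax s F.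
Proof.
rewrite /rmax; elim: s => //= j s IH; rewrite inE big_cons le_max.
by case/predU1P => [->|/IH ->]; rewrite ?lexx ?orbT.
Qed.

Lemma sum_iota_lt (V : nmodType) m n (F : nat -> V) : (m <= n)%N ->
  \sum_(k <- iota 0 n) (if (k < m)%N then F k else 0) = \sum_(k <- iota 0 m) F k.
Proof.
move=> mn; rewrite -(subnKC mn) iotaD big_cat /=.
have -> : \sum_(k <- iota (0 + m) (n - m)) (if (k < m)%N then F k else 0) = 0.
  by rewrite big_seq big1// => k; rewrite mem_iota add0n => /andP[mk _]; rewrite ltnNge mk.
rewrite addr0 big_seq [RHS]big_seq; apply: eq_bigr => k.
by rewrite mem_iota => /andP[_ ->].
Qed.

(** * The complete program and its guarantee *)

Section Output.
Variables (R : realType) (K : set (instance R)) (rho : R).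
Hypothesis KV : K `<=` @valid R.

(** Polynomial time is stated for all values of a type, so the class [K] is turned into a type. *)
Definition member_instance := {I : instance R | K I}.
Instance enc_member : Enc member_instance := fun I => enc_instance (sval I).

Definition raw_inst (I : member_instance) : raw := raw_of (sval I).

Lemma polytime_raw_inst : polytime raw_inst.
Proof.
apply: (@polytime_prim _ _ _ _ _ PId 'X) => [I|I]; first by rewrite encode_raw_of.
by rewrite hornerX /vsz encode_raw_of.
Qed.

(** Bit lists of any length denote sets, absent bits counting as false; in particular [[::]] denotes
    the empty set. *)
Definition set_of n (bs : seq bool) : {set 'I_n} := [set j | nth false bs (nat_of_ord j)]%SET.

Definition solves_part (I : instance R) (J : {set 'I_(njobs I)}) (sched : seq (rat * rat)) :=
  exists start rate : 'I_(njobs I) -> rat,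
    [/\ sched = [seq (start j, rate j) | j <- enum 'I_(njobs I)],
        feasible J (schedule_of start rate : R -> _) &
        makespan J (schedule_of start rate : R -> _) <= rho * ratr (max_load J)].

Lemma enc_scheduleE n (start rate : 'I_n -> rat) :
  enc_schedule start rate = encode [seq (start j, rate j) | j <- enum 'I_n].
Proof. by rewrite encode_seqE -map_comp. Qed.

(** Choosing one guaranteed output per input turns the subroutine into a function, which can then be
    composed like any other polynomial-time building block. *)
Lemma subroutine_function f : makespan_subroutine K rho f ->
  exists2 F : member_instance * seq bool -> seq (rat * rat),
    polytime F & forall p, solves_part (set_of (njobs (sval p.1)) p.2) (F p).
Proof.
move=> [q Hf].
pose rel (p : member_instance * seq bool) (s : seq (rat * rat)) :=
  solves_part (set_of (njobs (sval p.1)) p.2) s /\ exists t,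
    exec f (Pair (enc_instance (sval p.1)) (enc_set (set_of (njobs (sval p.1)) p.2))) (@encode
      _ (@enc_seq _ (@enc_prod _ _ enc_rat enc_rat)) s) t /\
    (t <= q.[vsize (Pair (enc_instance (sval p.1)) (enc_set (set_of (njobs (sval p.1)) p.2)))])%N.
have /choice[F FP] : forall p, exists s, rel p s.
  move=> [[I KI] bs].
  have [v [t [ev tq [y [[start [rate [vE yE]]] fy my]]]]] :=
    Hf (existT (fun I : instance R => {set 'I_(njobs I)}) I (set_of _ bs)) KI.
  exists [seq (start j, rate j) | j <- enum 'I_(njobs I)]; split.
    by exists start, rate; rewrite -yE.
  by exists t; rewrite -enc_scheduleE -vE.
exists F => [|p]; last by case: (FP p).
(* The subroutine is specified on encodings of sets only, so the bit list is first cut or padded to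
   one bit per job. *)
pose G (p : member_instance * seq bool) := (p.1, [seq nth false p.2 j | j <- jobs (raw_inst
  p.1)]).
have GE p : encode (G p) = Pair (enc_instance (sval p.1)) (enc_set (set_of (njobs (sval p.1))
  p.2)).
  rewrite encode_pairE -encode_bits; congr Pair; congr encode.
  rewrite /= jobsE -val_enum_ord -map_comp; apply: eq_map => j /=.
  by rewrite inE.
have pG : polytime G.
  by rewrite /G; solve_polytime using first [ call1 jobs polytime_jobs | call1 raw_inst
    polytime_raw_inst ].
apply: (polytime_after pG); exists f, q => p.
by have [_ [t [et tq]]] := FP p; exists t; rewrite /vsz GE.
Qed.

Section Program.
Variables (N : nat) (F : member_instance * seq bool -> seq (rat * rat)).
Hypothesis pF : polytime F.
Hypothesis FP : forall p, solves_part (set_of (njobs (sval p.1)) p.2) (F p).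

Definition stages_of (I : member_instance) : seq nat := best N (raw_inst I).
Definition part (I : member_instance) (k : nat) : seq (rat * rat) :=
  F (I, [seq nth 0%N (stages_of I) j == k | j <- jobs (raw_inst I)]).
(** The algorithm has no access to the real number [rho], so the length of a block is read off the
    schedule returned. Jobs of requirement 0 are skipped, as their start and rate may be
    arbitrary. *)
Definition part_length (I : member_instance) (k : nat) : rat :=
  rmax (jobs (raw_inst I)) (fun j =>
    if (nth 0%N (stages_of I) j == k) && (nth 0 (raw_inst I).1 j != 0) then
      (nth (0, 0) (part I k) j).1 + nth 0 (raw_inst I).1 j / (nth (0, 0) (part I k) j).2
    else 0).
Definition output (I : member_instance) : seq (rat * rat) :=
  [seq (rsum (stages (raw_inst I))
          (fun k => if (k < nth 0%N (stages_of I) j)%N then part_length I k else 0) +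
        (nth (0, 0) (part I (nth 0%N (stages_of I) j)) j).1,
        (nth (0, 0) (part I (nth 0%N (stages_of I) j)) j).2) | j <- jobs (raw_inst I)].

Lemma polytime_stages_of : polytime stages_of.
Proof.
by rewrite /stages_of; solve_polytime using first [ call1 (best N) (polytime_best N)
  | call1 raw_inst polytime_raw_inst ].
Qed.

Ltac insts := first [ call1 jobs polytime_jobs | call1 raw_inst polytime_raw_inst
  | call1 stages_of polytime_stages_of | call1 F pF ].

Lemma polytime_part : polytime (fun p : member_instance * nat => part p.1 p.2).
Proof. by rewrite /part; solve_polytime using first [ insts ]. Qed.

Lemma polytime_part_length : polytime (fun p : member_instance * nat => part_length p.1 p.2).
Proof.
by rewrite /part_length; solve_polytime using first [ insts | call2 part polytime_part ].
Qed.

Lemma polytime_output : polytime output.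
Proof.
by rewrite /output; solve_polytime using first [ insts | call2 part polytime_part
  | call2 part_length polytime_part_length | call1 stages polytime_stages ].
Qed.

Section Correct.
Variable I : member_instance.
Let x := raw_inst I.
Let n := njobs (sval I).
Let stg (j : 'I_n) : nat := nth 0%N (stages_of I) j.
Let vI : valid (sval I). Proof. exact: KV (svalP I). Qed.

Lemma stages_lt (j : nat) : (nth 0%N (stages_of I) j < size (stages x))%N.
Proof. exact: nth_best_lt. Qed.

Lemma stagesE : stages x = iota 0 (size (stages x)).
Proof. by rewrite /stages /indices size_iota. Qed.

Lemma part_set k :
  set_of n [seq nth 0%N (stages_of I) j == k | j <- jobs x] = [set j | stg j == k]%SET.
Proof.
apply/setP => j; rewrite !inE (nth_map 0%N) ?jobsE ?size_iota//.
by rewrite nth_iota.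
Qed.

Lemma part_solution : exists starts rts : nat -> 'I_n -> rat, forall k,
  [/\ part I k = [seq (starts k j, rts k j) | j <- enum 'I_n],
      feasible [set j | stg j == k]%SET (schedule_of (starts k) (rts k) : R -> _) &
      makespan [set j | stg j == k]%SET (schedule_of (starts k) (rts k) : R -> _) <=
        rho * ratr (max_load [set j | stg j == k]%SET)].
Proof.
have /choice[g gP] : forall k, exists sr : ('I_n -> rat) * ('I_n -> rat),
  [/\ part I k = [seq (sr.1 j, sr.2 j) | j <- enum 'I_n],
      feasible [set j | stg j == k]%SET (schedule_of sr.1 sr.2 : R -> _) &
      makespan [set j | stg j == k]%SET (schedule_of sr.1 sr.2 : R -> _) <=
        rho * ratr (max_load [set j | stg j == k]%SET)].
  move=> k; have := FP (I, [seq nth 0%N (stages_of I) j == k | j <- jobs x]).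
  rewrite part_set => -[s [r [H1 H2 H3]]]; by exists (s, r).
by exists (fun k => (g k).1), (fun k => (g k).2).
Qed.

Lemma empty_solution : exists start rate : 'I_n -> rat,
  feasible finset.set0 (schedule_of start rate : R -> 'rV[R]_n).
Proof.
have [s [r [_ H _]]] := FP (I, [::]); exists s, r.
rewrite (_ : finset.set0 = set_of n [::])//.
by apply/setP => j; rewrite !inE nth_nil.
Qed.

Lemma max_loadE k : max_load [set j | stg j == k]%SET = load x (stages_of I) k.
Proof.
rewrite /max_load /load /rmax machinesE big_iota_ord; apply: eq_bigr => d _.
rewrite /rsum jobsE big_iota_ord big_mkcond; apply: eq_bigr => j _.
by rewrite inE demandE.
Qed.

(** A job ends by the offset following its stage, and the length of a stage is at most [rho] times
    its load. *)
Lemma output_correct : 0 <= rho -> exists y : R -> 'rV[R]_n,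
  [/\ outputs_schedule (encode (output I)) y, feasible [set: 'I_n]%SET y &
      objective y <= rho * ratr (cost x (stages_of I))].
Proof.
move=> rho0; have [starts [rts srP]] := part_solution.
have [p0 w0 _ _ _] := vI.
have partE k (j : 'I_n) : nth (0, 0) (part I k) j = (starts k j, rts k j).
  by have [-> _ _] := srP k; rewrite (nth_map j) ?size_enum_ord// nth_ord_enum.
have feas k : feasible [set j | stg j == k]%SET (schedule_of (starts k) (rts k) : R -> _).
  by case: (srP k).
pose len k := part_length I k.
have len0 k : 0 <= len k by exact: rmax_ge0.
have lenP j : 0 < proc (sval I) j -> starts (stg j) j + proc (sval I) j / rts (stg j) j <= len
  (stg j).
  move=> pj; have := @rmax_ge _ (jobs x) (fun j0 : nat =>
    if (nth 0%N (stages_of I) j0 == stg j) && (nth 0 x.1 j0 != 0) then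
      (nth (0, 0) (part I (stg j)) j0).1 + nth 0 x.1 j0 / (nth (0, 0) (part I (stg j)) j0).2
    else 0) (nat_of_ord j).
  rewrite jobsE mem_iota ltn_ord => /(_ isT); rewrite eqxx nth_proc (gt_eqF pj) partE /=.
  by rewrite /len /part_length jobsE.
have len_load k : ratr (len k) <= rho * ratr (load x (stages_of I) k).
  have B0 : 0 <= rho * ratr (load x (stages_of I) k) :> R by rewrite mulr_ge0// ler0q rmax_ge0.
  apply: ratr_rmax_le => // i; case: ifP => [/andP[sk pi]|_]; last by rewrite rmorph0.
  have [jn|jn] := ltnP i n; last first.
    by move: pi; rewrite nth_default ?eqxx// size_map size_enum_ord.
  set j := Ordinal jn; rewrite -[i]/(nat_of_ord j) in sk pi *.
  rewrite nth_proc in pi; rewrite nth_proc partE /=.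
  have pj : 0 < proc (sval I) j by rewrite lt_def pi p0.
  have jJ : j \in [set j | stg j == k]%SET by rewrite inE.
  have [_ _ <-] := feasible_schedule_of vI (feas k) jJ pj.
  rewrite -max_loadE; have [_ _ mk] := srP k; apply: le_trans mk.
  exact: le_bigmax_cond.
pose start := cstart stg starts len; pose rate := crate stg rts.
exists (schedule_of start rate); split.
- exists start, rate; split => //; rewrite enc_scheduleE; congr encode.
  rewrite /output jobsE -val_enum_ord -map_comp; apply: eq_map => j /=.
  rewrite partE /=; congr (_ + _, _).
  by rewrite /offset stagesE /rsum sum_iota_lt// ltnW// stages_lt.
- exact: (concat_feasible vI (fun j => stages_lt j) feas empty_solution len0 lenP).
rewrite /objective -sum_clients /cost /rsum rmorph_sum /= mulr_sumr.
rewrite big_seq [leRHS]big_seq; apply: ler_sum => s; rewrite clientsE mem_iota => /andP[_ sg].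
rewrite wtE// rmorphM mulrCA ler_wpM2l//=.
  by rewrite ler0q ltW// w0// -mem_enum mem_nth// -cardE.
have load0 k : 0 <= load x (stages_of I) k by exact: rmax_ge0.
apply: bigmax_le => [|j js].
  by rewrite mulr_ge0// ler0q sumr_ge0// => k _; case: ifP.
have [_ cj] := concat_completion vI feas len0 lenP j.
apply: (le_trans cj); rewrite /offset rmorph_sum /=.
apply: (@le_trans _ _ (\sum_(k <- iota 0 (stg j).+1) rho * ratr (load x (stages_of I) k))).
  by apply: ler_sum.
rewrite -mulr_sumr ler_wpM2l// -rmorph_sum ler_rat stagesE -(@sum_iota_lt _ _ (size (stages
  x))) ?stages_lt//.
(* Job [j] itself witnesses that the group is charged for each stage up to its own. *)
apply: ler_sum => k _; rewrite ltnS; case: ifP => kj; last by case: ifP.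
rewrite ifT//; apply/hasP; exists (nat_of_ord j); first by rewrite jobsE mem_iota ltn_ord.
by rewrite memberE// js.
Qed.

End Correct.
End Program.

Lemma approximation (N : nat) (beta : R) f : (1 < N)%N -> 1 <= rho ->
  makespan_subroutine K rho f ->
  rho * (2 * (1 + 7 * N%:R^-1) ^+ 2 * (1 + N%:R^-1) ^+ 2 * (1 + N%:R^-1) ^+ N) <= beta ->
  exists g, approximation_algorithm K beta g.
Proof.
move=> N1 rho1 /subroutine_function[F pF FP] Hbeta.
have rho0 : 0 <= rho by rewrite (le_trans ler01).
set c := 2 * _ * _ * _ in Hbeta.
have c0 : 0 < c by rewrite /c !mulr_gt0// exprn_gt0// ltr_wpDr ?mulr_ge0 ?invr_ge0.
have beta0 : 0 < beta by rewrite (lt_le_trans _ Hbeta)// mulr_gt0// (lt_le_trans ltr01).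
have [g [q gP]] := polytime_output N pF.
exists g, q => I KI; pose I' : member_instance := exist _ I KI.
have [t [et tq]] := gP I'; exists (encode (output N F I')), t; split => //.
have [y [oy fy yc]] := output_correct N FP I' rho0.
exists y; split => //.
(* The optimum is an infimum, possibly not attained, so the output is compared with every feasible
   schedule. *)
rewrite mulrC -ler_pdivrMr//; apply: lb_le_inf; first by exists (objective y), y.
move=> _ [z fz <-]; rewrite ler_pdivrMr// mulrC.
have obj0 : 0 <= objective z.
  have [_ w0 _ _ _] := KV KI.
  rewrite sumr_ge0// => S SG; rewrite mulr_ge0 ?ler0q ?(ltW (w0 _ SG))//.
  by rewrite bigmax_ge_id.
apply: (le_trans yc); apply: (@le_trans _ _ (rho * (c * objective z))).
  by rewrite ler_wpM2l// best_objective//; exact: KV KI.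
by rewrite mulrA ler_wpM2r.
Qed.

End Output.

Theorem theorem3 (R : realType) (K : set (instance R)) (rho : R) :
  K `<=` @valid R ->
  1 <= rho ->
  (exists f : prog, makespan_subroutine K rho f) ->
  forall eps : R, 0 < eps ->
    exists g : prog, approximation_algorithm K (2 * rho * expR 1 + eps) g.
Proof.
move=> KV rho1 [f fP] eps eps0.
have rho0 : 0 < rho by exact: lt_le_trans rho1.
have e0 : 0 < expR 1 :> R by exact: expR_gt0.
pose A := 2 * rho * expR 1.
have A0 : 0 < A by rewrite !mulr_gt0.
(* For u = 1 / N with N >= 7 the two squares are at most 1 + 21 u and 1 + 3 u. Their product is at
   most 1 + 87 u, so 105 is generous, and N above 105 A / eps makes the excess at most eps. *)
pose N := (7 + Num.bound (105 * A / eps))%N.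
have NA : 105 * A / eps < N%:R.
  apply: lt_le_trans (_ : (Num.bound (105 * A / eps))%:R <= _); last by rewrite ler_nat /N; lia.
  by rewrite archi_boundP// divr_ge0// ?ltW// mulr_gt0.
have N0 : 0 < N%:R :> R by rewrite ltr0n.
apply: (approximation (N := N) KV _ rho1 fP) => //.
set u := N%:R^-1; have u0 : 0 < u by rewrite invr_gt0.
have u7 : 7 * u <= 1 by rewrite -ler_pdivlMr// mul1r invrK ler_nat.
have uA : A * (105 * u) <= eps.
  move: NA; rewrite ltr_pdivrMr// => /ltW NA.
  by rewrite mulrA /u ler_pdivrMr// (mulrC A) (mulrC eps).
have exp1 : (1 + u) ^+ N <= expR 1.
  have -> : expR 1 = expR u ^+ N :> R by rewrite -expRM_natl mulfV// gt_eqF.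
  by rewrite lerXn2r ?nnegrE ?expR_ge0 ?addr_ge0 ?(ltW u0)// expR_ge1Dx.
have sq : (1 + 7 * u) ^+ 2 * (1 + u) ^+ 2 <= 1 + 105 * u.
  have uu : u * u <= u by rewrite ler_piMr ?(ltW u0)//; lra.
  have uu0 : 0 <= u * u by rewrite mulr_ge0 ?(ltW u0).
  have h1 : (1 + 7 * u) ^+ 2 <= 1 + 21 * u.
    have : 0 <= u * (1 - 7 * u) by rewrite mulr_ge0 ?(ltW u0)//; lra.
    rewrite sqrrD expr1n expr2; lra.
  have h2 : (1 + u) ^+ 2 <= 1 + 3 * u by rewrite sqrrD expr1n expr2; lra.
  apply: le_trans (ler_pM _ _ h1 h2) _; rewrite ?exprn_ge0//; try lra.
have -> : rho * (2 * (1 + 7 * u) ^+ 2 * (1 + u) ^+ 2 * (1 + u) ^+ N) =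
    2 * rho * (1 + u) ^+ N * ((1 + 7 * u) ^+ 2 * (1 + u) ^+ 2) by ring.
apply: (@le_trans _ _ (A * (1 + 105 * u))); last by rewrite mulrDr mulr1 lerD2l.
apply: ler_pM => //.
- by apply: mulr_ge0; [rewrite mulr_ge0// ltW|apply: exprn_ge0; lra].
- by apply: mulr_ge0; apply: exprn_ge0; lra.
by rewrite /A ler_wpM2l// mulr_ge0// ltW.
Qed.
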